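(* Let $\mathcal E$ be the elliptic $U(2)$ dynamical quantum group, let $\langle\cdot,\cdot\rangle:\mathcal E^{\mathrm{cop}}\times\mathcal E\to D_{\mathfrak h^*}$ be its cobraiding, and let $t^N_{kj}(z)$ be the matrix elements of its irreducible corepresentations (all defined in the context). For $M,N\in\mathbb N$, $r,s\in\{0,\dots,M\}$ and $k,j\in\{0,\dots,N\}$, $$\langle t^M_{rs}(w),t^N_{kj}(z)\rangle=\delta_{s+j,r+k}\;C\;{}_{12}V_{11}\bigl(q^{2(\lambda+M-2s-r+1)};q^{-2r},q^{-2s},q^{2(\lambda-s+1)},q^{2(\lambda+M+N-k-s-r+2)},q^{2(\lambda+M-k-s-r+1)},q^{2(k-s)}z/w,q^{2(M-N+k-s+1)}w/z\bigr)\,T_{N+M-2s-2j},$$ where $$C=(-1)^{M-r-s}q^{(M-r-s)(\lambda-s+1)}\,\frac{(q^{2(M-r-s+1)},\,q^{2(k-s+1)},\,q^{2(\lambda+M-s-k-r+2)}w/z)_s}{(q^2,\,q^{2(\lambda+M-2s-r+2)},\,q^{2(M-r-s+1)}w/z)_s}$$ $$\times\frac{(q^{2(N-k+s-r+1)},\,q^{2(-\lambda-N+k+s)}w/z)_r}{(q^{-2(\lambda+M-2s)},\,q^{2(M-r+1)}w/z)_r}\cdot\frac{(q^{2(k+s+r-\lambda-M)},\,q^{2(s-k+1)}w/z)_{M-r-s}}{(q^{2(\lambda-s+1)},\,q^2w/z)_{M-r-s}},$$ the functions of $\lambda$ being considered as elements of $M_{\mathfrak h^*}$ (multiplication operators in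 $D_{\mathfrak h^*}$).
   Context: SPECIAL FUNCTIONS. $0<q<1$, $0<p<1$; $\theta(z)=\prod_{i\ge0}(1-zp^i)(1-p^{i+1}/z)$ for $z\neq0$; $\theta(a_1,\dots,a_r)=\prod_i\theta(a_i)$; $(a)_n=\prod_{i=0}^{n-1}\theta(aq^{2i})$ for $n\ge0$, with the standard extension $(a)_{-n}=1/(aq^{-2n})_n$; $(a_1,\dots,a_k)_n=\prod_i(a_i)_n$; $\begin{bmatrix}k\\ l\end{bmatrix}=\prod_{i=1}^l\frac{\theta(q^{2(k-l+i)})}{\theta(q^{2i})}$. The very-well-poised elliptic hypergeometric series is $${}_{r+1}V_r(a_1;a_6,\dots,a_{r+1})=\sum_{n=0}^\infty\frac{\theta(a_1q^{4n})}{\theta(a_1)}\frac{q^{2n}(a_1,a_6,a_7,\dots,a_{r+1})_n}{(q^2,q^2a_1/a_6,q^2a_1/a_7,\dots,q^2a_1/a_{r+1})_n},$$ assuming the elliptic balancing condition $(a_6a_7\cdots a_{r+1})^2q^4=(a_1q^2)^{r-5}$. All such series considered are terminating (here because of the parameters $q^{-2r}$, $q^{-2s}$). GENERAL NOTIONS. $\mathfrak h\cong\mathfrak h^*\cong\mathbb C$; $M_{\mathfrak h^*}$ is the field of meromorphic functions on $\mathfrak h^*$; $(T_\alpha f)(\lambda)=f(\lambda+\alpha)$. An $\mathfrak h$-algebra is a bigraded unital associative algebra $\mathcal A=\bigoplus_{\alpha,\beta}\mathcal A_{\alpha\beta}$ with algebra embeddings $\mu_l,\mu_r:M_{\mathfrak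 h^*}\to\mathcal A_{00}$ (moment maps) with commuting images and $\mu_l(f)a=a\mu_l(T_\alpha f)$, $\mu_r(f)a=a\mu_r(T_\beta f)$ for $a\in\mathcal A_{\alpha\beta}$. $D_{\mathfrak h^*}$ is the $\mathfrak h$-algebra of finite difference operators $\sum_if_iT_{\alpha_i}$ on $M_{\mathfrak h^*}$ with $fT_{-\alpha}\in(D_{\mathfrak h^*})_{\alpha\alpha}$, $(D_{\mathfrak h^*})_{\alpha\beta}=0$ for $\alpha\ne\beta$, both moment maps sending $f$ to multiplication by $f$. $\mathcal A\widetilde\otimes\mathcal B$ has $(\mathcal A\widetilde\otimes\mathcal B)_{\alpha\beta}=\bigoplus_\gamma\mathcal A_{\alpha\gamma}\otimes\mathcal B_{\gamma\beta}$ modulo $\mu_r^{\mathcal A}(f)a\otimes b=a\otimes\mu_l^{\mathcal B}(f)b$, with moment maps $\mu_l\otimes1$, $1\otimes\mu_r$ and componentwise product. An $\mathfrak h$-bialgebroid is an $\mathfrak h$-algebra with a coassociative comultiplication $\Delta:\mathcal A\to\mathcal A\widetilde\otimes\mathcal A$ and counit $\varepsilon:\mathcal A\to D_{\mathfrak h^*}$ (satisfying the counit axiom under $\mathcal A\widetilde\otimes D_{\mathfrak h^*}\cong\mathcal A\cong D_{\mathfrak h^*}\widetilde\otimes\mathcal A$) that are algebra homomorphisms preserving moment maps and bigrading. $\mathcal A^{\mathrm{cop}}$ has the same algebra structure, interchanged moment maps, $(\mathcal A^{\mathrm{cop}})_{\alpha\beta}=\mathcal A_{\beta\alpha}$, flipped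 comultiplication and the same counit. A pairing of $\mathfrak h$-bialgebroids is a $\mathbb C$-bilinear map $\mathcal U\times\mathcal A\to D_{\mathfrak h^*}$ with: $\langle\mathcal U_{\alpha\beta},\mathcal A_{\gamma\delta}\rangle\subseteq(D_{\mathfrak h^*})_{\alpha+\delta,\beta+\gamma}$; $\langle\mu_l^{\mathcal U}(f)X,a\rangle=\langle X,\mu_l^{\mathcal A}(f)a\rangle=f\circ\langle X,a\rangle$; $\langle X\mu_r^{\mathcal U}(f),a\rangle=\langle X,a\mu_r^{\mathcal A}(f)\rangle=\langle X,a\rangle\circ f$; $\langle XY,a\rangle=\sum\langle X,a_{(1)}\rangle T_\rho\langle Y,a_{(2)}\rangle$ with $a_{(1)}\in\mathcal A_{\gamma\rho}$; $\langle X,ab\rangle=\sum\langle X_{(1)},a\rangle T_\rho\langle X_{(2)},b\rangle$ with $X_{(1)}\in\mathcal U_{\alpha\rho}$; $\langle X,1\rangle=\varepsilon^{\mathcal U}(X)$, $\langle1,a\rangle=\varepsilon^{\mathcal A}(a)$. THE ALGEBRA $\mathcal E$. Put $$a(\lambda,z)=\frac{\theta(z,q^{2(\lambda+2)})}{\theta(q^2z,q^{2(\lambda+1)})},\quad b(\lambda,z)=\frac{\theta(q^2,q^{-2(\lambda+1)}z)}{\theta(q^2z,q^{-2(\lambda+1)})},$$ $$c(\lambda,z)=\frac{\theta(q^2,q^{2(\lambda+1)}z)}{\theta(q^2z,q^{2(\lambda+1)})},\quad d(\lambda,z)=\frac{\theta(z,q^{-2\lambda})}{\theta(q^2z,q^{-2(\lambda+1)})}.$$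 Let $R^{11}_{11}=R^{-1,-1}_{-1,-1}=1$, $R^{1,-1}_{1,-1}=a$, $R^{-1,1}_{1,-1}=b$, $R^{1,-1}_{-1,1}=c$, $R^{-1,1}_{-1,1}=d$, other entries $0$. The algebra generated by $L_{xy}(z)$ ($x,y\in\{1,-1\}$, bidegree $(x,y)$) and two copies of $M_{\mathfrak h^*}$ (elements $f(\lambda)=\mu_l(f)$, $f(\mu)=\mu_r(f)$) has relations $f(\lambda)g(\mu)=g(\mu)f(\lambda)$, $f(\lambda)L_{xy}(z)=L_{xy}(z)f(\lambda+x)$, $f(\mu)L_{xy}(z)=L_{xy}(z)f(\mu+y)$ and $$\sum_{x,y}R^{xy}_{ac}(\lambda,z_1/z_2)L_{xb}(z_1)L_{yd}(z_2)=\sum_{x,y}R^{bd}_{xy}(\mu,z_1/z_2)L_{cy}(z_2)L_{ax}(z_1).$$ Write $\alpha=L_{1,1}$, $\beta=L_{1,-1}$, $\gamma=L_{-1,1}$, $\delta=L_{-1,-1}$; $\Delta(L_{ab}(z))=\sum_xL_{ax}(z)\otimes L_{xb}(z)$, $\varepsilon(L_{ab}(z))=\delta_{ab}T_{-a}$. With $F(\lambda)=q^\lambda\theta(q^{-2(\lambda+1)})$, $\det(z)=\mu_r(F)\mu_l(F^{-1})[\alpha(z)\delta(q^2z)-\gamma(z)\beta(q^2z)]$ is central and group-like; $\mathcal E$ is obtained by adjoining its inverse $\det^{-1}(z)$ (group-like, bidegree $(0,0)$). THE COBRAIDING. It is the pairing of $\mathfrak h$-bialgebroids $\mathcal E^{\mathrm{cop}}\times\mathcal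 E\to D_{\mathfrak h^*}$ determined by $\langle\alpha(w),\alpha(z)\rangle=T_{-2}$, $\langle\alpha(w),\delta(z)\rangle=a(\lambda,w/z)T_0$, $\langle\beta(w),\gamma(z)\rangle=b(\lambda,w/z)T_0$, $\langle\gamma(w),\beta(z)\rangle=c(\lambda,w/z)T_0$, $\langle\delta(w),\alpha(z)\rangle=d(\lambda,w/z)T_0$, $\langle\delta(w),\delta(z)\rangle=T_2$, all other pairings among $\alpha,\beta,\gamma,\delta$ zero, and $\langle\alpha(w),\det^{-1}(z)\rangle=q^{-1}\frac{\theta(w/z)}{\theta(q^{-2}w/z)}T_{-1}$, $\langle\delta(w),\det^{-1}(z)\rangle=q^{-1}\frac{\theta(w/z)}{\theta(q^{-2}w/z)}T_1$, $\langle\det^{-1}(w),\alpha(z)\rangle=q^{-1}\frac{\theta(q^2w/z)}{\theta(w/z)}T_{-1}$, $\langle\det^{-1}(w),\delta(z)\rangle=q^{-1}\frac{\theta(q^2w/z)}{\theta(w/z)}T_1$, with zero pairings between $\det^{-1}$ and $\beta,\gamma$. (Its existence is part of the setting.) MATRIX ELEMENTS. $$t^N_{kj}(z)=\sum_{l=\max(0,k+j-N)}^{\min(k,j)}\begin{bmatrix}k\\ l\end{bmatrix}\begin{bmatrix}N-k\\ {j-l}\end{bmatrix}\mu_r^{\mathcal E}\Bigl(\frac{(q^{2(\cdot+N-k-2j+l+2)})_l}{(q^{2(\cdot+N-2j+2)})_l}\frac{(q^{2(\cdot+l-j+2)})_{j-l}}{(q^{2(\cdot+N-2j-k+2l+2)})_{j-l}}\Bigr)$$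 $$\times\gamma(q^{2(N-k-1)}z)\cdots\gamma(q^{2(N-j-k+l)}z)\,\delta(q^{2(N-j-k+l-1)}z)\cdots\delta(z)\,\alpha(q^{2(N-1)}z)\cdots\alpha(q^{2(N-l)}z)\,\beta(q^{2(N-l-1)}z)\cdots\beta(q^{2(N-k)}z),$$ where $\cdot$ denotes the argument of the function in $M_{\mathfrak h^*}$ and the products contain $j-l$, $N-k-j+l$, $l$, $k-l$ factors respectively. These are the matrix elements of the left corepresentation spanned over $\mu_l^{\mathcal E}(M_{\mathfrak h^*})$ by $v_k(z)=\gamma(z)\gamma(q^2z)\cdots\gamma(q^{2(N-k-1)}z)\alpha(q^{2(N-k)}z)\cdots\alpha(q^{2(N-1)}z)$, $k\in\{0,\dots,N\}$, i.e. $\Delta^{\mathcal E}(v_k(z))=\sum_{j=0}^Nt^N_{kj}(z)\otimes v_j(z)$; $t^N_{kj}(z)\in\mathcal E_{2k-N,2j-N}$ and $\Delta^{\mathcal E}(t^N_{kj}(z))=\sum_pt^N_{kp}(z)\otimes t^N_{pj}(z)$. The spectral parameters $w,z$ are nonzero complex numbers.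
   Formalization: With m=M-r-s, the printed power of q in C is false and is corrected to q^{2m(λ-s+1)+m(m-1)}; w/z must avoid p^Z q^{2Z}, where the cobraiding is undefined; q^{2i}≠p^m for i≥1 is assumed so the binomials exist; if r+s>M or k<s, zeros of C cancel against zero denominators of the series. *)

(* Defs.v *)
From HB Require Import structures.
From mathcomp Require Import all_boot all_order all_algebra.
From mathcomp Require Import generic_quotient ring_quotient complex.
From mathcomp Require Import all_classical all_reals all_analysis.

Set Implicit Arguments.
Unset Strict Implicit.
Unset Printing Implicit Defensive.

Import Order.TTheory GRing.Theory Num.Theory.
Import numFieldNormedType.Exports.

Local Open Scope classical_set_scope.
Local Open Scope ring_scope.

(* Packaged so that mathcomp-analysis equips C with its norm and topology. *)
Definition Cx (R : realType) : numClosedFieldType := R[i].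

Section MeromorphicFunctions.
Variable R : realType.
Local Notation C := (Cx R).

Definition holomorphic_near (f : C -> C) (c : C) : Prop :=
  \forall x \near c, derivable f x 1.

Lemma holomorphic_nearM (f g : C -> C) (c : C) :
  holomorphic_near f c -> holomorphic_near g c ->
  holomorphic_near (fun x => f x * g x) c.
Proof. by apply: filterS2 => x; exact: (@derivableM C C f g x 1). Qed.

Lemma holomorphic_nearB (f g : C -> C) (c : C) :
  holomorphic_near f c -> holomorphic_near g c ->
  holomorphic_near (fun x => f x - g x) c.
Proof. by apply: filterS2 => x; exact: (@derivableB C C C f g x 1). Qed.

(* Locally a quotient of holomorphic functions; the values of f on a closed
   discrete set (in particular at the poles) are irrelevant. *)
Definition meromorphic (f : C -> C) : Prop :=
  forall c : C, exists g h : C -> C,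
    [/\ holomorphic_near g c, holomorphic_near h c &
        \forall x \near c^', h x != 0 /\ f x = g x / h x].

Definition mero : {pred C -> C} := fun f => `[< meromorphic f >].

Lemma mero_subring : subring_closed mero.
Proof.
split.
- apply/asboolP => c; exists (fun=> 1), (fun=> 1); split.
  + by near=> x; exact: derivable_cst.
  + by near=> x; exact: derivable_cst.
  + by near=> x; rewrite oner_neq0 divr1.
- move=> f f' /asboolP mf /asboolP mf'; apply/asboolP => c.
  have [g [h [hg hh e]]] := mf c; have [g' [h' [hg' hh' e']]] := mf' c.
  exists (fun x => g x * h' x - g' x * h x), (fun x => h x * h' x); split.
  + by apply: holomorphic_nearB; exact: holomorphic_nearM.
  + exact: holomorphic_nearM.
  + near=> x.
    have [h0 fE] : h x != 0 /\ f x = g x / h x by near: x; exact: e.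
    have [h'0 f'E] : h' x != 0 /\ f' x = g' x / h' x by near: x; exact: e'.
    split; first exact: mulf_neq0.
    have -> : (f - f') x = f x - f' x by [].
    by rewrite fE f'E -mulNr addf_div // mulNr.
- move=> f f' /asboolP mf /asboolP mf'; apply/asboolP => c.
  have [g [h [hg hh e]]] := mf c; have [g' [h' [hg' hh' e']]] := mf' c.
  exists (fun x => g x * g' x), (fun x => h x * h' x); split.
  + exact: holomorphic_nearM.
  + exact: holomorphic_nearM.
  + near=> x.
    have [h0 fE] : h x != 0 /\ f x = g x / h x by near: x; exact: e.
    have [h'0 f'E] : h' x != 0 /\ f' x = g' x / h' x by near: x; exact: e'.
    split; first exact: mulf_neq0.
    have -> : (f * f') x = f x * f' x by [].
    by rewrite fE f'E mulf_div.
Unshelve. all: by end_near. Qed.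

HB.instance Definition _ :=
  GRing.isSubringClosed.Build (C -> C) mero mero_subring.

Record merofun := Merofun { merofun_val : C -> C; _ : merofun_val \in mero }.

HB.instance Definition _ := [isSub of merofun for merofun_val].
HB.instance Definition _ := [Choice of merofun by <:].
HB.instance Definition _ := [SubChoice_isSubComNzRing of merofun by <:].

Definition negligible_mero : {pred merofun} :=
  fun f => `[< forall c : C, \forall x \near c^', merofun_val f x = 0 >].

Lemma negligible_mero_ideal : idealr_closed negligible_mero.
Proof.
split.
- by apply/asboolP => c; near=> x.
- apply/negP => /asboolP /(_ 0) n0.
  have [x] : exists x : C, merofun_val 1 x = 0.
    exact: (@filter_ex _ (0 : C)^' _ _ n0).
  by move/eqP; rewrite (oner_eq0 C).
- move=> a f f' /asboolP nf /asboolP nf'; apply/asboolP => c; near=> x.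
  have -> : merofun_val (a * f + f') x
          = merofun_val a x * merofun_val f x + merofun_val f' x by [].
  have -> : merofun_val f x = 0 by near: x; exact: nf.
  have -> : merofun_val f' x = 0 by near: x; exact: nf'.
  by rewrite mulr0 addr0.
Unshelve. all: by end_near. Qed.

HB.instance Definition _ :=
  isIdealr.Build merofun negligible_mero negligible_mero_ideal.

(* Two functions agreeing near every point, except possibly at that point,
   represent the same element. *)
Definition Mer := {ideal_quot negligible_mero}.

End MeromorphicFunctions.

Section DifferenceOperators.
Variable R : realType.
Local Notation C := (Cx R).
Local Notation M := (Mer R).

(* The class of a meromorphic f; the junk value 0 otherwise. *)
Definition toM (f : C -> C) : M := (\pi_M (insubd (0 : merofun R) f))%qT.

Definition constM (c : C) : M := toM (fun=> c).

(* (T_al f)(l) = f(l + al). *)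
Definition Tshift (al : C) (f : M) : M :=
  toM (fun l => merofun_val (repr f) (l + al)).

Definition oper : Type := M -> M.

Definition mulop (f : M) : oper := fun g => f * g.

(* Membership in D_{h^*}: finite sums of f T_al. *)
Definition is_diffop (P : oper) : Prop :=
  exists s : seq (M * C), forall g, P g = \sum_(t <- s) t.1 * Tshift t.2 g.

(* The component of bidegree (al, be) of D_{h^*}. *)
Definition diffop_gr (al be : C) (P : oper) : Prop :=
  P = 0 \/ al = be /\ exists f : M, P = mulop f \o Tshift (- al).

End DifferenceOperators.

Section HAlgebras.
Variable R : realType.
Local Notation C := (Cx R).
Local Notation M := (Mer R).
Local Notation oper := (oper R).

Record hAlgebra := HAlgebra {
  hcar :> algType C;
  gr : C -> C -> hcar -> Prop;
  momL : {rmorphism M -> hcar};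
  momR : {rmorphism M -> hcar};
  gr_0 : forall al be, gr al be 0;
  gr_lin : forall al be (c : C) a b,
    gr al be a -> gr al be b -> gr al be (c *: a + b);
  gr_span : forall a, exists (s : seq (C * C)) (x : C * C -> hcar),
    (forall d, gr d.1 d.2 (x d)) /\ a = \sum_(d <- s) x d;
  gr_direct : forall (s : seq (C * C)) (x : C * C -> hcar), uniq s ->
    (forall d, gr d.1 d.2 (x d)) -> \sum_(d <- s) x d = 0 ->
    forall d, d \in s -> x d = 0;
  gr_1 : gr 0 0 1;
  gr_M : forall al be ga de a b,
    gr al be a -> gr ga de b -> gr (al + ga) (be + de) (a * b);
  momL_inj : injective momL;
  momR_inj : injective momR;
  momL_const : forall c : C, momL (constM c) = c%:A;
  momR_const : forall c : C, momR (constM c) = c%:A;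
  momL_gr : forall f, gr 0 0 (momL f);
  momR_gr : forall f, gr 0 0 (momR f);
  momLR : forall f g, momL f * momR g = momR g * momL f;
  momL_comm : forall al be a f,
    gr al be a -> momL f * a = a * momL (Tshift al f);
  momR_comm : forall al be a f,
    gr al be a -> momR f * a = a * momR (Tshift be f)
}.

Record is_hmorphism (A B : hAlgebra) (phi : {lrmorphism A -> B}) : Prop := {
  hmorphism_gr : forall al be a, gr al be a -> gr al be (phi a);
  hmorphism_momL : forall f, phi (momL A f) = momL B f;
  hmorphism_momR : forall f, phi (momR A f) = momR B f
}.

(* The smallest congruence on formal sums containing rel. *)
Inductive fsum_eq (T : Type) (rel : seq T -> seq T -> Prop) :
    seq T -> seq T -> Prop :=
| fsum_refl s : fsum_eq rel s s
| fsum_sym s t : fsum_eq rel s t -> fsum_eq rel t s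
| fsum_trans s t u : fsum_eq rel s t -> fsum_eq rel t u -> fsum_eq rel s u
| fsum_cat s t s' t' :
    fsum_eq rel s t -> fsum_eq rel s' t' -> fsum_eq rel (s ++ s') (t ++ t')
| fsum_comm s t : fsum_eq rel (s ++ t) (t ++ s)
| fsum_gen s t : rel s t -> fsum_eq rel s t.

(* An element of A (x)~ B is a formal sum of (rho, a, b), read a (x) b and
   understood to satisfy a \in A_{al,rho}, b \in B_{rho,be} for some al, be;
   equality is fsum_eq (tens_rel (A := A) (B := B)). Recording rho keeps the
   middle weight of the Sweedler components, which the pairing axioms use. *)
Definition tens (A B : hAlgebra) : Type := seq (C * A * B).

Inductive tens_rel (A B : hAlgebra) : tens A B -> tens A B -> Prop :=
| tens_0 rho b : tens_rel [:: (rho, 0, b)] [::]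
| tens_Dl rho a a' b :
    tens_rel [:: (rho, a + a', b)] [:: (rho, a, b); (rho, a', b)]
| tens_Dr rho a b b' :
    tens_rel [:: (rho, a, b + b')] [:: (rho, a, b); (rho, a, b')]
| tens_Z rho (c : C) a b :
    tens_rel [:: (rho, c *: a, b)] [:: (rho, a, c *: b)]
| tens_mom rho f a b :
    tens_rel [:: (rho, momR A f * a, b)] [:: (rho, a, momL B f * b)].

Definition tens_eq (A B : hAlgebra) : tens A B -> tens A B -> Prop :=
  fsum_eq (@tens_rel A B).

(* A (x)~ A (x)~ A; the two weights are those between consecutive factors. *)
Definition tens3 (A : hAlgebra) : Type := seq (C * C * A * A * A).

Inductive tens3_rel (A : hAlgebra) : tens3 A -> tens3 A -> Prop :=
| tens3_0 r s y z : tens3_rel [:: (r, s, 0, y, z)] [::]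
| tens3_D1 r s x x' y z :
    tens3_rel [:: (r, s, x + x', y, z)] [:: (r, s, x, y, z); (r, s, x', y, z)]
| tens3_D2 r s x y y' z :
    tens3_rel [:: (r, s, x, y + y', z)] [:: (r, s, x, y, z); (r, s, x, y', z)]
| tens3_D3 r s x y z z' :
    tens3_rel [:: (r, s, x, y, z + z')] [:: (r, s, x, y, z); (r, s, x, y, z')]
| tens3_Z12 r s (c : C) x y z :
    tens3_rel [:: (r, s, c *: x, y, z)] [:: (r, s, x, c *: y, z)]
| tens3_Z23 r s (c : C) x y z :
    tens3_rel [:: (r, s, x, c *: y, z)] [:: (r, s, x, y, c *: z)]
| tens3_mom12 r s f x y z :
    tens3_rel [:: (r, s, momR A f * x, y, z)] [:: (r, s, x, momL A f * y, z)]
| tens3_mom23 r s f x y z :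
    tens3_rel [:: (r, s, x, momR A f * y, z)] [:: (r, s, x, y, momL A f * z)].

Definition tens3_eq (A : hAlgebra) : tens3 A -> tens3 A -> Prop :=
  fsum_eq (@tens3_rel A).

Definition tens_scale (A B : hAlgebra) (c : C) (u : tens A B) : tens A B :=
  [seq (t.1.1, c *: t.1.2, t.2) | t <- u].

Definition tens_mul (A B : hAlgebra) (u v : tens A B) : tens A B :=
  [seq (x.1.1 + y.1.1, x.1.2 * y.1.2, x.2 * y.2) | x <- u, y <- v].

Definition Delta_id (A : hAlgebra) (Delta : A -> tens A A) (u : tens A A) :
    tens3 A :=
  flatten [seq [seq (s.1.1, t.1.1, s.1.2, s.2, t.2) | s <- Delta t.1.2]
          | t <- u].

Definition id_Delta (A : hAlgebra) (Delta : A -> tens A A) (u : tens A A) :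
    tens3 A :=
  flatten [seq [seq (t.1.1, s.1.1, t.1.2, s.1.2, s.2) | s <- Delta t.2]
          | t <- u].

(* Delta a is a representative, well defined up to tens_eq. In the counit
   axioms, f = eps a 1 recovers f from eps a = f T_{-al}, and D (x)~ A ~ A,
   A (x)~ D ~ A are f T_{-al} (x) a |-> mu_l(f) a, a (x) f T_{-be} |-> mu_r(f) a. *)
Record hBialgebroid := HBialgebroid {
  halg :> hAlgebra;
  Delta : halg -> tens halg halg;
  eps : halg -> oper;
  Delta_wf : forall a t, t \in Delta a ->
    exists al be, gr al t.1.1 t.1.2 /\ gr t.1.1 be t.2;
  Delta_gr : forall al be a, gr al be a ->
    forall t, t \in Delta a -> gr al t.1.1 t.1.2 /\ gr t.1.1 be t.2;
  Delta_lin : forall (c : C) a b,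
    tens_eq (Delta (c *: a + b)) (tens_scale c (Delta a) ++ Delta b);
  Delta_1 : tens_eq (Delta 1) [:: (0, 1, 1)];
  Delta_M : forall a b,
    tens_eq (Delta (a * b)) (tens_mul (Delta a) (Delta b));
  Delta_momL : forall f, tens_eq (Delta (momL _ f)) [:: (0, momL _ f, 1)];
  Delta_momR : forall f, tens_eq (Delta (momR _ f)) [:: (0, 1, momR _ f)];
  Delta_coassoc : forall a,
    tens3_eq (Delta_id Delta (Delta a)) (id_Delta Delta (Delta a));
  eps_diffop : forall a, is_diffop (eps a);
  eps_gr : forall al be a, gr al be a -> diffop_gr al be (eps a);
  eps_lin : forall (c : C) a b,
    eps (c *: a + b) = (mulop (constM c) \o eps a) + eps b;
  eps_1 : eps 1 = id;
  eps_M : forall a b, eps (a * b) = eps a \o eps b;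
  eps_momL : forall f, eps (momL _ f) = mulop f;
  eps_momR : forall f, eps (momR _ f) = mulop f;
  counitl : forall a, \sum_(t <- Delta a) momL _ (eps t.1.2 1) * t.2 = a;
  counitr : forall a, \sum_(t <- Delta a) momR _ (eps t.2 1) * t.1.2 = a
}.

Section Coopposite.

Definition hcop (A : hAlgebra) : hAlgebra.
Proof.
refine (@HAlgebra (hcar A) (fun al be => @gr A be al) (momR A) (momL A)
  _ _ _ _ _ _ _ _ _ _ _ _ _ _ _).
- by move=> al be; exact: gr_0.
- by move=> al be; exact: gr_lin.
- move=> a; have [s [x [xP ->]]] := gr_span a.
  exists [seq (d.2, d.1) | d <- s], (fun d => x (d.2, d.1)); split.
    by move=> [d1 d2]; exact: (xP (d2, d1)).
  by rewrite big_map; apply: eq_bigr => -[].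
- move=> s x us xP s0 [d1 d2] ds.
  apply: (@gr_direct A [seq (d.2, d.1) | d <- s] (fun d => x (d.2, d.1))
    _ _ _ (d2, d1)).
  + by rewrite map_inj_uniq // => -[? ?] [? ?] [-> ->].
  + by move=> [e1 e2]; exact: (xP (e2, e1)).
  + by rewrite big_map -[RHS]s0; apply: eq_bigr => -[].
  + by apply/mapP; exists (d1, d2).
- exact: gr_1.
- by move=> al be ga de a b ha hb; exact: gr_M.
- exact: momR_inj.
- exact: momL_inj.
- exact: momR_const.
- exact: momL_const.
- exact: momR_gr.
- exact: momL_gr.
- by move=> f g; rewrite momLR.
- by move=> al be a f; exact: momR_comm.
- by move=> al be a f; exact: momL_comm.
Defined.

Definition tens_flip (A : hAlgebra) (u : tens A A) : tens (hcop A) (hcop A) :=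
  [seq (t.1.1, t.2, t.1.2) | t <- u].

Lemma fsum_eq_map (T T' : Type) (rel : seq T -> seq T -> Prop)
    (rel' : seq T' -> seq T' -> Prop) (f : T -> T') :
  (forall s t, rel s t -> fsum_eq rel' (map f s) (map f t)) ->
  forall s t, fsum_eq rel s t -> fsum_eq rel' (map f s) (map f t).
Proof.
move=> H s t; elim=> {s t}.
- by move=> s; exact: fsum_refl.
- by move=> s t _; exact: fsum_sym.
- by move=> s t u _ + _; exact: fsum_trans.
- by move=> s t s' t' _ ? _ ?; rewrite !map_cat; exact: fsum_cat.
- by move=> s t; rewrite !map_cat; exact: fsum_comm.
- by move=> s t; exact: H.
Qed.

Lemma tens_flip_eq (A : hAlgebra) (u v : tens A A) :
  tens_eq u v -> tens_eq (tens_flip u) (tens_flip v).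
Proof.
apply: fsum_eq_map => s t; case=> /=.
- move=> rho b; apply: (@fsum_trans _ _ _ [:: (rho, 0 *: b, 0)]).
    apply: fsum_sym; apply: (fsum_trans (t := [:: (rho, b, 0 *: 0)])).
      exact/fsum_gen/(@tens_Z (hcop A) (hcop A)).
    by rewrite scale0r; exact: fsum_refl.
  by rewrite scale0r; exact/fsum_gen/(@tens_0 (hcop A) (hcop A)).
- by move=> rho a a' b; exact/fsum_gen/(@tens_Dr (hcop A) (hcop A)).
- by move=> rho a b b'; exact/fsum_gen/(@tens_Dl (hcop A) (hcop A)).
- by move=> rho c a b; exact/fsum_sym/fsum_gen/(@tens_Z (hcop A) (hcop A)).
- by move=> rho f a b;
    exact/fsum_sym/fsum_gen/(@tens_mom (hcop A) (hcop A)).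
Qed.

Definition tens3_flip (A : hAlgebra) (u : tens3 A) : tens3 (hcop A) :=
  [seq (t.1.1.1.2, t.1.1.1.1, t.2, t.1.2, t.1.1.2) | t <- u].

Lemma tens3_flip_eq (A : hAlgebra) (u v : tens3 A) :
  tens3_eq u v -> tens3_eq (tens3_flip u) (tens3_flip v).
Proof.
apply: fsum_eq_map => s t; case=> /=.
- move=> r s' y z; set B := hcop A.
  have zl : tens3_eq (A := B) [:: (s', r, 0, y, 0)] [::].
    exact/fsum_gen/(@tens3_0 B).
  apply: fsum_trans zl; rewrite -{1}(scale0r (0 : A)).
  apply: (fsum_trans (t := [:: (s', r, z, 0 *: y, 0)])).
    exact/fsum_sym/fsum_gen/(@tens3_Z23 B).
  rewrite -{2}(scale0r z).
  exact/fsum_sym/fsum_gen/(@tens3_Z12 B).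
- by move=> *; exact/fsum_gen/(@tens3_D3 (hcop A)).
- by move=> *; exact/fsum_gen/(@tens3_D2 (hcop A)).
- by move=> *; exact/fsum_gen/(@tens3_D1 (hcop A)).
- by move=> *; exact/fsum_sym/fsum_gen/(@tens3_Z23 (hcop A)).
- by move=> *; exact/fsum_sym/fsum_gen/(@tens3_Z12 (hcop A)).
- by move=> *; exact/fsum_sym/fsum_gen/(@tens3_mom23 (hcop A)).
- by move=> *; exact/fsum_sym/fsum_gen/(@tens3_mom12 (hcop A)).
Qed.

Definition cop (A : hBialgebroid) : hBialgebroid.
Proof.
refine (@HBialgebroid (hcop A) (fun a => tens_flip (@Delta A a)) (@eps A)
  _ _ _ _ _ _ _ _ _ _ _ _ _ _ _ _ _).
- move=> a t /mapP[u /(@Delta_wf A)[al [be [h1 h2]]] ->] /=.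
  by exists be, al.
- move=> al be a ha t /mapP[u uD ->] /=.
  by have [h1 h2] := Delta_gr ha uD.
- move=> c a b.
  apply: (fsum_trans (tens_flip_eq (Delta_lin c a b))).
  rewrite /tens_flip map_cat; apply: fsum_cat; last exact: fsum_refl.
  rewrite /tens_scale -!map_comp.
  elim: (Delta a) => [|t u IH] /=; first exact: fsum_refl.
  rewrite -cat1s -[X in fsum_eq _ _ X]cat1s; apply: fsum_cat => //.
  exact/fsum_sym/fsum_gen/(@tens_Z (hcop A) (hcop A)).
- exact: (tens_flip_eq (Delta_1 A)).
- move=> a b; apply: (fsum_trans (tens_flip_eq (Delta_M a b))).
  suff -> : tens_flip (tens_mul (Delta a) (Delta b)) =
      tens_mul (tens_flip (Delta a)) (tens_flip (Delta b)).
    exact: fsum_refl.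
  by rewrite /tens_flip /tens_mul map_allpairs allpairs_mapl allpairs_mapr.
- by move=> f; exact: (tens_flip_eq (Delta_momR A f)).
- by move=> f; exact: (tens_flip_eq (Delta_momL A f)).
- move=> a; have := tens3_flip_eq (Delta_coassoc a).
  have -> : tens3_flip (Delta_id (@Delta A) (Delta a)) =
      id_Delta (fun a => tens_flip (@Delta A a)) (tens_flip (Delta a)).
    rewrite /tens3_flip /Delta_id /id_Delta map_flatten -!map_comp.
    by congr flatten; apply: eq_map => t /=; rewrite /tens_flip -!map_comp.
  have -> : tens3_flip (id_Delta (@Delta A) (Delta a)) =
      Delta_id (fun a => tens_flip (@Delta A a)) (tens_flip (Delta a)).
    rewrite /tens3_flip /Delta_id /id_Delta map_flatten -!map_comp.
    by congr flatten; apply: eq_map => t /=; rewrite /tens_flip -!map_comp.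
  exact: fsum_sym.
- exact: eps_diffop.
- move=> al be a /eps_gr [->|[-> h]]; [by left|by right].
- exact: eps_lin.
- exact: eps_1.
- exact: eps_M.
- exact: eps_momR.
- exact: eps_momL.
- by move=> a; rewrite /tens_flip big_map; exact: counitr.
- by move=> a; rewrite /tens_flip big_map; exact: counitl.
Defined.

End Coopposite.

Record is_pairing (U A : hBialgebroid) (P : U -> A -> oper) : Prop := {
  pair_diffop : forall X a, is_diffop (P X a);
  pair_linl : forall (c : C) X Y a,
    P (c *: X + Y) a = (mulop (constM c) \o P X a) + P Y a;
  pair_linr : forall (c : C) X a b,
    P X (c *: a + b) = (mulop (constM c) \o P X a) + P X b;
  pair_gr : forall al be ga de X a, gr al be X -> gr ga de a ->
    diffop_gr (al + de) (be + ga) (P X a);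
  pair_momL : forall f X a, P (momL U f * X) a = mulop f \o P X a;
  pair_momL' : forall f X a, P X (momL A f * a) = mulop f \o P X a;
  pair_momR : forall f X a, P (X * momR U f) a = P X a \o mulop f;
  pair_momR' : forall f X a, P X (a * momR A f) = P X a \o mulop f;
  pair_mull : forall X Y a,
    P (X * Y) a =
    \sum_(t <- Delta a) (P X t.1.2 \o Tshift t.1.1 \o P Y t.2);
  pair_mulr : forall X a b,
    P X (a * b) =
    \sum_(t <- Delta X) (P t.1.2 a \o Tshift t.1.1 \o P t.2 b);
  pair_1r : forall X, P X 1 = eps X;
  pair_1l : forall a, P 1 a = eps a
}.

End HAlgebras.

Section SpecialFunctions.
Variables (R : realType) (q p : R).
Local Notation C := (Cx R).

(* q^x = exp(x ln q), with real logarithm. *)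
Definition qpow (x : C) : C :=
  let u := complex.Re (x : R[i]) * ln q in
  let v := complex.Im (x : R[i]) * ln q in
  ((expR u * cos v) +i* (expR u * sin v))%C.

Definition q2 (x : C) : C := qpow (2 * x).

Definition theta (z : C) : C :=
  limn (fun n => \prod_(i < n)
    ((1 - z * (p%:C)%C ^+ i) * (1 - (p%:C)%C ^+ i.+1 / z)) : C).

Definition poch (a : C) (n : int) : C :=
  match n with
  | Posz n => \prod_(i < n) theta (a * q2 i%:R)
  | Negz n =>
      (\prod_(i < n.+1) theta (a * q2 (- n.+1%:R) * q2 i%:R))^-1
  end.

Definition pochs (s : seq C) (n : int) : C := \prod_(a <- s) poch a n.

Definition qbinom (k l : nat) : C :=
  \prod_(1 <= i < l.+1)
    (theta (q2 (k%:R - l%:R + i%:R)) / theta (q2 i%:R)).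

(* The n-th term of V(a1; bs) with bs = (a6, ..., a_{r+1}). *)
Definition V_term (a1 : C) (bs : seq C) (n : nat) : C :=
  theta (a1 * q2 (2 * n%:R)) / theta a1 *
  (q2 n%:R * pochs (a1 :: bs) n /
   pochs (q2 1 :: [seq q2 1 * a1 / b | b <- bs]) n).

(* Finitely supported sum: only terminating series are meaningful. *)
Definition Vseries (a1 : C) (bs : seq C) : C :=
  \sum_(n \in [set: nat]) V_term a1 bs n.

(* prod_{d in ds} (q^2 a1/d)_s times V(a1; bs, ds), where the quotients
   (x)_s / (x)_n, x = q^2 a1/d, are written (x q^{2n})_{s-n}. *)
Definition Vseries_reg (s : nat) (a1 : C) (bs ds : seq C) : C :=
  \sum_(n \in [set: nat])
    V_term a1 bs n * pochs ds n *
    pochs [seq q2 1 * a1 / d * q2 n%:R | d <- ds] (s%:Z - n%:Z).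

Definition Ra (l z : C) : C :=
  theta z * theta (q2 (l + 2)) / (theta (q2 1 * z) * theta (q2 (l + 1))).
Definition Rb (l z : C) : C :=
  theta (q2 1) * theta (q2 (- (l + 1)) * z) /
  (theta (q2 1 * z) * theta (q2 (- (l + 1)))).
Definition Rc (l z : C) : C :=
  theta (q2 1) * theta (q2 (l + 1) * z) /
  (theta (q2 1 * z) * theta (q2 (l + 1))).
Definition Rd (l z : C) : C :=
  theta z * theta (q2 (- l)) / (theta (q2 1 * z) * theta (q2 (- (l + 1)))).

(* R^{xy}_{ab}; true and false stand for the indices 1 and -1. *)
Definition Rmat (x y a b : bool) (l z : C) : C :=
  match x, y, a, b with
  | true, true, true, true | false, false, false, false => 1
  | true, false, true, false => Ra l z
  | false, true, true, false => Rb l z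
  | true, false, false, true => Rc l z
  | false, true, false, true => Rd l z
  | _, _, _, _ => 0
  end.

(* theta(q^2 z) R^{xy}_{ab}, defined also where theta(q^2 z) = 0. *)
Definition Rnum (x y a b : bool) (l z : C) : C :=
  match x, y, a, b with
  | true, true, true, true | false, false, false, false => theta (q2 1 * z)
  | true, false, true, false =>
      theta z * theta (q2 (l + 2)) / theta (q2 (l + 1))
  | false, true, true, false =>
      theta (q2 1) * theta (q2 (- (l + 1)) * z) / theta (q2 (- (l + 1)))
  | true, false, false, true =>
      theta (q2 1) * theta (q2 (l + 1) * z) / theta (q2 (l + 1))
  | false, true, false, true =>
      theta z * theta (q2 (- l)) / theta (q2 (- (l + 1)))
  | _, _, _, _ => 0
  end.

Lemma RnumE x y a b l z : theta (q2 1 * z) != 0 ->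
  Rnum x y a b l z = theta (q2 1 * z) * Rmat x y a b l z.
Proof.
move=> nz; case: x; case: y; case: a; case: b => //=;
  rewrite ?mulr0 ?mulr1 // /Ra /Rb /Rc /Rd invfM;
  by rewrite [RHS]mulrC -mulrA [_^-1 / _]mulrC -!mulrA mulVf // mulr1.
Qed.

Definition detF (l : C) : C := qpow l * theta (q2 (- (l + 1))).

(* The prefactor C without its factors (q^{2(M-r-s+1)}, q^{2(k-s+1)})_s; here
   u = w/z. With m = M-r-s, the power of q is q^{2m(l-s+1)} q^{m(m-1)}, so that
   (-1)^m q^{2m(l-s+1)+m(m-1)} / (q^{2(l-s+1)})_m = 1 / (q^{-2(l+M-2s-r)})_m.
   With q^{m(l-s+1)} instead, the formula for the pairing already fails for
   M = 1, N = r = s = k = j = 0, where the pairing is <delta(w), 1> = T_1. *)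
Definition Cfactor0 (M N r s k : nat) (u l : C) : C :=
  let m : int := M%:Z - r%:Z - s%:Z in
  let M' : C := M%:R in let N' : C := N%:R in
  let r' : C := r%:R in let s' : C := s%:R in let k' : C := k%:R in
  (-1) ^ m * qpow (m%:~R * (2 * (l - s' + 1) + (m%:~R - 1))) *
  (poch (q2 (l + M' - s' - k' - r' + 2) * u) s /
   pochs [:: q2 1; q2 (l + M' - 2 * s' - r' + 2); q2 (M' - r' - s' + 1) * u] s) *
  (pochs [:: q2 (N' - k' + s' - r' + 1); q2 (- l - N' + k' + s') * u] r /
   pochs [:: q2 (- (l + M' - 2 * s')); q2 (M' - r' + 1) * u] r) *
  (pochs [:: q2 (k' + s' + r' - l - M'); q2 (s' - k' + 1) * u] m /
   pochs [:: q2 (l - s' + 1); q2 1 * u] m).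

Definition Cfactor (M N r s k : nat) (u l : C) : C :=
  pochs [:: q2 (M%:R - r%:R - s%:R + 1); q2 (k%:R - s%:R + 1)] s *
  Cfactor0 M N r s k u l.

(* C times 12V11, in the form that makes sense for all r, s, k: if r + s > M or
   k < s then C contains a vanishing factor (q^{2(M-r-s+1)})_s or
   (q^{2(k-s+1)})_s which cancels against zero denominators in the series. *)
Definition CVseries (M N r s k : nat) (u l : C) : C :=
  let M' : C := M%:R in let N' : C := N%:R in
  let r' : C := r%:R in let s' : C := s%:R in let k' : C := k%:R in
  Cfactor0 M N r s k u l *
  Vseries_reg s (q2 (l + M' - 2 * s' - r' + 1))
    [:: q2 (- r'); q2 (- s'); q2 (l + M' + N' - k' - s' - r' + 2);
        q2 (k' - s') / u; q2 (M' - N' + k' - s' + 1) * u]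
    [:: q2 (l - s' + 1); q2 (l + M' - k' - s' - r' + 1)].

End SpecialFunctions.

Section EllipticQuantumGroup.
Variables (R : realType) (q p : R).
Local Notation C := (Cx R).
Local Notation M := (Mer R).
Local Notation theta := (theta p).
Local Notation qpow := (qpow q).
Local Notation q2 := (q2 q).
Local Notation poch := (poch q p).

Definition wt (x : bool) : C := if x then 1 else -1.

(* alpha, beta, gamma, delta are L true true, L true false, L false true,
   L false false. *)
Definition elldet (A : hAlgebra R) (L : bool -> bool -> C -> A) (z : C) : A :=
  momR A (toM (detF q p)) * momL A (toM (fun l => (detF q p l)^-1)) *
  (L true true z * L false false (q2 1 * z)
   - L false true z * L true false (q2 1 * z)).

Definition spectral_domain (Om : set C) : Prop :=
  forall z, Om z -> z != 0 /\ Om (q2 1 * z).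

(* The exchange relations are multiplied by theta(q^2 z1/z2), since det(z)
   involves z1/z2 = q^{-2}, where the R-matrix has a pole. The relations
   f L = L f(. + x) are part of the bigrading, see momL_comm and momR_comm. *)
Record elliptic_relations (Om : set C) (A : hAlgebra R)
    (L : bool -> bool -> C -> A) (detinv : C -> A) : Prop := {
  L_gr : forall x y z, Om z -> gr (wt x) (wt y) (L x y z);
  detinv_gr : forall z, Om z -> gr 0 0 (detinv z);
  RLL : forall a b c d z1 z2, Om z1 -> Om z2 ->
    \sum_(x : bool) \sum_(y : bool)
      momL A (toM (fun l => Rnum q p x y a c l (z1 / z2)))
        * L x b z1 * L y d z2 =
    \sum_(x : bool) \sum_(y : bool)
      momR A (toM (fun m => Rnum q p b d x y m (z1 / z2)))
        * L c y z2 * L a x z1;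
  mul_det_detinv : forall z, Om z -> elldet L z * detinv z = 1;
  mul_detinv_det : forall z, Om z -> detinv z * elldet L z = 1
}.

(* The algebra E with spectral parameters of the generators in Om; Om is all of
   C^* for the full algebra. Being generated by the L_{xy}(z), det^{-1}(z) and
   the two copies of M with the above relations is the universal property. *)
Record ellipticU2 (Om : set C) := EllipticU2 {
  ellalg :> hBialgebroid R;
  Lgen : bool -> bool -> C -> ellalg;
  detinv : C -> ellalg;
  ell_relations : elliptic_relations Om Lgen detinv;
  ell_universal : forall (B : hAlgebra R) (L' : bool -> bool -> C -> B)
      (detinv' : C -> B), elliptic_relations Om L' detinv' ->
    let extends (phi : {lrmorphism ellalg -> B}) :=
      [/\ is_hmorphism phi,
          forall x y z, Om z -> phi (Lgen x y z) = L' x y z &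
          forall z, Om z -> phi (detinv z) = detinv' z] in
    exists2 phi, extends phi & forall psi, extends psi -> psi =1 phi;
  Delta_L : forall a b z, Om z ->
    tens_eq (Delta (Lgen a b z))
      [:: (wt true, Lgen a true z, Lgen true b z);
          (wt false, Lgen a false z, Lgen false b z)];
  eps_L : forall a b z, Om z ->
    eps (Lgen a b z) = if a == b then Tshift (- wt a) else 0;
  Delta_detinv : forall z, Om z ->
    tens_eq (Delta (detinv z)) [:: (0, detinv z, detinv z)];
  eps_detinv : forall z, Om z -> eps (detinv z) = Tshift 0
}.

(* pair_LL lists <alpha,alpha> = T_{-2}, <alpha,delta> = a T_0,
   <beta,gamma> = b T_0, <gamma,beta> = c T_0, <delta,alpha> = d T_0,
   <delta,delta> = T_2, the other pairings of generators being zero. For w/z in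
   p^Z q^{2Z} some of the values below have poles or are not invertible, and no
   such pairing exists; hence the separate spectral domains W and Z. *)
Record is_cobraiding (W Z : set C) (EW : ellipticU2 W) (EZ : ellipticU2 Z)
    (P : cop EW -> EZ -> oper R) : Prop := {
  cobraiding_pairing : is_pairing P;
  pair_LL : forall x y x' y' w z, W w -> Z z ->
    P (Lgen EW x y w) (Lgen EZ x' y' z) =
    mulop (toM (fun l => Rmat q p y y' x x' l (w / z)))
      \o Tshift (- (wt y + wt y'));
  pair_L_detinv : forall x y w z, W w -> Z z ->
    P (Lgen EW x y w) (detinv EZ z) =
    if x == y then
      mulop (constM (qpow (-1) * theta (w / z) / theta (q2 (-1) * (w / z))))
        \o Tshift (- wt x)
    else 0;
  pair_detinv_L : forall x y w z, W w -> Z z ->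
    P (detinv EW w) (Lgen EZ x y z) =
    if x == y then
      mulop (constM (qpow (-1) * theta (q2 1 * (w / z)) / theta (w / z)))
        \o Tshift (- wt x)
    else 0
}.

(* t^N_{kj}(z); the exponents of q^2 decrease along each of the products. *)
Definition tmat (Om : set C) (E : ellipticU2 Om) (N k j : nat) (z : C) : E :=
  let N' : C := N%:R in let k' : C := k%:R in let j' : C := j%:R in
  \sum_((k + j - N)%N <= l < (minn k j).+1)
    let l' : C := l%:R in
    (qbinom q p k l * qbinom q p (N - k) (j - l)) *:
    (momR E (toM (fun m =>
       poch (q2 (m + N' - k' - 2 * j' + l' + 2)) l
       / poch (q2 (m + N' - 2 * j' + 2)) l
       * (poch (q2 (m + l' - j' + 2)) (j - l)%N
          / poch (q2 (m + N' - 2 * j' - k' + 2 * l' + 2)) (j - l)%N)))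
     * (\prod_(e <- rev (index_iota (N + l - j - k) (N - k)))
          Lgen E false true (q2 e%:R * z))
     * (\prod_(e <- rev (index_iota 0 (N + l - j - k)))
          Lgen E false false (q2 e%:R * z))
     * (\prod_(e <- rev (index_iota (N - l) N))
          Lgen E true true (q2 e%:R * z))
     * (\prod_(e <- rev (index_iota (N - k) (N - l)))
          Lgen E true false (q2 e%:R * z))).

End EllipticQuantumGroup.

(* Main.v *)
Require Import Defs.
From HB Require Import structures.
From mathcomp Require Import all_boot all_order all_algebra.
From mathcomp Require Import generic_quotient ring_quotient complex ring lra zify.
From mathcomp Require Import all_classical all_reals all_analysis.

(** The matrix element t^M_rs(w) is by definition a sum over l of ordered
monomials in the generators. The proof moves the generators of such a
monomial one at a time through t^N_kj(z), which leaves a single sum of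
products of theta functions, and checks that its l-th summand is the l-th
term of the elliptic hypergeometric series. No summation formula is used; the
only identity between theta functions is the addition formula.

Words. For a sequence xs of signs and an integer j, the word of xs and j is the
sum of all products L_{x1 y1}(z) L_{x2 y2}(q^2 z) ... over sign sequences y
with j pluses. At ratio q^-2 the R-matrix degenerates (col_sym), so that a word
depends on xs through its number of pluses only (word_swap). Therefore the
coproduct of a word is a sum of tensors of words without any coefficients
(word_coproduct). Ordering the monomials of a word with constant xs
produces elliptic binomial coefficients (row_word), and t^N_kj(z) is the word
of N - k minuses followed by k pluses (tmat_word).

Pairings. A generator pairs with a word to a single quotient of theta functions
times a shift (pair_L_word); the induction on the length of the word is one
instance of the addition formula for each choice of the generator and of the
first letter (gpair_step). As word_coproduct has no coefficients, pairing a
product L Y with a standard word gives the pairing of Y with another standard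
word, up to one such factor (pair_L_std). Iterating this over the blocks of
gammas, deltas, alphas and betas in the definition of t^M_rs(w) gives the
single sum pair_tmat, whose summands are products of shifted factorials
(chain_gamma, chain_delta, chain_alpha, chain_beta).

Matching. In terms of the lengths of the four blocks, the shifted factorials in
the l-th summand and in the l-th term of the series are split at the same
places and agree up to signs and powers of q, which cancel (series_term_br).
The terms of the series outside the range of l vanish.

Analytic input. With [x] = q^-x theta(q^2x) all functions become quotients of
brackets and the powers of q disappear. The bracket is odd and satisfies the
addition formula (br_addition): the limit of the finite triple product
expresses theta(Y^2) / Y as a Jacobi series (theta_jac), the product of two
such series at a b and a / b is a two by two determinant of functions of a and
of b (rank2_cvg), and the addition formula is then a Pluecker relation
(jac_addition). That [l + c] is meromorphic in l and generically nonzero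
follows from the invertibility of det(z) (detF_unit).

Finally, the axioms of a pairing speak of the Sweedler components of one
particular representative of the coproduct. They are turned into statements
about all representatives by inserting projections to weight spaces
(pfun, pair_mull_tsum). *)

Set Implicit Arguments.
Unset Strict Implicit.
Unset Printing Implicit Defensive.

Import Order.TTheory GRing.Theory Num.Theory.
Import numFieldNormedType.Exports.

Local Open Scope classical_set_scope.
Local Open Scope ring_scope.

(** * Limits of complex sequences *)

Section ComplexLimits.
Variable R : realType.
Local Notation C := (Cx R).
Local Notation "x %:C" := (real_complex R x : C).

Lemma ltCR (x y : R) : (x%:C < y%:C) = (x < y).
Proof. exact: ltcR. Qed.

Lemma leCR (x y : R) : (x%:C <= y%:C) = (x <= y).
Proof. exact: lecR. Qed.

Lemma ge0CR (x : R) : (0 <= x%:C) = (0 <= x).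
Proof. exact: (leCR 0 x). Qed.

Lemma normCR (x : R) : `|x%:C| = `|x|%:C.
Proof. by rewrite [LHS]normc_def /= expr0n addr0 sqrtr_sqr. Qed.

Lemma ge0_realC (x : C) : 0 <= x -> exists r : R, x = r%:C.
Proof.
by move=> x0; exists (complex.Re (x : R[i])); rewrite RRe_real // ger0_real.
Qed.

(** The norm of C takes its values in C; a real majorant gives access to the
limits of real sequences. *)
Lemma squeezeC (u : nat -> C) (l : C) (e : nat -> R) :
  (forall n, `|u n - l| <= (e n)%:C) -> e @ \oo --> 0 -> u @ \oo --> l.
Proof.
move=> ule e0; apply/cvgrPdist_lt => eps eps0.
have [r er] := ge0_realC (ltW eps0).
have r0 : 0 < r by rewrite -ltCR -er.
have {}e0 := (cvgrPdist_lt e 0).1 e0 r r0.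
near=> n; rewrite distrC (le_lt_trans (ule n)) // er ltCR.
have : `|0 - e n| < r by near: n; exact: e0.
by rewrite sub0r normrN; apply: le_lt_trans; exact: ler_norm.
Unshelve. all: by end_near. Qed.

Lemma cvg_realC (u : nat -> R) (l : R) :
  u @ \oo --> l -> (fun n => (u n)%:C) @ \oo --> l%:C.
Proof.
move=> ul; apply: (squeezeC (e := fun n => `|u n - l|)) => [n|].
  by rewrite -rmorphB normCR.
by apply/norm_cvg0P/subr_cvg0.
Qed.

Lemma abs_cvgC (u : nat -> C) (b : nat -> R) :
  (forall n, `|u n| <= (b n)%:C) -> cvgn (series b) -> cvgn (series u).
Proof.
move=> ub cb.
have b0 n : 0 <= b n by rewrite -ge0CR (le_trans _ (ub n)).
have cRe : cvgn (series (fun n => complex.Re (u n : R[i]))).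
  apply: normed_cvg; apply: (series_le_cvg _ _ _ cb) => n //=.
  by rewrite -leCR (le_trans _ (ub n)) //; exact: normc_ge_Re.
have cIm : cvgn (series (fun n => complex.Im (u n : R[i]))).
  apply: normed_cvg; apply: (series_le_cvg _ _ _ cb) => n //=.
  rewrite -leCR (le_trans _ (ub n)) //.
  rewrite [X in _ <= X]normc_def leCR -sqrtr_sqr ler_wsqrtr // lerDr sqr_ge0.
  by [].
suff -> : series u = (fun n => (series (fun n => complex.Re (u n : R[i])) n)%:C
    + 'i * (series (fun n => complex.Im (u n : R[i])) n)%:C).
  apply: (cvgP (_ : C)); apply: cvgD; first exact: (cvg_realC cRe).
  by apply: cvgM; [exact: cvg_cst|exact: (cvg_realC cIm)].
apply/funext => n; rewrite /series /= !rmorph_sum mulr_sumr -big_split /=.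
by apply: eq_bigr => i _; rewrite [LHS]complexE complexiE.
Qed.

End ComplexLimits.

(** * The finite form of the Jacobi triple product *)

Section FiniteTripleProduct.
Variables (F : fieldType) (p : F).

Definition euler k : F := \prod_(i < k) (1 - p ^+ i.+1).

(** The coefficients of the finite triple product; as n grows they tend to the
inverse of the limit of euler. *)
Definition jcoef n j : F :=
  if (j <= n)%N then euler (2 * n).+1 / (euler (n - j) * euler (n + j).+1)
  else 0.

Definition jsign j : F := (-1) ^+ j * p ^+ 'C(j.+1, 2).

(** Since theta(Y^2) / Y is odd under inversion of Y, only these Laurent
polynomials occur in its expansion. *)
Definition jodd (Y : F) j : F := Y ^- (2 * j).+1 - Y ^+ (2 * j).+1.

Hypothesis p0 : p != 0.
Hypothesis p_gen : forall k, 1 - p ^+ k.+1 != 0.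

Lemma euler0 : euler 0 = 1.
Proof. exact: big_ord0. Qed.

Lemma eulerS k : euler k.+1 = euler k * (1 - p ^+ k.+1).
Proof. by rewrite /euler big_ord_recr. Qed.

Lemma euler_neq0 k : euler k != 0.
Proof. by apply/prodf_neq0 => i _; exact: p_gen. Qed.

Lemma jsign0 : jsign 0 = 1.
Proof. by rewrite /jsign bin_small // !expr0 mulr1. Qed.

Lemma jsignS j : jsign j.+1 = - p ^+ j.+1 * jsign j.
Proof. by rewrite /jsign exprS binS bin1 exprD; ring. Qed.

Lemma jcoefE n j d a b : n = (j + d)%N -> a = (2 * n).+1 -> b = (n + j).+1 ->
  jcoef n j = euler a / (euler d * euler b).
Proof. by move=> nE -> ->; rewrite /jcoef {1}nE leq_addr nE addKn. Qed.

Lemma jcoef_gt n j : (n < j)%N -> jcoef n j = 0.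
Proof. by rewrite /jcoef ltnNge => /negbTE ->. Qed.

Lemma jcoefnn n : jcoef n n = 1.
Proof.
rewrite (@jcoefE n n 0 (2 * n).+1 (2 * n).+1) ?euler0 ?mul1r ?divff //; try lia.
exact: euler_neq0.
Qed.

(** Multiplying by one more factor of the product turns into this recursion
through jodd_rec. *)
Lemma jcoef_rec n j :
  jcoef n.+1 j.+1 = (1 + p ^+ (2 * n.+1)) * jcoef n j.+1
    + p ^+ n.+1 * (p ^- j.+1 * jcoef n j + p ^+ j.+2 * jcoef n j.+2).
Proof.
have e0 := euler_neq0.
have [lt_nj|] := ltnP n j.
  by rewrite !jcoef_gt; [rewrite !(mulr0, addr0)|lia..].
move=> /subnKC <-; move: (n - j)%N => {n} [|[|d]].
- rewrite addn0 !jcoefnn !(jcoef_gt (n := j)) // !mulr0 add0r addr0 mulr1.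
  by rewrite divff // expf_neq0.
- have := @jcoefE j.+2 j.+1 1 (2 * j).+2.+3 (2 * j).+2.+2.
  have := @jcoefE j.+1 j 1 (2 * j).+3 (2 * j).+2.
  move=> /(_ ltac:(lia) ltac:(lia) ltac:(lia)) E1.
  move=> /(_ ltac:(lia) ltac:(lia) ltac:(lia)) E2.
  rewrite addn1 jcoefnn (jcoef_gt (n := j.+1) (j := j.+2)) // {}E1 {}E2.
  rewrite (_ : (2 * j.+2)%N = (2 * j).+2.+2); last by lia.
  rewrite (eulerS (2 * j).+2.+2) (eulerS (2 * j).+2) (eulerS 0) euler0 !mul1r.
  have := e0 (2 * j).+2.+2; have := e0 (2 * j).+2; have := p_gen 0; rewrite expr1.
  move: (euler _) (euler _) => a b p1 a0 b0.
  rewrite !(exprS, mul2n) -addnn !exprD.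
  have := p0; have : p ^+ j != 0 by rewrite expf_neq0.
  move: (p ^+ j) => u u0 p00.
  by field; rewrite p1 u0 p00 a0.
- have := @jcoefE (j + d).+3 j.+1 d.+2 (2 * j + 2 * d).+4.+3 (2 * j + d).+4.+1.
  have := @jcoefE (j + d).+2 j.+1 d.+1 (2 * j + 2 * d).+4.+1 (2 * j + d).+4.
  have := @jcoefE (j + d).+2 j d.+2 (2 * j + 2 * d).+4.+1 (2 * j + d).+3.
  have := @jcoefE (j + d).+2 j.+2 d (2 * j + 2 * d).+4.+1 (2 * j + d).+4.+1.
  move=> /(_ ltac:(lia) ltac:(lia) ltac:(lia)) E1.
  move=> /(_ ltac:(lia) ltac:(lia) ltac:(lia)) E2.
  move=> /(_ ltac:(lia) ltac:(lia) ltac:(lia)) E3.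
  move=> /(_ ltac:(lia) ltac:(lia) ltac:(lia)) E4.
  rewrite !addnS {}E1 {}E2 {}E3 {}E4.
  rewrite (_ : (2 * (j + d).+3)%N = (2 * j + 2 * d).+4.+2); last by lia.
  rewrite (eulerS (2 * j + 2 * d).+4.+2) (eulerS (2 * j + 2 * d).+4.+1).
  rewrite (eulerS (2 * j + d).+4) (eulerS (2 * j + d).+3) (eulerS d.+1) (eulerS d).
  have := p_gen (2 * j + d).+4; have := p_gen (2 * j + d).+3.
  have := p_gen d.+1; have := p_gen d.
  have := e0 (2 * j + 2 * d).+4.+1; have := e0 d; have := e0 (2 * j + d).+3.
  move: (euler _) (euler _) (euler _) => a b c a0 b0 c0.
  rewrite !(exprS, mul2n) -!addnn !exprD.
  have := p0; have : p ^+ j != 0 by rewrite expf_neq0.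
  move: (p ^+ j) (p ^+ d) => u v u0 p00 p1 p2 p3 p4.
  by field; rewrite p1 p2 p3 p4 u0 p00 a0 b0.
Qed.

Lemma jcoef_rec0 n :
  jcoef n.+1 0 = (1 + p ^+ (2 * n.+1) + p ^+ n.+1) * jcoef n 0
    + p ^+ n.+2 * jcoef n 1.
Proof.
have e0 := euler_neq0; rewrite /jcoef /=.
case: n => [|n].
  rewrite /euler !big_ord_recr !big_ord0 /=.
  have := (p_gen 0, p_gen 1, p_gen 2); rewrite !expr2 => -[[h0 h1] h2].
  by field; rewrite ?h0 ?h1 ?h2.
rewrite !subn0 !addn0 addn1 subSS subn0.
rewrite (_ : (2 * n.+2).+1 = (2 * n.+1).+3); last by lia.
rewrite !(eulerS (2 * n.+1).+1, eulerS (2 * n.+1).+2, eulerS n, eulerS n.+1, eulerS n.+2).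
have := (p_gen n, p_gen n.+1, p_gen n.+2); move=> [[]].
rewrite (_ : (2 * n.+1).+1.+1 = (n + n + 4)%N); last by lia.
rewrite (_ : (2 * n.+2)%N = (n + n + 4)%N); last by lia.
rewrite !(exprD, exprS).
move: (e0 n) (e0 (2 * n.+1).+1) => h1 h2 h3 h4 h5.
by rewrite ltn0Sn expr0; field; rewrite h1 h3 h4 h5.
Qed.

Lemma jodd_rec (Y : F) j : Y != 0 ->
  (Y ^+ 2 + Y ^- 2) * jodd Y j.+1 = jodd Y j.+2 + jodd Y j.
Proof.
move=> Y0; rewrite /jodd !(mul2n, doubleS, exprS) expr0 -!mul2n.
have : Y ^+ (2 * j) != 0 by rewrite expf_neq0.
by move: (Y ^+ (2 * j)) => u u0; field; rewrite u0.
Qed.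

Lemma jodd_rec0 (Y : F) : Y != 0 ->
  (Y ^+ 2 + Y ^- 2) * jodd Y 0 = jodd Y 1 - jodd Y 0.
Proof. by move=> Y0; rewrite /jodd !(mul2n, doubleS, exprS) !expr0; field. Qed.

(** The left-hand side times Y is a partial product of theta(Y^2) with one extra
factor; as the sum is finite, induction on n replaces any rearrangement of
infinite products. *)
Lemma finite_triple_product n (Y : F) : Y != 0 ->
  Y^-1 * (1 - Y ^+ 2) *
    \prod_(i < n) ((1 - Y ^+ 2 * p ^+ i.+1) * (1 - p ^+ i.+1 / Y ^+ 2)) =
  \sum_(j < n.+1) jcoef n j * jsign j * jodd Y j.
Proof.
move=> Y0; elim: n => [|n IH].
  rewrite big_ord0 big_ord1 jcoefnn jsign0 /jodd muln0 !expr1.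
  by field.
rewrite big_ord_recr mulrA IH.
have -> : (1 - Y ^+ 2 * p ^+ n.+1) * (1 - p ^+ n.+1 / Y ^+ 2) =
    1 + p ^+ (2 * n.+1) - p ^+ n.+1 * (Y ^+ 2 + Y ^- 2).
  by rewrite mul2n -addnn exprD; field.
set a := fun j => jcoef n j * jsign j.
have a_gt j : (n < j)%N -> a j = 0 by move=> ?; rewrite /a jcoef_gt ?mul0r.
have -> : \sum_(j < n.+2) jcoef n.+1 j * jsign j * jodd Y j =
  ((1 + p ^+ (2 * n.+1)) * a 0 - p ^+ n.+1 * (a 1 - a 0)) * jodd Y 0
  + \sum_(j < n.+1) ((1 + p ^+ (2 * n.+1)) * a j.+1
       - p ^+ n.+1 * (a j + a j.+2)) * jodd Y j.+1.
  rewrite big_ord_recl /=; congr (_ * _ + _).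
    rewrite jcoef_rec0 /a jsignS.
    by rewrite !(exprS p n.+1) expr1; ring.
  apply: eq_bigr => i _; congr (_ * _); rewrite /bump /= add1n jcoef_rec /a !jsignS.
  have : p ^+ i.+1 != 0 by rewrite expf_neq0.
  by rewrite (exprS p i.+1) => u0; field.
have S1 : \sum_(j < n.+1) a j.+1 * jodd Y j.+1 =
    \sum_(j < n.+1) a j * jodd Y j - a 0 * jodd Y 0.
  rewrite big_ord_recr /= a_gt // mul0r addr0 [in RHS]big_ord_recl /=.
  by rewrite addrAC subrr add0r.
have S2 : \sum_(j < n.+1) a j * ((Y ^+ 2 + Y ^- 2) * jodd Y j) =
    \sum_(j < n.+1) (a j + a j.+2) * jodd Y j.+1 + (a 1 - a 0) * jodd Y 0.
  under [in RHS]eq_bigr do rewrite mulrDl.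
  rewrite big_split /= [X in _ = _ + X + _]big_ord_recr /= a_gt // mul0r addr0.
  have -> : \sum_(i < n) a i.+2 * jodd Y i.+1 =
      \sum_(i < n.+1) a i.+1 * jodd Y i - a 1 * jodd Y 0.
    by rewrite big_ord_recl /= addrAC subrr add0r.
  have -> : \sum_(i < n.+1) a i.+1 * jodd Y i = \sum_(i < n) a i.+1 * jodd Y i.
    by rewrite big_ord_recr /= a_gt // mul0r addr0.
  have -> : \sum_(j < n.+1) a j * jodd Y j.+1 =
      a 0 * jodd Y 1 + \sum_(i < n) a i.+1 * jodd Y i.+2.
    by rewrite big_ord_recl.
  rewrite big_ord_recl /= jodd_rec0 //.
  have -> : \sum_(i < n) a (bump 0 i) * ((Y ^+ 2 + Y ^- 2) * jodd Y (bump 0 i)) =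
     \sum_(i < n) a i.+1 * jodd Y i.+2 + \sum_(i < n) a i.+1 * jodd Y i.
    by rewrite -big_split; apply: eq_bigr => i _; rewrite jodd_rec // mulrDr.
  ring.
have -> : \sum_(j < n.+1) ((1 + p ^+ (2 * n.+1)) * a j.+1
       - p ^+ n.+1 * (a j + a j.+2)) * jodd Y j.+1 =
  (1 + p ^+ (2 * n.+1)) * \sum_(j < n.+1) a j.+1 * jodd Y j.+1
  - p ^+ n.+1 * \sum_(j < n.+1) (a j + a j.+2) * jodd Y j.+1.
  by rewrite !mulr_sumr -sumrB; apply: eq_bigr => i _; ring.
rewrite S1; move: S2.
under eq_bigr => i _ do rewrite mulrCA.
rewrite -mulr_sumr => S2.
rewrite mulrBr mulrCA [X in _ - p ^+ _ * X]mulrC S2; ring.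
Qed.

End FiniteTripleProduct.

(** * Estimates *)

Lemma cvg_sum_ord (K : numFieldType) (V : normedModType K) N
    (f : nat -> nat -> V) (l : nat -> V) :
  (forall j, f^~ j @ \oo --> l j) ->
  (fun n => \sum_(j < N) f n j) @ \oo --> \sum_(j < N) l j.
Proof.
move=> fl; elim: N => [|N IH].
  by under eq_fun do rewrite big_ord0; rewrite big_ord0; exact: cvg_cst.
under eq_fun do rewrite big_ord_recr.
by rewrite big_ord_recr; apply: cvgD; [exact: IH|exact: fl].
Qed.

Section RealEstimates.
Variables (R : realType) (p : R).
Hypotheses (hp : 0 < p < 1).

(** For 0 <= y <= x the factor 1 - y is at least exp(- y / (1 - x)), which bounds
the product by the exponential of a geometric series. *)
Lemma prod_bound (x : R) : 0 <= x < 1 ->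
  exists2 c : R, 0 < c & forall n, c <= \prod_(i < n) (1 - x * p ^+ i).
Proof.
move=> /andP[x0 x1]; have /andP[p0 p1] := hp.
pose b n := \sum_(i < n) p ^+ i.
have bE n : b n * (1 - p) = 1 - p ^+ n.
  elim: n => [|n IH]; first by rewrite /b big_ord0 expr0; ring.
  by rewrite /b big_ord_recr /= -/(b n) mulrDl IH exprS; ring.
have b_le n : b n <= (1 - p)^-1.
  rewrite -[leRHS]mul1r ler_pdivlMr; last by lra.
  by rewrite bE gerBl exprn_ge0 // ltW.
exists (expR (- (x / (1 - x) * (1 - p)^-1))); first exact: expR_gt0.
move=> n; apply: (@le_trans _ _ (expR (- (x / (1 - x) * b n)))).
  rewrite ler_expR lerN2 ler_wpM2l //.
  by rewrite divr_ge0 // subr_ge0 ltW.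
elim: n => [|n IH]; first by rewrite /b !big_ord0 mulr0 oppr0 expR0.
rewrite /b !big_ord_recr /= -/(b n) mulrDr opprD expRD ler_pM ?expR_ge0 //.
set y := x * p ^+ n.
have y0 : 0 <= y by rewrite mulr_ge0 // exprn_ge0 // ltW.
have yx : y <= x by rewrite ler_piMr // exprn_ile1 // ltW.
have y1 : 0 < 1 - y by lra.
rewrite expRN -[leRHS]invrK lef_pV2 ?posrE ?invr_gt0 ?expR_gt0 //.
apply: le_trans (expR_ge1Dx _).
have -> : (1 - y)^-1 = 1 + y / (1 - y) by field; lra.
rewrite lerD2l (_ : x / (1 - x) * p ^+ n = y / (1 - x)); last by rewrite mulrAC.
rewrite ler_wpM2l //.
by rewrite lef_pV2 ?posrE //; lra.
Qed.

(** Dominated convergence for sums whose number of terms grows as well. *)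
Lemma tannery (f : nat -> nat -> R) (g : nat -> R) :
  (forall n j, 0 <= f n j <= g j) -> cvgn (series g) ->
  (forall j, f^~ j @ \oo --> 0) ->
  (fun n => \sum_(j < n.+1) f n j) @ \oo --> 0.
Proof.
move=> fg cg f0.
have g0 j : 0 <= g j by have /andP[/le_trans] := fg 0 j; apply.
have nd : nondecreasing_seq (series g) by exact: nondecreasing_series.
apply/cvgrPdist_lt => e e0; set l := lim (series g @ \oo).
have e2 : 0 < e / 2 by lra.
have [N _ HN] := (cvgrPdist_lt _ _).1 cg _ e2.
have f0N : (fun n => \sum_(j < N) f n j) @ \oo --> 0.
  have := @cvg_sum_ord R R^o N f (fun=> 0) f0.
  by rewrite [X in _ --> X]big1.
have {}f0N := (cvgrPdist_lt _ _).1 f0N _ e2.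
near=> n.
rewrite sub0r normrN ger0_norm; last first.
  by apply: sumr_ge0 => i _; case/andP: (fg n i).
have Nn : (N <= n.+1)%N by apply: leqW; near: n; exact: nbhs_infty_ge.
have h1 : \sum_(j < N) f n j < e / 2.
  have : `|0 - \sum_(j < N) f n j| < e / 2 by near: n; exact: f0N.
  by rewrite sub0r normrN; apply: le_lt_trans; exact: ler_norm.
have h2 : series g n.+1 - series g N < e / 2.
  have := HN N (leqnn N); rewrite /= -/l => h3.
  have : series g n.+1 <= l by exact: nondecreasing_cvgn_le.
  have : l - series g N <= `|l - series g N| by exact: ler_norm.
  by lra.
apply: le_lt_trans (_ : _ <= \sum_(j < N) f n j + (series g n.+1 - series g N)) _; last lra.
rewrite -(big_mkord predT (f n)) (big_cat_nat (leq0n N) Nn) /= big_mkord lerD2l.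
rewrite /series /= (big_cat_nat (leq0n N) Nn) /= addrAC subrr add0r.
by apply: ler_sum => i _; case/andP: (fg n i).
Unshelve. all: by end_near. Qed.

Lemma quadratic_power_bound (r : R) : 0 <= r ->
  exists D : R, forall j, p ^+ 'C(j.+1, 2) * r ^+ j <= D * 2^-1 ^+ j.
Proof.
move=> r0; have /andP[p0 p1] := hp.
pose u j := p ^+ 'C(j.+1, 2) * (2 * r) ^+ j.
have u0 j : 0 <= u j by rewrite mulr_ge0 ?exprn_ge0 ?mulr_ge0 // ltW.
have uS j : u j.+1 = (p ^+ j.+1 * (2 * r)) * u j.
  by rewrite /u binS bin1 exprD (exprS (2 * r)); ring.
have [N HN] : exists N, forall j, (N <= j)%N -> p ^+ j.+1 * (2 * r) <= 1.
  have h : (fun j => p ^+ j * (2 * r)) @ \oo --> 0.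
    rewrite -(mul0r (2 * r)); apply: cvgM; last exact: cvg_cst.
    by apply: cvg_expr; rewrite ger0_norm // ltW.
  have [N _ HN] := (cvgrPdist_lt _ _).1 h 1 ltr01.
  exists N => j Nj; have := HN j.+1 (leqW Nj); rewrite /= sub0r normrN => /ltW.
  by apply: le_trans; exact: ler_norm.
exists (\sum_(i < N.+1) u i) => j.
suff : u j <= \sum_(i < N.+1) u i.
  rewrite /u exprMn mulrCA => h; rewrite exprVn ler_pdivlMr ?exprn_gt0 //.
  by rewrite mulrC.
elim: j => [|j IH].
  by rewrite big_ord_recl lerDl sumr_ge0.
have [Nj|jN] := leqP N j.
  by rewrite (le_trans _ IH) // uS ler_piMl // HN.
by rewrite (bigD1 (inord j.+1)) //= inordK // lerDl sumr_ge0.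
Qed.

End RealEstimates.

(** * Theta functions as Jacobi series *)

Lemma cvg_subseq (T : topologicalType) (u : nat -> T) (l : T) (phi : nat -> nat) :
  (forall n, n <= phi n)%N -> u @ \oo --> l -> (u \o phi) @ \oo --> l.
Proof.
move=> phi_ge ul; apply: cvg_comp ul => A [N _ NA]; exists N => // n Nn.
by apply: NA; exact: leq_trans Nn (phi_ge n).
Qed.

Section JacobiSeries.
Variables (R : realType) (p : R).
Hypotheses (hp : 0 < p < 1).
Local Notation C := (Cx R).
Local Notation "x %:C" := (real_complex R x : C).

Definition jterm (Y : C) (j : nat) : C := (jsign p j)%:C * jodd Y j.

Definition jac (Y : C) : C := limn (series (jterm Y)).

Let p0 : p != 0. Proof. by case/andP: hp => /gt_eqF ->. Qed.

Let p_gen k : 1 - p ^+ k.+1 != 0.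
Proof.
case/andP: hp => p_gt0 p_lt1; rewrite subr_eq0 eq_sym lt_eqF //.
by rewrite exprn_ilt1 // ltW.
Qed.

(** The limit must be known to be positive: its inverse is the constant between
theta and the Jacobi series. *)
Lemma euler_lim : exists2 E : R, 0 < E &
  euler p @ \oo --> E /\ forall k, E <= euler p k <= 1.
Proof.
case/andP: (hp) => p_gt0 p_lt1.
have [|c c0 cE] := @prod_bound R p hp p; first by rewrite ltW.
have {}cE k : c <= euler p k.
  by rewrite (le_trans (cE k)) // /euler; under eq_bigr do rewrite -exprS.
have dE : nonincreasing_seq (euler p).
  apply/nonincreasing_seqP => k; rewrite eulerS ler_piMr //.
    exact: le_trans (ltW c0) (cE k).
  by rewrite gerBl exprn_ge0 // ltW.
have cvE : cvgn (euler p).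
  by apply: nonincreasing_is_cvgn => //; exists c => _ [k _ <-].
exists (limn (euler p)); last (split => // k).
  by apply: lt_le_trans c0 _; apply: limr_ge => //; near=> k.
apply/andP; split; first exact: nonincreasing_cvgn_ge.
by rewrite -(euler0 p); apply: dE.
Unshelve. all: by end_near. Qed.

(** The quadratic exponent of p beats the powers of Y, so that the series is
dominated by a geometric one. *)
Lemma jexp_bound (Y : C) : Y != 0 -> exists2 b : nat -> R,
  cvgn (series b) & forall j, `|(jsign p j)%:C| *
    (`|Y ^- (2 * j).+1| + `|Y ^+ (2 * j).+1|) <= (b j)%:C.
Proof.
move=> Y0; have [y yE] : exists y : R, `|Y| = y%:C by exact: ge0_realC.
have y0 : 0 < y.
  by rewrite -ltCR -yE (_ : 0%:C = 0) ?normr_gt0.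
have yi : 0 < y^-1 by rewrite invr_gt0.
have y2 : 0 < y ^+ 2 by exact: exprn_gt0.
have yi2 : 0 < y ^- 2 by rewrite invr_gt0.
pose r := y ^+ 2 + y ^- 2; have r0 : 0 <= r by rewrite /r; lra.
have [D HD] := @quadratic_power_bound R p hp r r0.
exists (geometric ((y + y^-1) * D) 2^-1).
  by apply: is_cvg_geometric_series; rewrite ger0_norm; lra.
move=> j; have js : `|jsign p j| = p ^+ 'C(j.+1, 2).
  rewrite /jsign normrM normrX normrN1 expr1n mul1r ger0_norm ?exprn_ge0 //.
  by case/andP: hp => /ltW.
rewrite normCR js.
apply: (@le_trans _ _ (p ^+ 'C(j.+1, 2) * ((y + y^-1) * r ^+ j))%:C); last first.
  rewrite leCR mulrCA.
  have -> : geometric ((y + y^-1) * D) 2^-1 j = (y + y^-1) * (D * 2^-1 ^+ j).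
    by rewrite /geometric /= -mulrA.
  by apply: ler_wpM2l (HD j); rewrite addr_ge0 // ltW.
rewrite (rmorphM (real_complex R)) ler_wpM2l // ?ge0CR ?exprn_ge0 //; first by case/andP: hp => /ltW.
rewrite normfV !normrX yE.
rewrite -!rmorphXn -fmorphV -rmorphD leCR mulrDl addrC lerD //.
  rewrite exprS exprM ler_pM2l //.
  by apply: lerXn2r; rewrite ?nnegrE /r; lra.
rewrite exprS exprM invfM ler_pM2l // -exprVn.
by apply: lerXn2r; rewrite ?nnegrE /r; lra.
Qed.

Lemma jterm_bound (Y : C) : Y != 0 -> exists2 b : nat -> R,
  cvgn (series b) & forall j, `|jterm Y j| <= (b j)%:C.
Proof.
move=> /jexp_bound[b cb bP]; exists b => // j; rewrite (le_trans _ (bP j)) //.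
by rewrite /jterm normrM ler_wpM2l // /jodd ler_normB.
Qed.

Lemma jac_cvg (Y : C) : Y != 0 -> series (jterm Y) @ \oo --> jac Y.
Proof. by move=> /jterm_bound[b cb /abs_cvgC]; apply. Qed.

Lemma jcoef_lim (E : R) : 0 < E -> euler p @ \oo --> E ->
  forall j, (jcoef p ^~ j) @ \oo --> E^-1.
Proof.
move=> E0 cE j; rewrite -(cvg_shiftn j).
have -> : (fun d => jcoef p (d + j) j) = (fun d => euler p (2 * (j + d)).+1 /
     (euler p d * euler p (j + d + j).+1)).
  by apply/funext => d; rewrite addnC; apply: jcoefE.
have -> : E^-1 = E / (E * E) by field; rewrite gt_eqF.
apply: cvgM.
  by apply: (cvg_subseq (phi := fun d => (2 * (j + d)).+1)) cE => d; lia.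
apply: cvgV; first by rewrite mulf_neq0 // gt_eqF.
apply: cvgM => //.
by apply: (cvg_subseq (phi := fun d => (j + d + j).+1)) cE => d; lia.
Qed.

Lemma jcoef_series (E : R) (Y : C) : 0 < E -> euler p @ \oo --> E ->
  (forall k, E <= euler p k <= 1) -> Y != 0 ->
  (fun n => \sum_(j < n.+1) (jcoef p n j)%:C * jterm Y j) @ \oo -->
    (E^-1)%:C * jac Y.
Proof.
move=> E0 cE Eb Y0; have [b cb bP] := jterm_bound Y0.
have b0 j : 0 <= b j by rewrite -ge0CR (le_trans _ (bP j)).
have EV : 0 < E^-1 by rewrite invr_gt0.
have jb n j : 0 <= jcoef p n j <= E^-1 * E^-1.
  rewrite /jcoef; case: ifP => _; last by rewrite lexx mulr_ge0 // ltW.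
  have e_gt k : 0 < euler p k by apply: lt_le_trans E0 _; case/andP: (Eb k).
  have e_ge k : (euler p k)^-1 <= E^-1.
    by rewrite lef_pV2 ?posrE //; case/andP: (Eb k).
  have ei_ge k : 0 <= (euler p k)^-1 by rewrite invr_ge0 ltW.
  have E1 : euler p (2 * n).+1 <= 1 by case/andP: (Eb (2 * n).+1).
  rewrite invfM; apply/andP; split.
    by apply: mulr_ge0; [exact: ltW|exact: mulr_ge0].
  rewrite -[E^-1 * E^-1]mul1r; apply: ler_pM => //; first exact: ltW.
    exact: mulr_ge0.
  exact: ler_pM.
pose f n j := `|jcoef p n j - E^-1| * b j.
have h : (fun n => \sum_(j < n.+1) f n j) @ \oo --> 0.
  apply: (@tannery R f (fun j => (E^-1 * E^-1 + E^-1) * b j)) => [n j||j].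
  - rewrite mulr_ge0 //= ler_wpM2r // (le_trans (ler_normB _ _)) //.
    case/andP: (jb n j) => j0 j1.
    by rewrite (ger0_norm j0) (gtr0_norm EV) lerD2r.
  - have -> : (fun j => (E^-1 * E^-1 + E^-1) * b j) =
        (E^-1 * E^-1 + E^-1) *: b by apply/funext.
    exact: is_cvg_seriesZ.
  - rewrite -(mul0r (b j)); apply: cvgM; last exact: cvg_cst.
    by apply/norm_cvg0P/subr_cvg0; exact: jcoef_lim.
have h2 : (fun n => \sum_(j < n.+1) ((jcoef p n j)%:C - (E^-1)%:C) * jterm Y j)
    @ \oo --> (0 : C).
  apply: squeezeC h => n; rewrite subr0 (le_trans (ler_norm_sum _ _ _)) //.
  rewrite rmorph_sum ler_sum // => j _; rewrite normrM -rmorphB normCR.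
  rewrite /f (rmorphM (real_complex R)) ler_wpM2l // ge0CR //.
have -> : (fun n => \sum_(j < n.+1) (jcoef p n j)%:C * jterm Y j) =
  (fun n => \sum_(j < n.+1) ((jcoef p n j)%:C - (E^-1)%:C) * jterm Y j
     + (E^-1)%:C * series (jterm Y) n.+1).
  apply/funext => n; rewrite /series /= big_mkord mulr_sumr -big_split /=.
  by apply: eq_bigr => j _; rewrite mulrBl subrK.
have hJ := @cvg_subseq _ (series (jterm Y)) _ S leqnSn (jac_cvg Y0).
rewrite -[X in _ --> X]add0r; apply: (cvgD h2).
exact: (cvgM (cvg_cst _) hJ).
Qed.

Definition theta_partial (z : C) n : C :=
  \prod_(i < n) ((1 - z * p%:C ^+ i) * (1 - p%:C ^+ i.+1 / z)).

Lemma theta_cvg : exists2 K : C, K != 0 &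
  forall Y : C, Y != 0 -> theta_partial (Y ^+ 2) @ \oo --> K * (Y * jac Y).
Proof.
have [E E0 [cE Eb]] := euler_lim.
have EV0 : (E^-1)%:C != 0 by rewrite fmorph_eq0 invr_eq0 gt_eqF.
exists (E^-1)%:C => // Y Y0; pose z := Y ^+ 2; pose P := p%:C.
have z0 : z != 0 by rewrite expf_neq0.
have cG := jcoef_series E0 cE Eb Y0.
pose th := theta_partial z.
have P_gen k : 1 - P ^+ k.+1 != 0.
  by rewrite -rmorphXn -(rmorph1 (real_complex R)) -rmorphB fmorph_eq0.
have P0 : P != 0 by rewrite fmorph_eq0.
have eulerC k : euler P k = (euler p k)%:C.
  rewrite /euler rmorph_prod; apply: eq_bigr => i _.
  by rewrite rmorphB rmorph1 rmorphXn.
have GE n : \sum_(j < n.+1) (jcoef p n j)%:C * jterm Y j =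
    Y^-1 * (th n * (1 - z * P ^+ n)).
  transitivity (\sum_(j < n.+1) jcoef P n j * jsign P j * jodd Y j).
    apply: eq_bigr => j _; rewrite /jterm mulrA; congr (_ * _ * _).
      by rewrite /jcoef; case: ifP => _; rewrite ?rmorph0 // fmorph_div rmorphM !eulerC.
    by rewrite /jsign rmorphM !rmorphXn rmorphN1.
  rewrite -finite_triple_product // -mulrA; congr (_ * _).
  rewrite /th /theta_partial !big_split /= -/z -/P mulrA [RHS]mulrAC; congr (_ * _).
  have <- : \prod_(i < n.+1) (1 - z * P ^+ i) = \prod_(i < n) (1 - z * P ^+ i) * (1 - z * P ^+ n).
    by rewrite big_ord_recr.
  by rewrite big_ord_recl expr0 mulr1.
have cP : (fun n => z * P ^+ n) @ \oo --> (0 : C).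
  have -> : (fun n => z * P ^+ n) = (fun n => z * (p ^+ n)%:C).
    by apply/funext => n; rewrite rmorphXn.
  rewrite -(mulr0 z); apply: cvgM; first exact: cvg_cst.
  rewrite -(rmorph0 (real_complex R)); apply: cvg_realC; apply: cvg_expr.
  by case/andP: hp => p1 p2; rewrite gtr0_norm.
(* This factor is missing from the partial product of theta. *)
have c1 : (fun n => 1 - z * P ^+ n) @ \oo --> (1 : C).
  by rewrite -[X in _ --> X]subr0; exact: (cvgB (cvg_cst _) cP).
have H : (fun n => (Y * \sum_(j < n.+1) (jcoef p n j)%:C * jterm Y j)
    / (1 - z * P ^+ n)) @ \oo --> (E^-1)%:C * (Y * jac Y).
  rewrite -[X in _ --> X]divr1 mulrCA; apply: cvgM.
    exact: (cvgM (cvg_cst _) cG).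
  exact: (cvgV (oner_neq0 _) c1).
apply: cvg_trans H; apply: near_eq_cvg.
have n1 := (cvgrPdist_lt _ _).1 c1 1 ltr01.
near=> n.
have nz : 1 - z * P ^+ n != 0.
  have : `|1 - (1 - z * P ^+ n)| < 1 by near: n; exact: n1.
  by apply: contraTneq => ->; rewrite subr0 normr1 ltxx.
by rewrite GE mulrA divff // mul1r mulfK.
Unshelve. all: by end_near. Qed.

Lemma theta_jac : exists2 K : C, K != 0 &
  forall Y : C, Y != 0 -> theta p (Y ^+ 2) = K * (Y * jac Y).
Proof.
have [K K0 KE] := theta_cvg; exists K => // Y Y0.
by apply: cvg_lim (KE Y Y0); exact: norm_hausdorff.
Qed.

End JacobiSeries.

(** * The addition formula for Jacobi series *)

Section SubsetSums.

Lemma sum_subset (V : nmodType) (T : eqType) (F : T -> V) (s t : seq T) :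
  uniq s -> uniq t -> {subset s <= t} ->
  \sum_(x <- t) F x = \sum_(x <- s) F x + \sum_(x <- t | x \notin s) F x.
Proof.
move=> us ut st; rewrite (bigID (mem s)) /=; congr (_ + _).
rewrite -big_filter; apply: perm_big; apply: uniq_perm => //.
  exact: filter_uniq.
by move=> x; rewrite mem_filter andb_idr // => /st.
Qed.

(** Sums over different exhausting families of finite sets are compared through
the sums of absolute values over boxes. *)
Lemma sum_sandwich (K : numDomainType) (T : eqType) (F : T -> K) (s t u : seq T) :
  uniq s -> uniq t -> uniq u -> {subset s <= t} -> {subset t <= u} ->
  `|\sum_(x <- t) F x - \sum_(x <- s) F x| <=
  \sum_(x <- u) `|F x| - \sum_(x <- s) `|F x|.
Proof.
move=> us ut uu st tu; have su x : x \in s -> x \in u by move/st/tu.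
rewrite (sum_subset F us ut st) addrAC subrr add0r.
rewrite (sum_subset (fun x => `|F x|) us uu su) addrAC subrr add0r.
apply: (le_trans (ler_norm_sum _ _ _)).
rewrite -big_filter -[leRHS]big_filter.
rewrite (@sum_subset _ _ (fun x => `|F x|) [seq x <- t | x \notin s]
  [seq x <- u | x \notin s]) ?filter_uniq //.
  by rewrite lerDl sumr_ge0.
by move=> x; rewrite !mem_filter => /andP[-> /tu].
Qed.

End SubsetSums.

Definition zrange n : seq int := [seq Posz j | j <- iota 0 n] ++ [seq Negz j | j <- iota 0 n].

Lemma mem_zrange n m : (m \in zrange n) = (- n%:Z <= m < n%:Z).
Proof.
rewrite mem_cat; case: m => j.
  rewrite (mem_map (f := Posz)); last by move=> ? ? [].
  rewrite mem_iota /= add0n; case: mapP => [[]//|_]; rewrite orbF.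
  by apply/idP/idP; lia.
rewrite orbC (mem_map (f := Negz)); last by move=> ? ? [].
rewrite mem_iota /= add0n; case: mapP => [[]//|_]; rewrite orbF.
by apply/idP/idP; lia.
Qed.

Lemma zrange_uniq n : uniq (zrange n).
Proof.
rewrite cat_uniq !map_inj_uniq ?iota_uniq ?andbT /=; try by move=> ? ? [].
by apply/hasPn => _ /mapP[j _ ->]; apply/mapP => -[].
Qed.

Lemma big_zrange (V : nmodType) (F : int -> V) n :
  \sum_(m <- zrange n) F m = \sum_(j < n) (F (Posz j) + F (Negz j)).
Proof.
have -> : zrange n = [seq Posz j | j <- index_iota 0 n] ++ [seq Negz j | j <- index_iota 0 n].
  by rewrite /index_iota subn0.
by rewrite big_cat !big_map /= !big_mkord big_split.
Qed.

Section Addition.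
Variables (R : realType) (p : R).
Hypotheses (hp : 0 < p < 1).
Local Notation C := (Cx R).
Local Notation "x %:C" := (real_complex R x : C).

Let rho : C := (Num.sqrt p)%:C.

Let rho2 : rho ^+ 2 = p%:C.
Proof. by rewrite -rmorphXn sqr_sqrtr //; case/andP: hp => /ltW. Qed.

Let rho0 : rho != 0.
Proof. by rewrite fmorph_eq0 sqrtr_eq0 -ltNge; case/andP: hp. Qed.

(** The terms of the Jacobi series indexed by all integers, which makes room for
the change of variables m = k + d, n = k - d. *)
Definition jmono (Y : C) (m : int) : C :=
  - (-1) ^ m * rho ^ (m * m + m) * Y ^ (2 * m + 1).

Lemma jsignC j : (jsign p j)%:C = (-1) ^+ j * rho ^+ (j * j + j).
Proof.
rewrite /jsign rmorphM !rmorphXn rmorphN1; congr (_ * _).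
transitivity ((rho ^+ 2) ^+ 'C(j.+1, 2)); first by rewrite rho2.
rewrite -exprM; congr (_ ^+ _); rewrite mulnC bin2 /= muln2.
by rewrite even_halfK; [lia|rewrite oddM /= andNb].
Qed.

Lemma jmono_Posz Y j : jmono Y (Posz j) = - (jsign p j)%:C * Y ^+ (2 * j).+1.
Proof.
by rewrite /jmono jsignC -!PoszM -!PoszD -!exprnP addn1; ring.
Qed.

Lemma jmono_Negz Y j : jmono Y (Negz j) = (jsign p j)%:C * Y ^- (2 * j).+1.
Proof.
rewrite /jmono jsignC.
rewrite (_ : Negz j * Negz j + Negz j = (j * j + j)%:Z); last by lia.
rewrite (_ : 2 * Negz j + 1 = - (2 * j).+1%:Z); last by lia.
by rewrite expN1r /= -exprnN -exprnP exprS; ring.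
Qed.

Lemma jac_partial Y n : series (jterm p Y) n = \sum_(m <- zrange n) jmono Y m.
Proof.
rewrite big_zrange /series /= big_mkord; apply: eq_bigr => j _.
by rewrite jmono_Posz jmono_Negz /jterm /jodd; ring.
Qed.

Lemma jmono_abs Y : Y != 0 -> exists2 al : nat -> R, cvgn al &
  forall n, \sum_(m <- zrange n) `|jmono Y m| = (al n)%:C.
Proof.
move=> Y0; have [b cb bP] := jexp_bound hp Y0.
have /choice[c cP] : forall j, exists c : R,
    `|jmono Y (Posz j)| + `|jmono Y (Negz j)| = c%:C.
  by move=> j; apply: ge0_realC; rewrite addr_ge0.
have c0 j : 0 <= c j by rewrite -ge0CR -cP addr_ge0.
have cb' j : c j <= b j.
  rewrite -leCR -cP (le_trans _ (bP j)) // jmono_Posz jmono_Negz !normrM normrN.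
  by rewrite mulrDr addrC.
exists (series c).
  apply: series_le_cvg cb => // j; exact: le_trans (cb' j).
move=> n; rewrite big_zrange /series /= big_mkord rmorph_sum.
by apply: eq_bigr => j _; rewrite cP.
Qed.

Let xmono (a : C) (k : int) : C := rho ^ (2 * (k * k) + 2 * k) * a ^ (4 * k + 2).
Let ymono (a : C) (k : int) : C := rho ^ (2 * (k * k)) * a ^ (4 * k).

Lemma jmono_prod a b m n : a != 0 -> b != 0 ->
  jmono (a * b) m * jmono (a / b) n =
  (-1) ^ (m + n) * rho ^ (m * m + m + (n * n + n)) * a ^ (2 * (m + n + 1)) *
    b ^ (2 * (m - n)).
Proof.
move=> a0 b0; have N10 : (-1 : C) != 0 by rewrite oppr_eq0 oner_eq0.
rewrite /jmono !expfzMl !exprz_inv.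
rewrite (_ : 2 * (m + n + 1) = (2 * m + 1) + (2 * n + 1)); last by ring.
rewrite (_ : 2 * (m - n) = (2 * m + 1) + - (2 * n + 1)); last by ring.
rewrite (expfzDr (2 * m + 1) _ a0) (expfzDr (2 * m + 1) _ b0).
rewrite (expfzDr (m * m + m) _ rho0) (expfzDr m n N10).
move: (a ^ _) (a ^ _) (b ^ _) (b ^ _) (rho ^ _) (rho ^ _) (_ ^ m) (_ ^ n).
by move=> *; ring.
Qed.

(** For m + n even the product of the terms m and n separates in k and d into a
function of a and a function of b; jmono_prod_odd treats m + n odd. *)
Lemma jmono_prod_even a b k d : a != 0 -> b != 0 ->
  jmono (a * b) (k + d) * jmono (a / b) (k - d) = xmono a k * ymono b d.
Proof.
move=> a0 b0; rewrite jmono_prod // /xmono /ymono.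
rewrite (_ : k + d + (k - d) = 2 * k); last by ring.
rewrite (_ : 2 * (2 * k + 1) = 4 * k + 2); last by ring.
rewrite (_ : 2 * (k + d - (k - d)) = 4 * d); last by ring.
rewrite (_ : (k + d) * (k + d) + _ + _ = 2 * (k * k) + 2 * k + 2 * (d * d)); last by ring.
rewrite -exprz_exp (_ : (-1) ^ 2 = 1 :> C) ?exp1rz; last by rewrite -exprnP sqrrN expr1n.
rewrite (expfzDr _ (2 * (d * d)) rho0).
by move: (a ^ _) (b ^ _) (rho ^ _) (rho ^ _) => *; ring.
Qed.

Lemma jmono_prod_odd a b k d : a != 0 -> b != 0 ->
  jmono (a * b) (k + d) * jmono (a / b) (k - d - 1) = - (ymono a k * xmono b d).
Proof.
move=> a0 b0; rewrite jmono_prod // /xmono /ymono.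
rewrite (_ : k + d + (k - d - 1) = 2 * k + -1); last by ring.
rewrite (_ : 2 * (2 * k + -1 + 1) = 4 * k); last by ring.
rewrite (_ : 2 * (k + d - (k - d - 1)) = 4 * d + 2); last by ring.
rewrite (_ : (k + d) * (k + d) + _ + _ = 2 * (k * k) + (2 * (d * d) + 2 * d)); last by ring.
have N10 : (-1 : C) != 0 by rewrite oppr_eq0 oner_eq0.
rewrite (expfzDr _ _ N10).
rewrite -exprz_exp (_ : (-1) ^ 2 = 1 :> C) ?exp1rz; last by rewrite -exprnP sqrrN expr1n.
rewrite (_ : (-1) ^ (-1) = -1 :> C); last by rewrite expN1r.
rewrite (expfzDr (2 * (k * k)) _ rho0).
by move: (a ^ _) (b ^ _) (rho ^ _) (rho ^ _) => *; ring.
Qed.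

Let rank2 n (a b : C) : C :=
  (\sum_(k <- zrange n) xmono a k) * (\sum_(d <- zrange n) ymono b d)
  - (\sum_(k <- zrange n) ymono a k) * (\sum_(d <- zrange n) xmono b d).

(** The pairs (m, n) with m + n even, then those with m + n odd, in the rotated
coordinates k and d. *)
Let zrot n : seq (int * int) :=
  [seq (k + d, k - d) | k <- zrange n, d <- zrange n] ++
  [seq (k + d, k - d - 1) | k <- zrange n, d <- zrange n].

Lemma mem_zrot1 n (s : int) x :
  (x \in [seq (k + d, k - d - s) | k <- zrange n, d <- zrange n]) ->
  exists k d, [/\ k \in zrange n, d \in zrange n & x = (k + d, k - d - s)].
Proof. by case/allpairsP => -[k d] [? ? ->]; exists k, d. Qed.

Lemma zrotE n : zrot n = [seq (k + d, k - d - 0) | k <- zrange n, d <- zrange n] ++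
  [seq (k + d, k - d - 1) | k <- zrange n, d <- zrange n].
Proof.
by congr (_ ++ _); apply: eq_allpairs => k d; rewrite subr0.
Qed.

Lemma zrot_uniq n : uniq (zrot n).
Proof.
have H (s : int) : uniq [seq (k + d, k - d - s) | k <- zrange n, d <- zrange n].
  by apply: allpairs_uniq; rewrite ?zrange_uniq // => -[k d] [k' d'] _ _ /= [? ?];
    congr (_, _); lia.
rewrite zrotE cat_uniq !H andbT /=; apply/hasPn => x /mem_zrot1[k [d [_ _ ->]]].
by apply/negP => /mem_zrot1[k' [d' [_ _ [? ?]]]]; lia.
Qed.

Lemma zrot_sup n : {subset [seq (k, d) | k <- zrange n, d <- zrange n] <= zrot n.+1}.
Proof.
move=> _ /allpairsP[[m k] [/= hm hk ->]]; rewrite zrotE mem_cat.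
rewrite !mem_zrange in hm hk.
have [e|e] : (m + k = 2 * ((m + k) %/ 2)%Z) \/ (m + k = 2 * ((m + k) %/ 2)%Z + 1) by lia.
- apply/orP; left; apply/allpairsP; exists (((m + k) %/ 2)%Z, m - ((m + k) %/ 2)%Z).
  by rewrite /= !mem_zrange; split; [lia|lia|congr (_, _); lia].
- apply/orP; right; apply/allpairsP; exists (((m + k) %/ 2)%Z + 1, m - ((m + k) %/ 2)%Z - 1).
  by rewrite /= !mem_zrange; split; [lia|lia|congr (_, _); lia].
Qed.

Lemma zrot_sub n : {subset zrot n.+1 <=
  [seq (k, d) | k <- zrange (2 * n).+3, d <- zrange (2 * n).+3]}.
Proof.
move=> x; rewrite zrotE mem_cat => /orP[] /mem_zrot1[k [d [hk hd ->]]];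
  apply/allpairsP; [exists (k + d, k - d - 0)|exists (k + d, k - d - 1)];
  by move: hk hd; rewrite /= !mem_zrange; split => //; lia.
Qed.

Lemma rank2E n a b : a != 0 -> b != 0 ->
  rank2 n a b = \sum_(x <- zrot n) jmono (a * b) x.1 * jmono (a / b) x.2.
Proof.
move=> a0 b0; rewrite big_cat !big_allpairs_dep /= /rank2; congr (_ + _).
  rewrite mulr_suml; apply: eq_bigr => k _; rewrite mulr_sumr.
  by apply: eq_bigr => d _; rewrite jmono_prod_even.
rewrite mulr_suml -sumrN; apply: eq_bigr => k _; rewrite mulr_sumr -sumrN.
by apply: eq_bigr => d _; rewrite jmono_prod_odd.
Qed.

(** The rotated boxes lie between two boxes in the original coordinates, so that
absolute convergence identifies the limit of the determinants. *)
Lemma rank2_cvg a b : a != 0 -> b != 0 ->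
  (fun n => rank2 n.+1 a b) @ \oo --> jac p (a * b) * jac p (a / b).
Proof.
move=> a0 b0; have ab0 : a * b != 0 by rewrite mulf_neq0.
have ab0' : a / b != 0 by rewrite mulf_neq0 ?invr_eq0.
have [al cal alE] := jmono_abs ab0; have [be cbe beE] := jmono_abs ab0'.
pose F (x : int * int) := jmono (a * b) x.1 * jmono (a / b) x.2.
pose box n := [seq (k, d) | k <- zrange n, d <- zrange n].
have box_uniq n : uniq (box n).
  by apply: allpairs_uniq; rewrite ?zrange_uniq // => -[? ?] [? ?] _ _.
have absbox n : \sum_(x <- box n) `|F x| = (al n * be n)%:C.
  transitivity ((al n)%:C * (be n)%:C); last by rewrite -rmorphM.
  rewrite big_allpairs_dep /= -alE -beE mulr_suml; apply: eq_bigr => k _.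
  by rewrite mulr_sumr; apply: eq_bigr => d _; rewrite normrM.
have sumbox n : \sum_(x <- box n) F x =
    series (jterm p (a * b)) n * series (jterm p (a / b)) n.
  transitivity ((\sum_(m <- zrange n) jmono (a * b) m) *
      (\sum_(m <- zrange n) jmono (a / b) m)); last first.
    by rewrite (jac_partial (a * b) n) (jac_partial (a / b) n).
  rewrite big_allpairs_dep mulr_suml; apply: eq_bigr => k _.
  by rewrite mulr_sumr.
have h0 : (fun n => al (2 * n).+3 * be (2 * n).+3 - al n * be n) @ \oo --> 0.
  have sub (u : nat -> R) : cvgn u -> (fun n => u (2 * n).+3) @ \oo --> limn u.
    by move=> cu; apply: (@cvg_subseq _ u _ (fun n => (2 * n).+3)) cu => n; lia.
  rewrite -(subrr (limn al * limn be)); apply: cvgB; first by apply: cvgM; exact: sub.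
  exact: (cvgM cal cbe).
(* The rotated box of size n + 1 contains the box of size n and is contained in
   the box of size 2 n + 3. *)
have h : (fun n => rank2 n.+1 a b - \sum_(x <- box n) F x) @ \oo --> (0 : C).
  apply: squeezeC h0 => n; rewrite subr0 rank2E //.
  have -> : (al (2 * n).+3 * be (2 * n).+3 - al n * be n)%:C =
      \sum_(x <- box (2 * n).+3) `|F x| - \sum_(x <- box n) `|F x|.
    by rewrite !absbox -rmorphB.
  apply: sum_sandwich => //; [exact: zrot_uniq|exact: zrot_sup|exact: zrot_sub].
have -> : (fun n => rank2 n.+1 a b) = (fun n => (rank2 n.+1 a b - \sum_(x <- box n) F x)
   + series (jterm p (a * b)) n * series (jterm p (a / b)) n).
  by apply/funext => n; rewrite -sumbox subrK.
rewrite -[X in _ --> X]add0r.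
exact: (cvgD h (cvgM (jac_cvg hp ab0) (jac_cvg hp ab0'))).
Qed.

(** By rank2_cvg each phi is a two by two minor of the same two by four matrix, and
the claim is the Pluecker relation between these minors. *)
Lemma jac_addition a b c d : a != 0 -> b != 0 -> c != 0 -> d != 0 ->
  let phi x y := jac p (x * y) * jac p (x / y) in
  phi a b * phi c d - phi a c * phi b d + phi a d * phi b c = 0.
Proof.
move=> a0 b0 c0 d0 phi.
have H : (fun n => rank2 n.+1 a b * rank2 n.+1 c d - rank2 n.+1 a c * rank2 n.+1 b d
   + rank2 n.+1 a d * rank2 n.+1 b c) @ \oo -->
   (phi a b * phi c d - phi a c * phi b d + phi a d * phi b c).
  exact: (cvgD (cvgB (cvgM (rank2_cvg a0 b0) (rank2_cvg c0 d0))
    (cvgM (rank2_cvg a0 c0) (rank2_cvg b0 d0)))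
    (cvgM (rank2_cvg a0 d0) (rank2_cvg b0 c0))).
rewrite -(cvg_lim (@norm_hausdorff _ _) H); apply: cvg_lim; first exact: norm_hausdorff.
rewrite (_ : (fun n => _) = fun=> 0); first exact: cvg_cst.
have plucker (x1 y1 x2 y2 x3 y3 x4 y4 : C) :
    (x1 * y2 - y1 * x2) * (x3 * y4 - y3 * x4) -
    (x1 * y3 - y1 * x3) * (x2 * y4 - y2 * x4) +
    (x1 * y4 - y1 * x4) * (x2 * y3 - y2 * x3) = 0 by ring.
by apply/funext => n; exact: plucker.
Qed.

Lemma jac_inv a : a != 0 -> jac p a^-1 = - jac p a.
Proof.
move=> a0; rewrite /jac; apply: cvg_lim; first exact: norm_hausdorff.
have -> : series (jterm p a^-1) = (fun n => - series (jterm p a) n).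
  apply/funext => n; rewrite /series /= -sumrN; apply: eq_bigr => j _.
  by rewrite /jterm /jodd exprVn invrK -mulrN opprB.
exact: (cvgN (jac_cvg hp a0)).
Qed.

End Addition.

(** * The odd theta bracket *)

(** The power of q makes the function odd in x. The definition is locked because
unification would otherwise unfold the infinite product. *)
HB.lock Definition br (R : realType) (q p : R) (x : Cx R) : Cx R :=
  qpow q (- x) * theta p (q2 q x).

Section Bracket.
Variables (R : realType) (q p : R).
Hypotheses (hq : 0 < q < 1) (hp : 0 < p < 1).
Local Notation C := (Cx R).
Local Notation "x %:C" := (real_complex R x : C).

Lemma qpow0 : qpow q 0 = 1 :> C.
Proof. by rewrite /qpow /= !mul0r expR0 cos0 sin0 mulr1 mulr0. Qed.

Lemma qpowD (x y : C) : qpow q (x + y) = qpow q x * qpow q y.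
Proof.
case: x => a b; case: y => c d; rewrite /qpow /=.
rewrite !mulrDl expRD cosD sinD; apply/eqP; rewrite eq_complex /=.
by apply/andP; split; apply/eqP; ring.
Qed.

Lemma qpow_neq0 (x : C) : qpow q x != 0.
Proof.
apply/negP => /eqP h; have := qpowD x (- x).
by rewrite subrr qpow0 h mul0r => /eqP; rewrite oner_eq0.
Qed.

Lemma qpowN (x : C) : qpow q (- x) = (qpow q x)^-1.
Proof.
apply: (mulIf (qpow_neq0 x)).
by rewrite -qpowD addNr qpow0 mulVf // qpow_neq0.
Qed.

Lemma qpow_sqr (x : C) : qpow q (2 * x) = qpow q x ^+ 2.
Proof. by rewrite mulr_natl mulr2n qpowD expr2. Qed.

Lemma q2D (x y : C) : q2 q (x + y) = q2 q x * q2 q y.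
Proof. by rewrite /q2 mulrDr qpowD. Qed.

Lemma q2_0 : q2 q 0 = 1 :> C.
Proof. by rewrite /q2 mulr0 qpow0. Qed.

Lemma q2E (x : C) : q2 q x = qpow q (2 * x). Proof. by []. Qed.

Lemma q2_neq0 (x : C) : q2 q x != 0. Proof. exact: qpow_neq0. Qed.

Lemma q2N (x : C) : q2 q (- x) = (q2 q x)^-1.
Proof. by apply: (mulIf (q2_neq0 x)); rewrite -q2D addNr q2_0 mulVf ?q2_neq0. Qed.

Lemma q2_nat (i : nat) : q2 q i%:R = (q ^+ (2 * i))%:C.
Proof.
elim: i => [|i IH]; first by rewrite /q2 mulr0 qpow0 muln0 expr0.
rewrite -natr1 q2D IH mulnS addnC exprD rmorphM; congr (_ * _).
rewrite /q2 mulr1 -[2]mulr1 qpow_sqr rmorphXn; congr (_ ^+ _).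
rewrite /qpow /= mul1r mul0r cos0 sin0 mulr0 mulr1 lnK // posrE.
by case/andP: hq.
Qed.

Lemma unit_circle (a b : R) : a ^+ 2 + b ^+ 2 = 1 ->
  exists t : R, cos t = a /\ sin t = b.
Proof.
move=> ab1; have a1 : -1 <= a <= 1.
  by have b2 := sqr_ge0 b; apply/andP; split; nra.
have sb : sin (acos a) = `|b|.
  by rewrite sin_acos // -ab1 addrAC subrr add0r sqrtr_sqr.
have [b0|b0] := leP 0 b.
  by exists (acos a); rewrite acosK ?in_itv //= sb ger0_norm.
by exists (- acos a); rewrite cosN sinN acosK ?in_itv //= sb ltr0_norm // opprK.
Qed.

(** Every spectral ratio w / z can thus be written as q^2v, with an additive
parameter v. *)
Lemma q2_surj (z : C) : z != 0 -> exists x : C, q2 q x = z.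
Proof.
case: z => a b z0; have /andP[q0 q1] := hq.
have lnq0 : ln q != 0 by rewrite lt_eqF // ln_lt0 // q0.
have s0 : 0 < a ^+ 2 + b ^+ 2.
  rewrite lt_neqAle addr_ge0 ?sqr_ge0 // andbT eq_sym paddr_eq0 ?sqr_ge0 //.
  by move: z0; rewrite eq_complex !sqrf_eq0.
pose r := Num.sqrt (a ^+ 2 + b ^+ 2).
have r0 : 0 < r by rewrite sqrtr_gt0.
have r2 : r ^+ 2 = a ^+ 2 + b ^+ 2 by rewrite sqr_sqrtr // ltW.
have [t [ct st]] : exists t : R, cos t = a / r /\ sin t = b / r.
  apply: unit_circle; rewrite !expr_div_n -mulrDl -r2 divff //.
  by rewrite expf_neq0 // gt_eqF.
pose y : C := (ln r / ln q +i* (t / ln q))%C.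
exists (y / 2); rewrite /q2 mulrCA divff ?pnatr_eq0 // mulr1 /qpow /y /=.
rewrite !mulfVK // lnK ?posrE // ct st.
by congr (_ +i* _)%C; field; rewrite gt_eqF.
Qed.

Local Notation br := (br q p).

Lemma theta_br (x : C) : theta p (q2 q x) = qpow q x * br x.
Proof. by rewrite br.unlock mulrA -qpowD subrr qpow0 mul1r. Qed.

Lemma br_jac : exists2 K : C, K != 0 & forall x, br x = K * jac p (qpow q x).
Proof.
have [K K0 KE] := theta_jac hp; exists K => // x.
rewrite br.unlock /q2 qpow_sqr KE ?qpow_neq0 // qpowN mulrCA mulKf //.
exact: qpow_neq0.
Qed.

Lemma brN (x : C) : br (- x) = - br x.
Proof.
have [K K0 KE] := br_jac.
by rewrite !KE qpowN jac_inv ?qpow_neq0 // mulrN.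
Qed.

Lemma br0 : br 0 = 0.
Proof.
by have /eqP := brN 0; rewrite oppr0 -addr_eq0 -mulr2n mulrn_eq0 /= => /eqP.
Qed.

Lemma br_addition (x y u v : C) :
  br (x + y) * br (x - y) * (br (u + v) * br (u - v)) -
  br (x + u) * br (x - u) * (br (y + v) * br (y - v)) +
  br (x + v) * br (x - v) * (br (y + u) * br (y - u)) = 0.
Proof.
have [K K0 KE] := br_jac; have qn := qpow_neq0.
have := jac_addition hp (qn x) (qn y) (qn u) (qn v) => /= H.
rewrite !KE !qpowD !qpowN -[RHS](mulr0 (K ^+ 4)) -H.
move: (jac p _) (jac p _) (jac p _) (jac p _) (jac p _) (jac p _) (jac p _)
  (jac p _) (jac p _) (jac p _) (jac p _) (jac p _) => *.
by ring.
Qed.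

Hypothesis hqp : forall i m : nat, (0 < i)%N -> q ^+ (2 * i) != p ^+ m.

(** Apart from finitely many factors, none of which vanishes, both products in
theta stay away from zero by prod_bound. *)
Lemma theta_real_neq0 (x : R) : 0 < x < 1 -> (forall m, x != p ^+ m) ->
  theta p x%:C != 0.
Proof.
move=> /andP[x0 x1] xp; have /andP[p0 p1] := hp.
have [c c0 cP] : exists2 c : R, 0 < c & forall n,
    c <= \prod_(i < n) (1 - x * p ^+ i).
  by apply: prod_bound => //; rewrite ltW.
have [i0 i0P] : exists i0, p ^+ i0.+1 / x < 1.
  have h : (fun n => p ^+ n) @ \oo --> 0.
    by apply: cvg_expr; rewrite gtr0_norm.
  have [N _ HN] := (cvgrPdist_lt _ _).1 h x x0.
  exists N; have := HN N.+1 (leqnSn N); rewrite /= sub0r normrN => h1.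
  by rewrite ltr_pdivrMr // mul1r (le_lt_trans _ h1) // ler_norm.
have [d d0 dP] : exists2 d : R, 0 < d & forall n,
    d <= \prod_(i < n) (1 - p ^+ i0.+1 / x * p ^+ i).
  by apply: prod_bound => //; rewrite i0P divr_ge0 ?exprn_ge0 // ltW.
pose e := `|\prod_(i < i0) (1 - p ^+ i.+1 / x)|.
have e0 : 0 < e.
  rewrite normr_gt0; apply/prodf_neq0 => i _; rewrite subr_eq0 eq_sym.
  apply: contra (xp i.+1) => /eqP h.
  by rewrite -(mulfVK (lt0r_neq0 x0) (p ^+ i.+1)) h mul1r.
pose u n := \prod_(i < n) ((1 - x * p ^+ i) * (1 - p ^+ i.+1 / x)).
have uP n : c * (e * d) <= `|u (i0 + n)%N|.
  have c_le (y z : R) : 0 < y -> y <= z -> y <= `|z|.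
    by move=> _ yz; apply: le_trans yz (ler_norm z).
  rewrite /u big_split /= normrM; apply: ler_pM.
  - exact: ltW.
  - by rewrite ltW // mulr_gt0.
  - exact: c_le c0 (cP _).
  rewrite big_split_ord /= normrM; apply: ler_pM; [exact: ltW|exact: ltW|exact: lexx|].
  have <- : \prod_(i < n) (1 - p ^+ i0.+1 / x * p ^+ i) =
      \prod_(i < n) (1 - p ^+ (i0 + i).+1 / x).
    by apply: eq_bigr => i _; rewrite -addSn exprD mulrAC.
  exact: c_le d0 (dP _).
have x0C : x%:C != 0 by rewrite fmorph_eq0 gt_eqF.
have [s sE] := q2_surj x0C.
have [K K0 /(_ (qpow q s) (qpow_neq0 s))] := theta_cvg hp.
rewrite -qpow_sqr -/(q2 q s) sE => cth.
have -> : theta p x%:C = K * (qpow q s * jac p (qpow q s)).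
  by apply: cvg_lim cth; exact: norm_hausdorff.
apply/negP => /eqP L0; rewrite L0 in cth.
have ced : 0 < c * (e * d) by rewrite !mulr_gt0.
have cedC : (0 : C) < (c * (e * d))%:C by rewrite -[0]/(0%:C) ltCR.
have [N _ HN] := (cvgrPdist_lt _ _).1 cth _ cedC.
have := HN (i0 + N)%N (leq_addl _ _); rewrite /= sub0r normrN.
have -> : theta_partial p x%:C (i0 + N) = (u (i0 + N)%N)%:C.
  rewrite /u rmorph_prod; apply: eq_bigr => i _.
  by rewrite rmorphM !rmorphB !rmorph1 fmorph_div rmorphM !rmorphXn.
by rewrite normCR ltCR ltNge uP.
Qed.

Lemma br_nat_neq0 i : (0 < i)%N -> br i%:R != 0.
Proof.
move=> i0; rewrite br.unlock mulf_neq0 ?qpow_neq0 // q2_nat theta_real_neq0 //.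
  case/andP: hq => q0 q1; rewrite exprn_gt0 // exprn_ilt1 ?ltW //.
  by rewrite muln_eq0 /= -lt0n.
by move=> m; exact: hqp.
Qed.

End Bracket.

(** * Classes of meromorphic functions *)

Section MeromorphicCalculus.
Variable R : realType.
Local Notation C := (Cx R).
Local Notation M := (Mer R).
Implicit Types f g : C -> C.

(** Equality of two classes of meromorphic functions means equality in this
sense, by toM_eq and toM_inj. *)
Definition ae (P : C -> Prop) : Prop := forall c : C, \forall x \near c^', P x.

Lemma ae_and (P Q : C -> Prop) : ae P -> ae Q -> ae (fun x => P x /\ Q x).
Proof. by move=> hP hQ c; apply: filterI; [exact: hP|exact: hQ]. Qed.

Lemma ae_impl (P Q : C -> Prop) : (forall x, P x -> Q x) -> ae P -> ae Q.
Proof. by move=> PQ hP c; apply: filterS (hP c). Qed.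

Lemma ae_sum (I : eqType) (t : seq I) (F : C -> I -> C) (G : I -> C -> C) :
  (forall l, l \in t -> ae (fun x => F x l = G l x)) ->
  ae (fun x => \sum_(l <- t) F x l = \sum_(l <- t) G l x).
Proof.
elim: t => [|l t IH] h; first by move=> c; apply: nearW => x; rewrite !big_nil.
have h1 := h l (mem_head _ _); have h2 := IH (fun i it => h i (@mem_behead _ (l :: t) i it)).
by apply: ae_impl (ae_and h1 h2) => x [e1 e2]; rewrite !big_cons e1 e2.
Qed.

Lemma near_shift (P : C -> Prop) (a c : C) :
  (\forall x \near c + a, P x) -> \forall x \near c, P (x + a).
Proof.
move=> /nbhs_normP[e e0 eP]; apply/nbhs_normP; exists e => // x xc.
by apply: eP; move: xc; rewrite /= opprD addrACA subrr addr0.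
Qed.

Lemma dnbhs_shift (P : C -> Prop) (a c : C) :
  (\forall x \near (c + a)^', P x) -> \forall x \near c^', P (x + a).
Proof.
move=> hP; have : \forall y \near c + a, y != c + a -> P y by exact: hP.
move=> /near_shift h.
suff : \forall x \near c, x != c -> P (x + a) by [].
by apply: filterS h => x Px xc; apply: Px; rewrite (inj_eq (addIr a)).
Qed.

Lemma ae_shift (P : C -> Prop) (a : C) : ae P -> ae (fun x => P (x + a)).
Proof. by move=> hP c; apply: dnbhs_shift. Qed.

Lemma holomorphic_near_shift f (a c : C) :
  holomorphic_near f (c + a) -> holomorphic_near (fun x => f (x + a)) c.
Proof.
move=> /near_shift; apply: filterS => x; rewrite /derivable.
set u := (X in cvg (X @ _)) => cu; set v := (X in cvg (X @ _)).
suff -> : v = u by [].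
by apply/funext => h; rewrite /v /u /= addrA.
Qed.

Lemma meromorphic_shift f (a : C) :
  meromorphic f -> meromorphic (fun x => f (x + a)).
Proof.
move=> mf c; have [g [h [hg hh e]]] := mf (c + a).
exists (fun x => g (x + a)), (fun x => h (x + a)); split.
- exact: holomorphic_near_shift.
- exact: holomorphic_near_shift.
exact: (dnbhs_shift e).
Qed.

Lemma meromorphic_ae f g : ae (fun x => f x = g x) -> meromorphic f -> meromorphic g.
Proof.
move=> fg mf c; have [u [v [hu hv e]]] := mf c; exists u, v; split => //.
near=> x; have <- : f x = g x by near: x; exact: fg.
by near: x.
Unshelve. all: by end_near. Qed.

Lemma meromorphicV f : ae (fun x => f x != 0) -> meromorphic f ->
  meromorphic (fun x => (f x)^-1).
Proof.
move=> f0 mf c; have [u [v [hu hv e]]] := mf c; exists v, u; split => //.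
near=> x.
have [v0 fE] : v x != 0 /\ f x = u x / v x by near: x; exact: e.
have : f x != 0 by near: x; exact: f0.
by rewrite fE invf_div mulf_eq0 negb_or => /andP[].
Unshelve. all: by end_near. Qed.

Lemma meromorphic_cst (k : C) : meromorphic (fun=> k).
Proof.
move=> c; exists (fun=> k), (fun=> 1); split.
- by near=> x; exact: derivable_cst.
- by near=> x; exact: derivable_cst.
- by near=> x; rewrite oner_neq0 divr1.
Unshelve. all: by end_near. Qed.

Lemma meroP f : reflect (meromorphic f) (f \in @mero R).
Proof. exact: asboolP. Qed.

Lemma meromorphicM f g : meromorphic f -> meromorphic g ->
  meromorphic (fun x => f x * g x).
Proof. by move=> /meroP mf /meroP mg; apply/meroP; exact: (rpredM mf mg). Qed.

Lemma meromorphicD f g : meromorphic f -> meromorphic g ->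
  meromorphic (fun x => f x + g x).
Proof. by move=> /meroP mf /meroP mg; apply/meroP; exact: (rpredD mf mg). Qed.

Lemma insubd_mero f : meromorphic f -> merofun_val (insubd (0 : merofun R) f) = f.
Proof. by move=> /meroP mf; rewrite [LHS]insubdK. Qed.

Lemma toM_nonmero f : ~ meromorphic f -> toM f = 0.
Proof.
move=> mf; rewrite /toM /insubd insubN; last by apply/meroP.
by rewrite /= raddf0.
Qed.

Lemma pi_eq (f g : merofun R) : ae (fun x => merofun_val f x = merofun_val g x) <->
  (\pi_M f = \pi_M g)%qT.
Proof.
have -> : ((\pi_M f = \pi_M g)%qT) <-> f - g \in @negligible_mero R.
  by rewrite Quotient.idealrBE; split=> [/eqP|/eqP].
split=> [fg|/asboolP fg].
  apply/asboolP => c; apply: filterS (fg c) => x.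
  by have -> : merofun_val (f - g) x = merofun_val f x - merofun_val g x by [];
    move=> ->; rewrite subrr.
move=> c; apply: filterS (fg c) => x.
have -> : merofun_val (f - g) x = merofun_val f x - merofun_val g x by [].
by move=> /eqP; rewrite subr_eq0 => /eqP.
Qed.

Lemma toM_eq f g : ae (fun x => f x = g x) -> toM f = toM g.
Proof.
move=> fg; have [mf|nf] := pselect (meromorphic f).
  have mg := meromorphic_ae fg mf.
  by rewrite /toM; apply/pi_eq; rewrite !insubd_mero.
rewrite !toM_nonmero // => mg; apply: nf; apply: meromorphic_ae mg.
by apply: ae_impl fg.
Qed.

Lemma toM_inj f g : meromorphic f -> meromorphic g -> toM f = toM g ->
  ae (fun x => f x = g x).
Proof. by move=> mf mg /pi_eq; rewrite !insubd_mero. Qed.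

Lemma toM_repr (F : M) : toM (merofun_val (repr F)) = F.
Proof. by rewrite /toM valKd reprK. Qed.

Lemma repr_mero (F : M) : meromorphic (merofun_val (repr F)).
Proof. by apply/meroP; case: (repr F). Qed.

Lemma toM_ex (F : M) : exists2 f, meromorphic f & F = toM f.
Proof.
by exists (merofun_val (repr F)); [exact: repr_mero|rewrite toM_repr].
Qed.

Lemma toMM f g : meromorphic f -> meromorphic g ->
  toM (fun x => f x * g x) = toM f * toM g.
Proof.
move=> mf mg; rewrite /toM -rmorphM; apply/pi_eq.
rewrite (insubd_mero (meromorphicM mf mg)) => c; apply: nearW => x.
have -> (u v : merofun R) : merofun_val (u * v) x = merofun_val u x * merofun_val v x by [].
by rewrite !insubd_mero.
Qed.

Lemma toMD f g : meromorphic f -> meromorphic g ->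
  toM (fun x => f x + g x) = toM f + toM g.
Proof.
move=> mf mg; rewrite /toM -rmorphD; apply/pi_eq.
rewrite (insubd_mero (meromorphicD mf mg)) => c; apply: nearW => x.
have -> (u v : merofun R) : merofun_val (u + v) x = merofun_val u x + merofun_val v x by [].
by rewrite !insubd_mero.
Qed.

Lemma toM1 : toM (fun=> 1) = 1 :> M.
Proof.
rewrite -(rmorph1 (\pi_M)%qT); apply/pi_eq; rewrite insubd_mero //.
  by move=> c; exact: nearW.
exact: meromorphic_cst.
Qed.

Lemma toM0 : toM (fun=> 0) = 0 :> M.
Proof.
rewrite -(raddf0 (\pi_M)%qT); apply/pi_eq; rewrite insubd_mero //.
  by move=> c; exact: nearW.
exact: meromorphic_cst.
Qed.

(** Scaling by a nonzero constant affects neither meromorphy nor its failure. *)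
Lemma toM_scale (c : C) f : toM (fun l => c * f l) = constM c * toM f.
Proof.
have [->|c0] := eqVneq c 0.
  by rewrite /constM toM0 mul0r (_ : (fun l => _) = (fun=> 0)) ?toM0 //; apply/funext => l; rewrite mul0r.
have [mf|nf] := pselect (meromorphic f); first by rewrite toMM //; exact: meromorphic_cst.
rewrite (toM_nonmero nf) mulr0; apply: toM_nonmero => mcf; apply: nf.
have -> : f = (fun l => c^-1 * (c * f l)) by apply/funext => l; rewrite mulKf.
by apply: meromorphicM => //; exact: meromorphic_cst.
Qed.

Lemma Tshift_toM c f : meromorphic f -> Tshift c (toM f) = toM (fun x => f (x + c)).
Proof.
move=> mf; apply: toM_eq.
have h : ae (fun y => merofun_val (repr (toM f)) y = f y).
  by apply: toM_inj => //; [exact: repr_mero|rewrite toM_repr].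
exact: (ae_shift c h).
Qed.

Lemma TshiftM c (F G : M) : Tshift c (F * G) = Tshift c F * Tshift c G.
Proof.
have [f mf ->] := toM_ex F; have [g mg ->] := toM_ex G.
rewrite -toMM // !Tshift_toM //; last exact: meromorphicM.
by rewrite toMM //; exact: meromorphic_shift.
Qed.

Lemma TshiftD c (F G : M) : Tshift c (F + G) = Tshift c F + Tshift c G.
Proof.
have [f mf ->] := toM_ex F; have [g mg ->] := toM_ex G.
rewrite -toMD // !Tshift_toM //; last exact: meromorphicD.
by rewrite toMD //; exact: meromorphic_shift.
Qed.

Lemma Tshift_comp c d (F : M) : Tshift c (Tshift d F) = Tshift (c + d) F.
Proof.
have [f mf ->] := toM_ex F.
rewrite !Tshift_toM //; last exact: meromorphic_shift.
by congr toM; apply/funext => x; rewrite addrA.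
Qed.

Lemma Tshift0 (F : M) : Tshift 0 F = F.
Proof.
have [f mf ->] := toM_ex F; rewrite Tshift_toM //.
by congr toM; apply/funext => x; rewrite addr0.
Qed.

Lemma Tshift_cst c (k : C) : Tshift c (constM k) = constM k.
Proof. by rewrite Tshift_toM //; exact: meromorphic_cst. Qed.

Lemma Tshift_0 c : Tshift c 0 = 0 :> M.
Proof. by rewrite -toM0 Tshift_cst. Qed.

End MeromorphicCalculus.

(** * Homogeneous components *)

Section GradedProjections.
Variable R : realType.
Local Notation C := (Cx R).
Local Notation M := (Mer R).
Variable A : hAlgebra R.

Definition graded_dec (w : seq ((C * C) * A)) : Prop :=
  forall t, t \in w -> gr t.1.1 t.1.2 t.2.

Lemma grD al be (a b : A) : gr al be a -> gr al be b -> gr al be (a + b).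
Proof. by move=> ga gb; rewrite -[a]scale1r; exact: gr_lin. Qed.

Lemma grZ al be (c : C) (a : A) : gr al be a -> gr al be (c *: a).
Proof. by move=> ga; rewrite -[_ *: _]addr0; apply: gr_lin => //; exact: gr_0. Qed.

Lemma gr_sum al be (I : Type) (r : seq I) (Q : pred I) (F : I -> A) :
  (forall i, Q i -> gr al be (F i)) -> gr al be (\sum_(i <- r | Q i) F i).
Proof. by move=> gF; apply: big_ind => //; [exact: gr_0|exact: grD]. Qed.

Lemma graded_dec_ex (a : A) : exists w, graded_dec w /\ \sum_(t <- w) t.2 = a.
Proof.
have [s [x [gx ->]]] := gr_span a; exists [seq (d, x d) | d <- s]; split.
  by move=> t /mapP[d _ ->]; exact: gx.
by rewrite big_map.
Qed.

Lemma sum_by_key (V : nmodType) (w : seq ((C * C) * A)) (Q : pred (C * C))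
    (F : (C * C) * A -> V) :
  \sum_(t <- w | Q t.1) F t =
  \sum_(d <- undup [seq t.1 | t <- w] | Q d) \sum_(t <- w | t.1 == d) F t.
Proof.
rewrite (exchange_big_dep predT) //= big_mkcond big_seq [RHS]big_seq.
apply: eq_bigr => t tw; case: ifP => Qt; last first.
  by rewrite big_pred0 // => d; apply/andP => -[Qd /eqP tE]; rewrite tE Qd in Qt.
rewrite (eq_bigl (pred1 t.1)) => [|d]; last first.
  by rewrite /= eq_sym; case: eqP => [->|]; rewrite ?Qt ?andbF.
rewrite big_mkcond (bigD1_seq t.1) ?undup_uniq //=.
  by rewrite eqxx big1 ?addr0 // => d /negbTE ->.
by rewrite mem_undup; exact: (map_f (fun t => t.1) tw).
Qed.

(** The components of a vanishing sum vanish because the bigraded pieces are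
independent. *)
Lemma graded_sum0 (w : seq ((C * C) * A)) (Q : pred (C * C)) :
  graded_dec w -> \sum_(t <- w) t.2 = 0 -> \sum_(t <- w | Q t.1) t.2 = 0.
Proof.
move=> gw; rewrite (sum_by_key w predT (fun t => t.2)) => w0.
rewrite sum_by_key big_seq_cond big1 // => d /andP[du _].
pose x d := \sum_(t <- w | t.1 == d) t.2.
apply: (gr_direct (x := x) _ _ w0 du); first exact: undup_uniq.
move=> e; rewrite /x big_seq_cond; apply: gr_sum => t /andP[tw /eqP <-].
exact: gw.
Qed.

(** A decomposition is chosen; by wprojE the value depends on the element only. *)
Definition wproj (Q : pred (C * C)) (a : A) : A :=
  \sum_(t <- xget [::] [set w | graded_dec w /\ \sum_(t <- w) t.2 = a] | Q t.1) t.2.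

Lemma wprojE Q w : graded_dec w ->
  wproj Q (\sum_(t <- w) t.2) = \sum_(t <- w | Q t.1) t.2.
Proof.
move=> gw; rewrite /wproj; case: xgetP => [v _ [gv vE]|H]; last first.
  by case: (H w); split.
apply/eqP; rewrite -subr_eq0; apply/eqP.
pose n (t : (C * C) * A) := (t.1, - t.2).
have gwn : graded_dec (v ++ map n w).
  move=> t; rewrite mem_cat => /orP[/gv //|/mapP[u /gw gu ->]].
  by rewrite /= -scaleN1r; exact: grZ.
have := @graded_sum0 _ Q gwn; rewrite !big_cat !big_map /= !sumrN vE subrr.
exact.
Qed.

Lemma wproj_gr Q al be a : gr al be a ->
  wproj Q a = if Q (al, be) then a else 0.
Proof.
move=> ga; have := @wprojE Q [:: ((al, be), a)].
rewrite big_cons big_nil addr0 => ->; first by rewrite big_cons big_nil; case: ifP; rewrite ?addr0.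
by move=> t; rewrite inE => /eqP ->.
Qed.

Lemma wprojD Q a b : wproj Q (a + b) = wproj Q a + wproj Q b.
Proof.
have [v [gv <-]] := graded_dec_ex a; have [w [gw <-]] := graded_dec_ex b.
rewrite -big_cat !wprojE ?big_cat //.
by move=> t; rewrite mem_cat => /orP[/gv|/gw].
Qed.

Lemma wprojZ Q (c : C) a : wproj Q (c *: a) = c *: wproj Q a.
Proof.
have [v [gv <-]] := graded_dec_ex a.
rewrite wprojE // !scaler_sumr.
rewrite -(big_map (fun t => (t.1, c *: t.2)) xpredT (fun t => t.2)) wprojE.
  by rewrite big_map.
by move=> t /mapP[u /gv gu ->]; exact: grZ.
Qed.

Lemma wprojM Q x a : gr 0 0 x -> wproj Q (x * a) = x * wproj Q a.
Proof.
move=> gx; have [v [gv <-]] := graded_dec_ex a.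
rewrite wprojE // !mulr_sumr.
rewrite -(big_map (fun t => (t.1, x * t.2)) xpredT (fun t => t.2)) wprojE.
  by rewrite big_map.
move=> t /mapP[u /gv gu ->] /=; rewrite -[u.1.1]add0r -[u.1.2]add0r.
exact: gr_M.
Qed.

(** The commutation with the right moment map holds weight by weight, so it
extends to elements with several left weights. *)
Lemma wprojR_comm (rho : C) f a :
  momR A f * wproj (fun d => d.2 == rho) a =
  wproj (fun d => d.2 == rho) a * momR A (Tshift rho f).
Proof.
have [v [gv <-]] := graded_dec_ex a; rewrite wprojE // mulr_sumr mulr_suml.
rewrite big_seq_cond [RHS]big_seq_cond; apply: eq_bigr => t /andP[/gv gt /eqP <-].
exact: momR_comm gt.
Qed.

End GradedProjections.

(** * Sums over formal tensors *)

Section Balanced.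
Variable R : realType.
Local Notation C := (Cx R).
Local Notation M := (Mer R).

(** The conditions under which a sum over a formal tensor depends on the class of
the tensor only, see tsum_eq. *)
Record balanced (A B : hAlgebra R) (V : zmodType) (F : C -> A -> B -> V) : Prop := {
  bal_Dl : forall rho a a' b, F rho (a + a') b = F rho a b + F rho a' b;
  bal_Dr : forall rho a b b', F rho a (b + b') = F rho a b + F rho a b';
  bal_Z : forall rho (c : C) a b, F rho (c *: a) b = F rho a (c *: b);
  bal_mom : forall rho f a b, F rho (momR A f * a) b = F rho a (momL B f * b)
}.

Definition tsum (A B : hAlgebra R) (V : zmodType) (F : C -> A -> B -> V)
  (u : tens A B) : V := \sum_(t <- u) F t.1.1 t.1.2 t.2.

Lemma tsum_eq (A B : hAlgebra R) (V : zmodType) (F : C -> A -> B -> V) u v :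
  balanced F -> tens_eq u v -> tsum F u = tsum F v.
Proof.
move=> bF; elim=> {u v} //.
- by move=> s t u _ -> _ ->.
- by move=> s t s' t' _ e _ e'; rewrite /tsum !big_cat; congr (_ + _).
- by move=> s t; rewrite /tsum !big_cat /= addrC.
move=> s t; rewrite /tsum; case=> [rho b|rho a a' b|rho a b b'|rho c a b|rho f a b];
  rewrite !big_cons !big_nil /= ?addr0.
- by apply: (addIr (F rho 0 b)); rewrite -(bal_Dl bF) addr0 add0r.
- exact: bal_Dl.
- exact: bal_Dr.
- exact: bal_Z.
- exact: bal_mom.
Qed.

Section Pairing.
Variables (U A : hBialgebroid R) (P : U -> A -> oper R).
Hypothesis hP : is_pairing P.

Lemma pair_add X a (g h : M) : P X a (g + h) = P X a g + P X a h.
Proof.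
have [s sE] := pair_diffop hP X a; rewrite !sE -big_split.
by apply: eq_bigr => t _; rewrite TshiftD mulrDr.
Qed.

Lemma pair_scale X a (c : C) (g : M) : P X a (constM c * g) = constM c * P X a g.
Proof.
have [s sE] := pair_diffop hP X a; rewrite !sE mulr_sumr.
by apply: eq_bigr => t _; rewrite TshiftM Tshift_cst mulrCA.
Qed.

Lemma constM1 : constM 1 = 1 :> M. Proof. exact: toM1. Qed.
Lemma pair_Dr X a b g : P X (a + b) g = P X a g + P X b g.
Proof.
rewrite -[a in LHS]scale1r (pair_linr hP) /mulop /= constM1.
have -> (u v : oper R) : (u + v) g = u g + v g by [].
by rewrite /= mul1r.
Qed.

Lemma pair_0r X g : P X 0 g = 0.
Proof. by apply: (addIr (P X 0 g)); rewrite -pair_Dr addr0 add0r. Qed.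

Lemma pair_Zr X (c : C) a g : P X (c *: a) g = constM c * P X a g.
Proof.
rewrite -[c *: a]addr0 (pair_linr hP).
have -> (u v : oper R) : (u + v) g = u g + v g by [].
by rewrite /= pair_0r addr0.
Qed.

Lemma pair_Dl X Y a g : P (X + Y) a g = P X a g + P Y a g.
Proof.
rewrite -[X in LHS]scale1r (pair_linl hP) /mulop /= constM1.
have -> (u v : oper R) : (u + v) g = u g + v g by [].
by rewrite /= mul1r.
Qed.

Lemma pair_0l a g : P 0 a g = 0.
Proof. by apply: (addIr (P 0 a g)); rewrite -pair_Dl addr0 add0r. Qed.

Lemma pair_Zl (c : C) X a g : P (c *: X) a g = constM c * P X a g.
Proof.
rewrite -[c *: X]addr0 (pair_linl hP).
have -> (u v : oper R) : (u + v) g = u g + v g by [].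
by rewrite /= pair_0l addr0.
Qed.

(** The summand of the axiom for a product, with projections that do not change it
on homogeneous arguments. They make it balanced for arbitrary arguments, since
the shift by rho then matches the weights at the moment maps. *)
Definition pfun X Y g (rho : C) (a b : A) : M :=
  P X (wproj (fun d => d.2 == rho) a)
    (Tshift rho (P Y (wproj (fun d => d.1 == rho) b) g)).

Lemma pfun_balanced X Y g : balanced (pfun X Y g).
Proof.
split=> rho.
- by move=> a a' b; rewrite /pfun wprojD pair_Dr.
- by move=> a b b'; rewrite /pfun wprojD pair_Dr TshiftD pair_add.
- move=> c a b; rewrite /pfun !wprojZ !pair_Zr TshiftM Tshift_cst pair_scale //.
- move=> f a b; rewrite /pfun !wprojM; [|exact: momL_gr|exact: momR_gr].
  rewrite wprojR_comm (pair_momR' hP) (pair_momL' hP) /mulop /=.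
  by rewrite TshiftM.
Qed.

Lemma pfun_gr X Y g al rho be a b : gr al rho a -> gr rho be b ->
  pfun X Y g rho a b = P X a (Tshift rho (P Y b g)).
Proof. by move=> ga gb; rewrite /pfun (wproj_gr _ ga) (wproj_gr _ gb) /= eqxx. Qed.

Lemma pair_mull_tsum X Y a g : P (X * Y) a g = tsum (pfun X Y g) (Delta a).
Proof.
rewrite (pair_mull hP) fct_sumE /tsum big_seq [RHS]big_seq.
apply: eq_bigr => t /(@Delta_wf _ _ _) [al [be [ga gb]]].
by rewrite (pfun_gr _ _ _ ga gb).
Qed.

End Pairing.
End Balanced.

(** * Meromorphy of the bracket *)

Section BracketMeromorphic.
Variables (R : realType) (q p : R).
Hypotheses (hq : 0 < q < 1) (hp : 0 < p < 1).
Local Notation C := (Cx R).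
Local Notation M := (Mer R).
Local Notation br := (br q p).

Lemma detF_br (l : C) : detF q p l = - qpow q (-1) * br (l + 1).
Proof.
rewrite /detF theta_br mulrA -qpowD opprD addrA subrr add0r -opprD addrC.
by rewrite brN // mulrN mulNr [1 + l]addrC.
Qed.

Variables (Om : set C) (E : ellipticU2 q p Om) (z0 : C).
Hypothesis Oz0 : Om z0.

(** Apply the counit to det(z) det^-1(z) = 1. As toM sends every function that is
not meromorphic to 0, this makes detF meromorphic and generically nonzero. *)
Lemma detF_unit : exists G : M,
  toM (detF q p) * (toM (fun l => (detF q p l)^-1) * G) = 1.
Proof.
have := mul_det_detinv (ell_relations E) Oz0; rewrite /elldet.
set X := (_ - _) => H; exists (eps (X * detinv E z0) 1).
have := congr1 (fun x : E => eps x 1) H.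
by rewrite -!mulrA !eps_M eps_1 eps_momR eps_momL.
Qed.

Lemma detF_mero : meromorphic (detF q p).
Proof.
have [G GE] := detF_unit; apply: contrapT => nm.
by move/eqP: GE; rewrite toM_nonmero // mul0r eq_sym oner_eq0.
Qed.

Lemma detF_ae : ae (fun l => detF q p l != 0).
Proof.
have [G GE] := detF_unit; have [g mg GE'] := toM_ex G.
have mV : meromorphic (fun l => (detF q p l)^-1).
  apply: contrapT => nm.
  by move/eqP: GE; rewrite [X in _ * (X * _)]toM_nonmero // mul0r mulr0 eq_sym oner_eq0.
move: GE; rewrite GE' -toMM // -toMM //; last exact: meromorphicM.
  rewrite -toM1 => /toM_inj h.
  apply: ae_impl (h _ _).
  - by move=> x; apply: contra_eq_neq => ->; rewrite mul0r eq_sym oner_eq0.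
  - by apply: meromorphicM; [exact: detF_mero|exact: meromorphicM].
  - exact: meromorphic_cst.
exact: detF_mero.
Qed.

Lemma br_mero c : meromorphic (fun l => br (l + c)).
Proof.
have h : meromorphic (fun l => (- qpow q 1) * detF q p l).
  by apply: meromorphicM; [exact: meromorphic_cst|exact: detF_mero].
have := meromorphic_shift (c - 1) h; congr meromorphic; apply/funext => l.
rewrite detF_br mulrA mulrNN -qpowD subrr qpow0 mul1r.
by rewrite -addrA subrK.
Qed.

Lemma br_ae c : ae (fun l => br (l + c) != 0).
Proof.
have := ae_shift (c - 1) detF_ae; apply: ae_impl => l; apply: contra_neq.
by rewrite detF_br -addrA subrK => ->; rewrite mulr0.
Qed.

End BracketMeromorphic.

(** * The exchange relations in brackets *)

Local Opaque theta qpow q2.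

Section RMatrixBrackets.
Variables (R : realType) (q p : R).
Hypotheses (hq : 0 < q < 1) (hp : 0 < p < 1).
Local Notation C := (Cx R).
Local Notation br := (br q p).

(** The entry of theta(q^2 z) R at z = q^2u, up to a power of q that is common to
all entries (Rnum_br). It remains defined at u = -1, where R has a pole. *)
Definition rbr (x y a b : bool) (l u : C) : C :=
  match x, y, a, b with
  | true, true, true, true | false, false, false, false => br (u + 1)
  | true, false, true, false => br u * br (l + 2) / br (l + 1)
  | false, true, true, false => br 1 * br (l + (1 - u)) / br (l + 1)
  | true, false, false, true => br 1 * br (l + (1 + u)) / br (l + 1)
  | false, true, false, true => br u * br (l + 0) / br (l + 1)
  | _, _, _, _ => 0
  end.

Lemma theta_brD x y : theta p (q2 q x * q2 q y) = qpow q (x + y) * br (x + y).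
Proof. by rewrite -theta_br q2D. Qed.

Lemma theta_brN x : theta p (q2 q (- x)) = - qpow q (- x) * br x.
Proof. by rewrite theta_br brN // mulrN mulNr. Qed.

Lemma Rnum_br x y a b l u :
  Rnum q p x y a b l (q2 q u) = qpow q (u + 1) * rbr x y a b l u.
Proof.
have key (t1 t2 t3 a1 a2 a3 b1 b2 b3 k : C) : t1 = a1 * b1 -> t2 = a2 * b2 ->
    t3 = a3 * b3 -> a1 * a2 / a3 = k -> t1 * t2 / t3 = k * (b1 * b2 / b3).
  by move=> -> -> -> <-; rewrite invfM; ring.
have br_u1 : theta p (q2 q 1 * q2 q u) = qpow q (u + 1) * br (u + 1).
  by rewrite theta_brD [1 + u]addrC.
have br_b : theta p (q2 q (- (l + 1)) * q2 q u) = - qpow q (- (l + (1 - u))) * br (l + (1 - u)).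
  by rewrite -theta_brN -q2D; congr (theta p (q2 q _)); ring.
have br_c : theta p (q2 q (l + 1) * q2 q u) = qpow q (l + (1 + u)) * br (l + (1 + u)).
  by rewrite theta_brD -addrA.
rewrite /Rnum /rbr; case: x; case: y; case: a; case: b.
all: lazymatch goal with |- 0 = _ => exact: (esym (mulr0 _)) | |- _ => idtac end.
- exact: br_u1.
- apply: (key _ _ _ _ _ _ _ _ _ _ (theta_br _ _ u) (theta_br _ _ (l + 2)) (theta_br _ _ (l + 1))).
  by rewrite -qpowN -!qpowD; congr (qpow q _); ring.
- apply: (key _ _ _ _ _ _ _ _ _ _ (theta_br _ _ 1) br_c (theta_br _ _ (l + 1))).
  by rewrite -qpowN -!qpowD; congr (qpow q _); ring.
- apply: (key _ _ _ _ _ _ _ _ _ _ (theta_br _ _ 1) br_b (theta_brN (l + 1))).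
  rewrite invrN !(mulrN, mulNr) opprK -qpowN -!qpowD; congr (qpow q _); ring.
- rewrite [l + 0]addr0.
  apply: (key _ _ _ _ _ _ _ _ _ _ (theta_br _ _ u) (theta_brN l) (theta_brN (l + 1))).
  rewrite invrN !(mulrN, mulNr) opprK -qpowN -!qpowD; congr (qpow q _); ring.
- exact: br_u1.
Qed.

Lemma Rmat_br x y a b l u : br (u + 1) != 0 ->
  Rmat q p x y a b l (q2 q u) = rbr x y a b l u / br (u + 1).
Proof.
move=> u0; have t0 : theta p (q2 q 1 * q2 q u) != 0.
  by rewrite -q2D theta_br mulf_neq0 ?qpow_neq0 // addrC.
apply: (mulfI t0); rewrite -RnumE // Rnum_br -q2D theta_br [1 + u]addrC.
by field.
Qed.

Hypothesis brm : forall c, meromorphic (fun l => br (l + c)).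
Hypothesis bra : forall c, ae (fun l => br (l + c) != 0).

Lemma brV_mero c : meromorphic (fun l => (br (l + c))^-1).
Proof. by apply: meromorphicV. Qed.

Lemma rbr_mero x y a b u : meromorphic (fun l => rbr x y a b l u).
Proof.
have cst := @meromorphic_cst R; have brV := brV_mero.
by case: x; case: y; case: a; case: b; rewrite /rbr; try exact: cst;
  apply: meromorphicM => //; apply: meromorphicM.
Qed.

End RMatrixBrackets.

Section ExchangeRelations.
Variables (R : realType) (q p : R).
Hypotheses (hq : 0 < q < 1) (hp : 0 < p < 1).
Local Notation C := (Cx R).
Local Notation M := (Mer R).
Local Notation br := (br q p).
Local Notation rbr := (rbr q p).
Hypothesis brn : forall i, (0 < i)%N -> br i%:R != 0.
Hypothesis brm : forall c, meromorphic (fun l => br (l + c)).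
Hypothesis bra : forall c, ae (fun l => br (l + c) != 0).

Variables (Om : set C) (E : ellipticU2 q p Om).
Hypothesis hOm : spectral_domain q Om.

Definition mR (f : C -> C) : E := momR E (toM f).
Definition mL (f : C -> C) : E := momL E (toM f).
Local Notation L := (Lgen E).

Lemma mRE f : mR f = momR E (toM f). Proof. by []. Qed.

Lemma mRM f g : meromorphic f -> meromorphic g -> mR f * mR g = mR (fun l => f l * g l).
Proof. by move=> mf mg; rewrite /mR -rmorphM toMM. Qed.

Lemma mRD f g : meromorphic f -> meromorphic g -> mR f + mR g = mR (fun l => f l + g l).
Proof. by move=> mf mg; rewrite /mR -rmorphD toMD. Qed.

Lemma mR_eq f g : ae (fun l => f l = g l) -> mR f = mR g.
Proof. by rewrite /mR => /toM_eq ->. Qed.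

Lemma mL_eq f g : ae (fun l => f l = g l) -> mL f = mL g.
Proof. by rewrite /mL => /toM_eq ->. Qed.

Lemma mR_cst (k : C) : mR (fun=> k) = k%:A.
Proof. exact: momR_const. Qed.

Lemma mL_cst (k : C) : mL (fun=> k) = k%:A.
Proof. exact: momL_const. Qed.

Lemma mR_scale (k : C) f : meromorphic f -> mR (fun l => k * f l) = k *: mR f.
Proof.
move=> mf; rewrite -mRM //; last exact: meromorphic_cst.
by rewrite mR_cst -scalerAl mul1r.
Qed.

Lemma mL_scale (k : C) f : meromorphic f -> mL (fun l => k * f l) = k *: mL f.
Proof.
move=> mf; rewrite /mL toMM //; last exact: meromorphic_cst.
by rewrite rmorphM [momL _ _]mL_cst -scalerAl mul1r.
Qed.

Lemma mR_0 : mR (fun=> 0) = 0.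
Proof. by rewrite mR_cst scale0r. Qed.

Lemma mR_1 : mR (fun=> 1) = 1.
Proof. by rewrite mR_cst scale1r. Qed.

Lemma q2_iter n z : Om z -> Om (q2 q n%:R * z).
Proof.
move=> Oz; elim: n => [|n IH]; first by rewrite q2_0 mul1r.
by rewrite -natr1 addrC q2D -mulrA; case: (hOm IH).
Qed.

Lemma Om_neq0 z : Om z -> z != 0. Proof. by case/hOm. Qed.

Lemma L_mR f x y z : Om z -> meromorphic f ->
  L x y z * mR f = mR (fun l => f (l - wt R y)) * L x y z.
Proof.
move=> Oz mf; rewrite /mR (momR_comm _ (L_gr (ell_relations E) x y Oz)).
rewrite Tshift_toM; last exact: meromorphic_shift.
by congr (_ * momR _ (toM _)); apply/funext => l; rewrite addrK.
Qed.

(** The common power of q cancels from the two sides. *)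
Lemma RLL_br a b c d z1 z2 u : Om z1 -> Om z2 -> z1 / z2 = q2 q u ->
  \sum_(x : bool) \sum_(y : bool) mL (fun l => rbr x y a c l u) * L x b z1 * L y d z2 =
  \sum_(x : bool) \sum_(y : bool) mR (fun m => rbr b d x y m u) * L c y z2 * L a x z1.
Proof.
move=> O1 O2 zE; have := RLL (ell_relations E) a b c d O1 O2; rewrite zE => H.
have k0 : qpow q (u + 1) != 0 :> C by exact: qpow_neq0.
apply: (scalerI k0); rewrite !scaler_sumr.
transitivity (\sum_x \sum_y
      momL E (toM (fun l => Rnum q p x y a c l (q2 q u))) * L x b z1 * L y d z2).
  apply: eq_bigr => x _; rewrite scaler_sumr; apply: eq_bigr => y _.
  rewrite !scalerAl -mL_scale //; last exact: rbr_mero.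
  by congr (_ * _ * _); apply: mL_eq => ?; apply: nearW => l; rewrite Rnum_br.
rewrite H; apply: eq_bigr => x _; rewrite scaler_sumr; apply: eq_bigr => y _.
rewrite !scalerAl -mR_scale //; last exact: rbr_mero.
by congr (_ * _ * _); apply: mR_eq => ?; apply: nearW => l; rewrite Rnum_br.
Qed.

Lemma row_comm a b n z : Om z -> let z' := q2 q n%:R * z in
  L a b z' * L a b z = L a b z * L a b z'.
Proof.
move=> Oz z'; have Oz' : Om z' by exact: q2_iter.
have zE : z' / z = q2 q n%:R by rewrite /z' mulfK // Om_neq0.
have := RLL_br a b a b Oz' Oz zE; rewrite !big_bool /=.
have n0 : br (n%:R + 1) != 0 by rewrite natr1 brn.
move: a b => [] [] /=; rewrite !mR_0 ?mL_cst ?mR_cst !mul0r ?addr0 ?add0r;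
  rewrite -!scalerAl !mul1r ?scale0r ?mul0r ?addr0 ?add0r => H; exact: (scalerI n0).
Qed.

(** On equal row indices the R-matrix on the left acts as the scalar [n + 1]. *)
Lemma row_pm a n z : Om z -> let z' := q2 q n%:R * z in
  L a true z' * L a false z =
  mR (fun m => br n%:R / br (n%:R + 1) * (br (m + 2) / br (m + 1)))
    * L a false z * L a true z' +
  mR (fun m => br 1 / br (n%:R + 1) * (br (m + (1 + n%:R)) / br (m + 1)))
    * L a true z * L a false z'.
Proof.
move=> Oz z'; have Oz' : Om z' by exact: q2_iter.
have zE : z' / z = q2 q n%:R by rewrite /z' mulfK // Om_neq0.
have n0 : br (n%:R + 1) != 0 by rewrite natr1 brn.
have brV := brV_mero brm bra; have cst := @meromorphic_cst R.
have m1 c : meromorphic (fun m => br (m + c) / br (m + 1)) by exact: meromorphicM.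
have scal (k x y v : C) : k != 0 -> x * y * v = k * (x / k * (y * v)).
  by move=> k0; field.
apply: (scalerI n0); rewrite scalerDr !scalerAl -!mR_scale; try exact: meromorphicM.
have := RLL_br a true a false Oz' Oz zE; rewrite !big_bool /=.
have -> : mL (fun l => rbr true true a a l n%:R) * L true true z' * L true false z +
  mL (fun l => rbr true false a a l n%:R) * L true true z' * L false false z +
  (mL (fun l => rbr false true a a l n%:R) * L false true z' * L true false z +
   mL (fun l => rbr false false a a l n%:R) * L false true z' * L false false z) =
   br (n%:R + 1) *: L a true z' * L a false z.
  case: a; rewrite /rbr !mL_cst !scale0r !mul0r ?addr0 ?add0r; by rewrite -!scalerAl mul1r.
move=> ->; rewrite /rbr !mR_0 !mul0r add0r addr0; congr (_ * _ * _ + _ * _ * _);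
  by apply: mR_eq => ?; apply: nearW => l; exact: scal.
Qed.

Lemma row_mp a n z : Om z -> let z' := q2 q n%:R * z in
  L a false z' * L a true z =
  mR (fun m => br 1 / br (n%:R + 1) * (br (m + (1 - n%:R)) / br (m + 1)))
    * L a false z * L a true z' +
  mR (fun m => br n%:R / br (n%:R + 1) * (br (m + 0) / br (m + 1)))
    * L a true z * L a false z'.
Proof.
move=> Oz z'; have Oz' : Om z' by exact: q2_iter.
have zE : z' / z = q2 q n%:R by rewrite /z' mulfK // Om_neq0.
have n0 : br (n%:R + 1) != 0 by rewrite natr1 brn.
have brV := brV_mero brm bra; have cst := @meromorphic_cst R.
have m1 c : meromorphic (fun m => br (m + c) / br (m + 1)) by exact: meromorphicM.
have scal (k x y v : C) : k != 0 -> x * y * v = k * (x / k * (y * v)).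
  by move=> k0; field.
apply: (scalerI n0); rewrite scalerDr !scalerAl -!mR_scale; try exact: meromorphicM.
have := RLL_br a false a true Oz' Oz zE; rewrite !big_bool /=.
have -> : mL (fun l => rbr true true a a l n%:R) * L true false z' * L true true z +
  mL (fun l => rbr true false a a l n%:R) * L true false z' * L false true z +
  (mL (fun l => rbr false true a a l n%:R) * L false false z' * L true true z +
   mL (fun l => rbr false false a a l n%:R) * L false false z' * L false true z) =
   br (n%:R + 1) *: L a false z' * L a true z.
  case: a; rewrite /rbr !mL_cst !scale0r !mul0r ?addr0 ?add0r; by rewrite -!scalerAl mul1r.
move=> ->; rewrite /rbr !mR_0 !mul0r add0r addr0; congr (_ * _ * _ + _ * _ * _);
  by apply: mR_eq => ?; apply: nearW => l; exact: scal.
Qed.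

(** At ratio q^-2 the R-matrix has rank one on the zero weight space. Products of
generators at z and q^2 z that are symmetrized in the column indices are
therefore symmetric in the row indices. *)
Lemma col_sym z : Om z -> let z' := q2 q 1 * z in
  [/\ L true true z * L false true z' = L false true z * L true true z',
      L true false z * L false false z' = L false false z * L true false z' &
      L true true z * L false false z' + L true false z * L false true z' =
      L false true z * L true false z' + L false false z * L true true z'].
Proof.
move=> Oz z'; have Oz' : Om z' by case: (hOm Oz).
have zE : z / z' = q2 q (-1).
  rewrite /z' invfM mulrCA divff ?Om_neq0 // mulr1; apply: (mulfI (qpow_neq0 q (2 * 1))).
  by rewrite -/(q2 q 1) mulfV -?q2D ?subrr ?q2_0 //; exact: qpow_neq0.
have brV := brV_mero brm bra; have cst := @meromorphic_cst R.
pose ka l := br 1 * br (l + 2) / br (l + 1).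
have mka : meromorphic ka by apply: meromorphicM => //; exact: meromorphicM.
pose kb l := (br 1)^-1 * br (l + 1) * (br (l + 2))^-1.
have mkb : meromorphic kb by apply: meromorphicM => //; exact: meromorphicM.
have b1 : br 1 != 0 by rewrite -[1]/(1%:R) brn.
(* kb is only the inverse of ka away from zeros of brackets, which suffices for
   classes. *)
have kab : mL kb * mL ka = 1.
  rewrite /mL -rmorphM -toMM // -[RHS](rmorph1 (momL E)) -toM1.
  apply: mL_eq => c; have h1 := bra 1 c; have h2 := bra 2 c.
  near=> l; have l1 : br (l + 1) != 0 by near: l; exact: h1.
  have l2 : br (l + 2) != 0 by near: l; exact: h2.
  by rewrite /ka /kb; field; rewrite b1 l1 l2.
have kI (x y : E) : mL ka * x = mL ka * y -> x = y.
  by move=> h; rewrite -[x]mul1r -kab -mulrA h mulrA kab mul1r.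
have H b d : mL ka * (L false b z * L true d z' - L true b z * L false d z') =
  \sum_(x : bool) \sum_(y : bool) mR (fun m => rbr b d x y m (-1)) * L false y z' * L true x z.
  rewrite -(RLL_br true b false d Oz Oz' zE) !big_bool /= /rbr !mL_cst !scale0r !mul0r add0r addr0.
  have -> : mL (fun l => br (-1) * br (l + 2) / br (l + 1)) = - mL ka.
    rewrite -[- mL ka]scaleN1r -mL_scale //; apply: mL_eq => c; apply: nearW => l.
    by rewrite /ka brN //; ring.
  have -> : mL (fun l => br 1 * br (l + (1 - -1)) / br (l + 1)) = mL ka.
    by apply: mL_eq => c; apply: nearW => l; rewrite /ka opprK.
  by rewrite mulrBr !mulNr !mulrA addrC.
have br00 : br (-1 + 1) = 0 by rewrite addNr br0.
have H0 b : L false b z * L true b z' - L true b z * L false b z' = 0.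
  apply: kI; rewrite mulr0 H !big_bool /=; case: b; rewrite /rbr br00 !mR_0 !mul0r !addr0; by [].
split.
- by apply/esym/eqP; rewrite -subr_eq0 H0.
- by apply/esym/eqP; rewrite -subr_eq0 H0.
have : (L false true z * L true false z' - L true true z * L false false z')
    + (L false false z * L true true z' - L true false z * L false true z') = 0.
  apply: kI; rewrite mulr0 mulrDr !H !big_bool /= /rbr !mR_0 !mul0r !addr0 !add0r.
  rewrite addrACA -!mulrDl !mRD; try by apply: meromorphicM => //; exact: meromorphicM.
  have e1 : mR (fun l => br (-1) * br (l + 2) / br (l + 1) +
      br 1 * br (l + (1 - -1)) / br (l + 1)) = 0.
    rewrite -mR_0; apply: mR_eq => c; apply: nearW => l; rewrite opprK brN //.
    ring.
  have e2 : mR (fun l => br 1 * br (l + (1 + -1)) / br (l + 1) +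
      br (-1) * br (l + 0) / br (l + 1)) = 0.
    rewrite -mR_0; apply: mR_eq => c; apply: nearW => l; rewrite subrr brN //.
    ring.
  by rewrite e1 e2 !mul0r addr0.
rewrite addrACA -opprD => /eqP; rewrite subr_eq0 => /eqP ->.
by [].
Unshelve. all: by end_near. Qed.

End ExchangeRelations.

(** * Words and their coproduct *)

Section BalancedProducts.
Variable R : realType.
Local Notation C := (Cx R).

Lemma balanced_mulr (A B : hAlgebra R) (V : zmodType) (F : C -> A -> B -> V) s c d :
  balanced F -> balanced (fun rho a b => F (rho + s) (a * c) (b * d)).
Proof.
move=> bF; split=> rho.
- by move=> a a' b; rewrite mulrDl (bal_Dl bF).
- by move=> a b b'; rewrite mulrDl (bal_Dr bF).
- by move=> k a b; rewrite -!scalerAl (bal_Z bF).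
- by move=> f a b; rewrite -!mulrA (bal_mom bF).
Qed.

Lemma balanced_mull (A B : hAlgebra R) (V : zmodType) (F : C -> A -> B -> V) al s be c d :
  gr al s c -> gr s be d ->
  balanced F -> balanced (fun rho a b => F (s + rho) (c * a) (d * b)).
Proof.
move=> gc gd bF; split=> rho.
- by move=> a a' b; rewrite mulrDr (bal_Dl bF).
- by move=> a b b'; rewrite mulrDr (bal_Dr bF).
- by move=> k a b; rewrite -!scalerAr (bal_Z bF).
- move=> f a b; rewrite !mulrA.
  have -> : c * momR A f = momR A (Tshift (- s) f) * c.
    by rewrite (momR_comm _ gc) Tshift_comp subrr Tshift0.
  rewrite -mulrA (bal_mom bF) mulrA (momL_comm _ gd) Tshift_comp subrr Tshift0.
  by [].
Qed.

Lemma tsum_Delta_D (A : hBialgebroid R) (V : zmodType) (F : C -> A -> A -> V) a b :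
  balanced F -> tsum F (Delta (a + b)) = tsum F (Delta a) + tsum F (Delta b).
Proof.
move=> bF; rewrite -[a in LHS]scale1r (tsum_eq bF (Delta_lin 1 a b)).
rewrite /tsum big_cat /=; congr (_ + _); rewrite big_map; apply: eq_bigr => t _ /=.
by rewrite scale1r.
Qed.

Lemma tsum_Delta_M (A : hBialgebroid R) (V : zmodType) (F : C -> A -> A -> V) a b :
  balanced F -> tsum F (Delta (a * b)) =
  \sum_(y <- Delta b) tsum (fun rho a' b' => F (rho + y.1.1) (a' * y.1.2) (b' * y.2)) (Delta a).
Proof.
move=> bF; rewrite (tsum_eq bF (Delta_M a b)) /tsum big_allpairs_dep /=.
by rewrite exchange_big.
Qed.

End BalancedProducts.

Section Words.
Variables (R : realType) (q p : R).
Hypotheses (hq : 0 < q < 1) (hp : 0 < p < 1).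
Local Notation C := (Cx R).
Local Notation M := (Mer R).
Local Notation br := (br q p).
Hypothesis brn : forall i, (0 < i)%N -> br i%:R != 0.
Hypothesis brm : forall c, meromorphic (fun l => br (l + c)).
Hypothesis bra : forall c, ae (fun l => br (l + c) != 0).

Variables (Om : set C) (E : ellipticU2 q p Om).
Hypothesis hOm : spectral_domain q Om.
Local Notation L := (Lgen E).

(** Expanding the recursion gives the sum of the products
L_{x1 y1}(z) L_{x2 y2}(q^2 z) ... over all sequences y with j pluses, where
true stands for plus. *)
Fixpoint word (xs : seq bool) (j : nat) (z : C) : E :=
  if xs is x :: xs' then
    L x false z * word xs' j (q2 q 1 * z) +
    (if j is j'.+1 then L x true z * word xs' j' (q2 q 1 * z) else 0)
  else (j == 0%N)%:R.

(** The signs in the basis vector v_k(z) of the corepresentation. *)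
Definition stdw n k : seq bool := nseq (n - k) false ++ nseq k true.

Definition wsum n k : C := (2 * k)%:R - n%:R.

Lemma size_stdw n k : (k <= n)%N -> size (stdw n k) = n.
Proof. by move=> kn; rewrite size_cat !size_nseq subnK. Qed.

Lemma Om_q2 z : Om z -> Om (q2 q 1 * z). Proof. by case/hOm. Qed.

(** Two adjacent letters contribute products of generators at z and q^2 z, summed
over column indices with a fixed number of pluses: this is the situation of
col_sym. *)
Lemma word_swap x y xs j z : Om z -> word (x :: y :: xs) j z = word (y :: x :: xs) j z.
Proof.
wlog : x y / x && ~~ y.
  move=> h Oz; case: x; case: y => //; first exact: h.
  by apply/esym; exact: h.
case: x; case: y => // _ Oz; have [s1 s2 s3] := col_sym hp brn brm bra E hOm Oz.
set z' := q2 q 1 * z in s1 s2 s3 *; set z'' := q2 q 1 * z'.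
rewrite /= -/z' -/z''; case: j => [|[|j]]; rewrite ?addr0 ?mulrDr !mulrA ?s2 //.
  by rewrite -!addrA -!mulrDl; congr (_ + _ * _); rewrite addrC s3 addrC.
rewrite s1 -!addrA; congr (_ + _); rewrite !addrA; congr (_ + _).
by rewrite -!mulrDl; congr (_ * _); rewrite addrC s3 addrC.
Qed.

Lemma word_cons_congr x xs ys j z : (forall j z, Om z -> word xs j z = word ys j z) ->
  Om z -> word (x :: xs) j z = word (x :: ys) j z.
Proof.
move=> h Oz; have Oz' := Om_q2 Oz.
by rewrite /= h //; case: j => [//|j]; rewrite h.
Qed.

Lemma word_insert n xs j z : Om z ->
  word (true :: nseq n false ++ xs) j z = word (nseq n false ++ true :: xs) j z.
Proof.
elim: n j z => [//|n IH] j z Oz.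
by rewrite [LHS]word_swap //; apply: word_cons_congr.
Qed.

Lemma word_gt xs j z : (size xs < j)%N -> word xs j z = 0.
Proof.
elim: xs j z => [|x xs IH] [|j] z //= lt_j.
by rewrite !IH ?mulr0 ?addr0 //; exact: ltnW.
Qed.

Lemma word_gr xs j z : Om z ->
  gr (wsum (size xs) (count_mem true xs)) (wsum (size xs) j) (word xs j z).
Proof.
elim: xs j z => [|x xs IH] j z Oz.
  rewrite /wsum /= muln0; case: j => [|j]; last exact: gr_0.
  by rewrite muln0 subrr; exact: gr_1.
have Oz' := Om_q2 Oz; have gL b := L_gr (ell_relations E) x b Oz.
have wx : wsum (size (x :: xs)) (count_mem true (x :: xs)) =
    wt R x + wsum (size xs) (count_mem true xs).
  rewrite /wsum /= -natr1 mulnDr natrD; case: x {gL} => /=; ring.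
rewrite wx; apply: grD.
  have -> : wsum (size (x :: xs)) j = wt R false + wsum (size xs) j.
    by rewrite /wsum /= -natr1; ring.
  by apply: gr_M (gL _) (IH _ _ Oz').
case: j => [|j]; first exact: gr_0.
have -> : wsum (size (x :: xs)) j.+1 = wt R true + wsum (size xs) j.
  by rewrite /wsum /= -natr1 mulnS natrD; ring.
by apply: gr_M (gL _) (IH _ _ Oz').
Qed.

(** The coproduct of a product of generators is a sum over all intermediate sign
sequences. By word_swap the second tensor factor only depends on their number
k of pluses, and the first factors with the same k add up to a word. *)
Lemma word_coproduct (V : zmodType) xs j z (F : C -> E -> E -> V) : Om z ->
  balanced F -> tsum F (Delta (word xs j z)) =
  \sum_(k < (size xs).+1) F (wsum (size xs) k) (word xs k z) (word (stdw (size xs) k) j z).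
Proof.
elim: xs j z F => [|x xs IH] j z F Oz bF.
  rewrite big_ord1 /wsum /=; case: j => [|j] /=.
    by rewrite (tsum_eq bF (Delta_1 E)) /tsum big_seq1 /= muln0 subrr.
  have F0 a rho : F rho a 0 = 0.
    by apply: (addIr (F rho a 0)); rewrite -(bal_Dr bF) addr0 add0r.
  have D0 : tsum F (Delta (0 : E)) = 0.
    by apply: (addIr (tsum F (Delta (0 : E)))); rewrite -tsum_Delta_D // addr0 add0r.
  by rewrite D0 F0.
have Oz' := Om_q2 Oz; set z' := q2 q 1 * z.
have F0 a rho : F rho a 0 = 0.
  by apply: (addIr (F rho a 0)); rewrite -(bal_Dr bF) addr0 add0r.
have D0 : tsum F (Delta (0 : E)) = 0.
  by apply: (addIr (tsum F (Delta (0 : E)))); rewrite -tsum_Delta_D // addr0 add0r.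
have step b i : tsum F (Delta (L x b z * word xs i z')) =
   \sum_(k < (size xs).+1) (F (wt R true + wsum (size xs) k)
       (L x true z * word xs k z') (L true b z * word (stdw (size xs) k) i z') +
     F (wt R false + wsum (size xs) k)
       (L x false z * word xs k z') (L false b z * word (stdw (size xs) k) i z')).
  rewrite tsum_Delta_M //.
  transitivity (\sum_(y <- Delta (word xs i z'))
     (F (wt R true + y.1.1) (L x true z * y.1.2) (L true b z * y.2) +
      F (wt R false + y.1.1) (L x false z * y.1.2) (L false b z * y.2))).
    apply: eq_bigr => y _.
    rewrite (tsum_eq (balanced_mulr _ _ _ bF) (Delta_L E x b Oz)) /tsum.
    by rewrite !big_cons big_nil addr0.
  rewrite !big_split; congr (_ + _).
    exact: (IH i z' _ Oz' (balanced_mull (L_gr (ell_relations E) x true Oz)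
       (L_gr (ell_relations E) true b Oz) bF)).
  exact: (IH i z' _ Oz' (balanced_mull (L_gr (ell_relations E) x false Oz)
     (L_gr (ell_relations E) false b Oz) bF)).
set n := size xs in step *.
have W0 k : (k <= n)%N -> word (stdw n.+1 k) j z = word (false :: stdw n k) j z.
  by move=> kn; rewrite /stdw subSn.
have W1 k : word (stdw n.+1 k.+1) j z = word (true :: stdw n k) j z.
  by rewrite /stdw subSS word_insert.
have w0 k : wsum n.+1 k = wt R false + wsum n k by rewrite /wsum -natr1 /=; ring.
have w1 k : wsum n.+1 k.+1 = wt R true + wsum n k.
  by rewrite /wsum -natr1 mulnS natrD /=; ring.
transitivity (\sum_(k < n.+1)
   (F (wsum n.+1 k.+1) (L x true z * word xs k z') (word (stdw n.+1 k.+1) j z) +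
    F (wsum n.+1 k) (L x false z * word xs k z') (word (stdw n.+1 k) j z))).
  rewrite [word (x :: xs) j z]/= -/z' tsum_Delta_D // step.
  case: j W0 W1 => [|j] W0 W1.
    rewrite D0 addr0; apply: eq_bigr => k _.
    rewrite W1 W0; last by rewrite -ltnS.
    by rewrite /= !addr0 w1 w0.
  rewrite step -big_split; apply: eq_bigr => k _.
  rewrite W1 W0; last by rewrite -ltnS.
  by rewrite /= -/z' !(bal_Dr bF) w1 w0 addrACA.
rewrite big_split /= addrC [RHS](eq_bigr (fun k : 'I_n.+2 =>
   F (wsum n.+1 k) (L x false z * word xs k z') (word (stdw n.+1 k) j z) +
   F (wsum n.+1 k) (if (k : nat) is k'.+1 then L x true z * word xs k' z' else 0)
     (word (stdw n.+1 k) j z))); last first.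
  by move=> k _; rewrite -(bal_Dl bF).
rewrite [RHS]big_split /=; congr (_ + _).
  rewrite [RHS]big_ord_recr /= word_gt // mulr0.
  suff F0l b rho : F rho 0 b = 0 by rewrite F0l addr0.
  by apply: (addIr (F rho 0 b)); rewrite -(bal_Dl bF) addr0 add0r.
rewrite [RHS]big_ord_recl /=.
suff F0l b rho : F rho 0 b = 0 by rewrite F0l add0r.
by apply: (addIr (F rho 0 b)); rewrite -(bal_Dl bF) addr0 add0r.
Qed.

Lemma word_cat xs ys j z : word (xs ++ ys) j z =
  \sum_(i < j.+1) word xs i z * word ys (j - i) (q2 q (size xs)%:R * z).
Proof.
elim: xs j z => [|x xs IH] j z.
  rewrite big_ord_recl /= subn0 mul1r q2_0 mul1r big1 ?addr0 // => i _.
  by rewrite mul0r.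
have zE : q2 q (size (x :: xs))%:R * z = q2 q (size xs)%:R * (q2 q 1 * z).
  by rewrite mulrA -q2D natr1.
rewrite zE cat_cons [LHS]/=.
transitivity (\sum_(i < j.+1) L x false z * word xs i (q2 q 1 * z) *
     word ys (j - i) (q2 q (size xs)%:R * (q2 q 1 * z)) +
   \sum_(i < j.+1) (if (i : nat) is i'.+1 then L x true z * word xs i' (q2 q 1 * z) else 0) *
     word ys (j - i) (q2 q (size xs)%:R * (q2 q 1 * z))).
  congr (_ + _).
    by rewrite IH mulr_sumr; apply: eq_bigr => i _; rewrite mulrA.
  rewrite big_ord_recl /= mul0r add0r; case: j => [|j]; first by rewrite big_ord0.
  by rewrite IH mulr_sumr; apply: eq_bigr => i _; rewrite /= mulrA.
by rewrite -big_split; apply: eq_bigr => i _; rewrite /= -mulrDl.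
Qed.

End Words.

(** * Words with constant row index *)

Section RowBinomial.
Variables (R : realType) (q p : R).
Hypotheses (hq : 0 < q < 1) (hp : 0 < p < 1).
Local Notation C := (Cx R).
Local Notation M := (Mer R).
Local Notation br := (br q p).
Hypothesis brn : forall i, (0 < i)%N -> br i%:R != 0.
Hypothesis brm : forall c, meromorphic (fun l => br (l + c)).
Hypothesis bra : forall c, ae (fun l => br (l + c) != 0).

(** The form in which the addition formula appears below: a, b, c, d are
differences of adjacent arguments. *)
Lemma br_add4 (a b c d : C) :
  br (a + 2 * b + c + d) * br a * (br d * br c) +
  br (a + b + d) * br (a + b + c) * (br (b + c + d) * br b) =
  br (a + b + c + d) * br (a + b) * (br (b + d) * br (b + c)).
Proof.
have two : (2 : C) != 0 by rewrite pnatr_eq0.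
have := br_addition q hp (a + b + (c + d) / 2) (b + (c + d) / 2) ((c + d) / 2) ((d - c) / 2).
have -> : a + b + (c + d) / 2 + (b + (c + d) / 2) = a + 2 * b + c + d by field.
have -> : a + b + (c + d) / 2 - (b + (c + d) / 2) = a by ring.
have -> : (c + d) / 2 + (d - c) / 2 = d by field.
have -> : (c + d) / 2 - (d - c) / 2 = c by field.
have -> : a + b + (c + d) / 2 + (c + d) / 2 = a + b + c + d by field.
have -> : a + b + (c + d) / 2 - (c + d) / 2 = a + b by ring.
have -> : b + (c + d) / 2 + (d - c) / 2 = b + d by field.
have -> : b + (c + d) / 2 - (d - c) / 2 = b + c by field.
have -> : a + b + (c + d) / 2 + (d - c) / 2 = a + b + d by field.
have -> : a + b + (c + d) / 2 - (d - c) / 2 = a + b + c by field.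
have -> : b + (c + d) / 2 + (c + d) / 2 = b + c + d by field.
have -> : b + (c + d) / 2 - (c + d) / 2 = b by ring.
by move=> /eqP; rewrite addrAC subr_eq0 => /eqP.
Qed.

Variables (Om : set C) (E : ellipticU2 q p Om).
Hypothesis hOm : spectral_domain q Om.
Local Notation L := (Lgen E).
Local Notation mR := (mR E).
Local Notation word := (word E).

(** Fp and Fm are the factors by which a generator is absorbed into a word with
constant rows, see row_step. *)
Definition Fp (n i : nat) (m : C) : C :=
  br (i%:R + 1) / br (n%:R + 1) * (br (m + (n%:R - i%:R + 1)) / br (m + 1)).

Definition Fm (n i : nat) (m : C) : C :=
  br (n%:R - i%:R + 1) / br (n%:R + 1) * (br (m + (1 - i%:R)) / br (m + 1)).

Let brq_mero c d : meromorphic (fun m => br (m + c) / br (m + d)).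
Proof. by apply: meromorphicM => //; apply: meromorphicV. Qed.

Let kbrq_mero k c d : meromorphic (fun m => k * (br (m + c) / br (m + d))).
Proof. by apply: meromorphicM; [exact: meromorphic_cst|exact: brq_mero]. Qed.

Lemma Fp_mero n i : meromorphic (Fp n i). Proof. exact: kbrq_mero. Qed.
Lemma Fm_mero n i : meromorphic (Fm n i). Proof. exact: kbrq_mero. Qed.

Let br012 : ae (fun l => [/\ br l != 0, br (l + 1) != 0 & br (l + 2) != 0]).
Proof.
have := ae_and (bra 0) (ae_and (bra 1) (bra 2)); apply: ae_impl => l [].
by rewrite addr0 => ? [? ?].
Qed.

Let n1 n : br (n%:R + 1) != 0. Proof. by rewrite natr1 brn. Qed.

(** The new generator is moved past the first letter by row_comm, row_pm and
row_mp; the coefficients of the two resulting terms combine by br_add4. *)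
Lemma row_step e n i z : Om z ->
  L e true (q2 q n%:R * z) * word (nseq n e) i z =
    mR (Fp n i) * word (nseq n.+1 e) i.+1 z /\
  L e false (q2 q n%:R * z) * word (nseq n e) i z =
    mR (Fm n i) * word (nseq n.+1 e) i z.
Proof.
have one (f : C -> C) : (forall m, f m = br (0 + 1) / br (0 + 1) * (br (m + 1) / br (m + 1))) ->
    mR f = 1.
  move=> fE; rewrite -(mR_1 E); apply: mR_eq; apply: ae_impl br012 => l [_ l1 _].
  by rewrite fE !divff ?mulr1 //; exact: (n1 0).
have p00 : mR (Fp 0 0) = 1 by apply: one => m; rewrite /Fp subr0 add0r.
have m00 : mR (Fm 0 0) = 1 by apply: one => m; rewrite /Fm !subr0 ?addr0.
have m01 : mR (Fm 0 1) = 0.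
  rewrite -(mR_0 E); apply: mR_eq => c; apply: nearW => l.
  by rewrite /Fm add0r addNr br0 // !mul0r.
elim: n i z => [|n IH] i z Oz.
  rewrite q2_0 mul1r; case: i => [|[|i]]; rewrite /= ?p00 ?m00 ?m01 !(mulr0, mulr1, addr0, add0r, mul0r, mul1r) //.
have Oz' := Om_q2 hOm Oz; set z' := q2 q 1 * z in Oz' *.
have QE : q2 q n.+1%:R * z = q2 q n%:R * z' by rewrite /z' mulrA -q2D natr1.
have mF := Fp_mero; have mG := Fm_mero.
have IHp j : L e true (q2 q n.+1%:R * z) * word (nseq n e) j z' =
    mR (Fp n j) * word (nseq n.+1 e) j.+1 z' by rewrite QE; case: (IH j z' Oz').
have IHm j : L e false (q2 q n.+1%:R * z) * word (nseq n e) j z' =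
    mR (Fm n j) * word (nseq n.+1 e) j z' by rewrite QE; case: (IH j z' Oz').
have wE m j : word (nseq m.+1 e) j z = L e false z * word (nseq m e) j z' +
  (if j is j'.+1 then L e true z * word (nseq m e) j' z' else 0) by [].
have cm b := row_comm hp brn brm bra E hOm e b n.+1 Oz.
have pm := row_pm hp brn brm bra E hOm e n.+1 Oz.
have mp := row_mp hp brn brm bra E hOm e n.+1 Oz.
set Z := q2 q n.+1%:R * z in IHp IHm cm pm mp *.
pose A (m : C) := br n.+1%:R / br (n.+1%:R + 1) * (br (m + 2) / br (m + 1)).
pose B (m : C) := br 1 / br (n.+1%:R + 1) * (br (m + (1 - n.+1%:R)) / br (m + 1)).
pose D (m : C) := br 1 / br (n.+1%:R + 1) * (br (m + (1 + n.+1%:R)) / br (m + 1)).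
pose G (m : C) := br n.+1%:R / br (n.+1%:R + 1) * (br (m + 0) / br (m + 1)).
rewrite -/A -/D in pm; rewrite -/B -/G in mp.
have LR b f : meromorphic f -> L e b z * mR f = mR (fun l => f (l - wt R b)) * L e b z.
  exact: L_mR.
have step b K f j : meromorphic f -> meromorphic K ->
    mR K * L e b z * (mR f * word (nseq n.+1 e) j z') =
    mR (fun l => K l * f (l - wt R b)) * (L e b z * word (nseq n.+1 e) j z').
  move=> mf mK; rewrite mulrA -(mulrA _ (L e b z)) LR // !mulrA mRM //.
  exact: meromorphic_shift.
have step1 b f j : meromorphic f ->
    L e b z * (mR f * word (nseq n.+1 e) j z') =
    mR (fun l => f (l - wt R b)) * (L e b z * word (nseq n.+1 e) j z').
  by move=> mf; rewrite mulrA LR // !mulrA.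
have msh f c : meromorphic f -> meromorphic (fun l => f (l - c)).
  by move=> mf; exact: meromorphic_shift.
have mA : meromorphic A by exact: kbrq_mero.
have mB : meromorphic B by exact: kbrq_mero.
have mD : meromorphic D by exact: kbrq_mero.
have mG' : meromorphic G by exact: kbrq_mero.
have S1 : n.+1%:R = n%:R + 1 :> C by rewrite natr1.
have e1 : mR (fun l => A l * Fp n i (l - wt R false)) = mR (Fp n.+1 i).
  apply: mR_eq; apply: ae_impl br012 => l [l0 l1 l2].
  rewrite /A /Fp S1 /= opprK.
  rewrite (_ : l + 1 + (n%:R - i%:R + 1) = l + (n%:R + 1 - i%:R + 1)); last by ring.
  rewrite (_ : l + 1 + 1 = l + 2); last by ring.
  have h1 := n1 n; have h2 := n1 n.+1; rewrite S1 in h2.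
  by field; rewrite ?(l0, l1, l2, h1, h2).
have e2 i' : mR (fun l => D l * Fm n i'.+1 (l - wt R true)) +
    mR (fun l => Fp n i' (l - wt R true)) = mR (Fp n.+1 i'.+1).
  rewrite mRD; [|by apply: meromorphicM => //; exact: msh|exact: msh].
  apply: mR_eq; apply: ae_impl br012 => l [l0 l1 l2].
  have h1 := n1 n; have h2 := n1 n.+1; rewrite S1 in h2.
  have i1 : i'.+1%:R = i'%:R + 1 :> C by rewrite natr1.
  rewrite /D /Fm /Fp S1 i1 /=.
  have := br_add4 (l - (i'%:R + 1)) (i'%:R + 1) 1 (n%:R - i'%:R).
  rewrite (_ : l - (i'%:R + 1) + 2 * (i'%:R + 1) + 1 + (n%:R - i'%:R) = l + (1 + (n%:R + 1))); last by ring.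
  rewrite (_ : l - (i'%:R + 1) + (i'%:R + 1) + (n%:R - i'%:R) = l - 1 + (n%:R - i'%:R + 1)); last by ring.
  rewrite (_ : l - (i'%:R + 1) + (i'%:R + 1) + 1 + (n%:R - i'%:R) = l + (n%:R + 1 - (i'%:R + 1) + 1)); last by ring.
  rewrite (_ : l - (i'%:R + 1) + (i'%:R + 1) + 1 = l + 1); last by ring.
  rewrite (_ : i'%:R + 1 + 1 + (n%:R - i'%:R) = n%:R + 1 + 1); last by ring.
  rewrite (_ : l - (i'%:R + 1) + (i'%:R + 1) = l); last by ring.
  rewrite (_ : i'%:R + 1 + (n%:R - i'%:R) = n%:R + 1); last by ring.
  rewrite (_ : l - 1 + (1 - (i'%:R + 1)) = l - (i'%:R + 1)); last by ring.
  rewrite (_ : n%:R - (i'%:R + 1) + 1 = n%:R - i'%:R); last by ring.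
  rewrite (_ : l - 1 + 1 = l); last by ring.
  move=> H; apply: (mulIf l0); apply: (mulIf l1); apply: (mulIf h1); apply: (mulIf h2).
  transitivity (br (l + (n%:R + 1 - (i'%:R + 1) + 1)) * br l * (br (n%:R + 1) * br (i'%:R + 1 + 1))).
    by rewrite -H; field; rewrite ?(l0, l1, l2, h1, h2).
  by field; rewrite ?(l0, l1, l2, h1, h2).
have e20 : mR (fun l => D l * Fm n 0 (l - wt R true)) = mR (Fp n.+1 0).
  apply: mR_eq; apply: ae_impl br012 => l [l0 l1 l2].
  have h1 := n1 n; have h2 := n1 n.+1; rewrite S1 in h2.
  rewrite /D /Fm /Fp S1 /= !subr0 subrK add0r (_ : 1 + (n%:R + 1) = n%:R + 1 + 1); last by ring.
  by field; rewrite ?(l0, l1, l2, h1, h2).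
have e3 i' : mR (fun l => Fm n i'.+1 (l - wt R false)) +
    mR (fun l => B l * Fp n i' (l - wt R false)) = mR (Fm n.+1 i'.+1).
  rewrite mRD; [|exact: msh|by apply: meromorphicM => //; exact: msh].
  apply: mR_eq; apply: ae_impl br012 => l [l0 l1 l2].
  have h1 := n1 n; have h2 := n1 n.+1; rewrite S1 in h2.
  have i1 : i'.+1%:R = i'%:R + 1 :> C by rewrite natr1.
  rewrite /B /Fm /Fp S1 i1 /= opprK.
  have := br_add4 (l - n%:R) (n%:R - i'%:R) 1 (i'%:R + 1).
  rewrite (_ : l - n%:R + 2 * (n%:R - i'%:R) + 1 + (i'%:R + 1) = l + 1 + (n%:R - i'%:R + 1)); last by ring.
  rewrite (_ : l - n%:R + (n%:R - i'%:R) + (i'%:R + 1) = l + 1); last by ring.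
  rewrite (_ : l - n%:R + (n%:R - i'%:R) + 1 + (i'%:R + 1) = l + 2); last by ring.
  rewrite (_ : l - n%:R + (n%:R - i'%:R) + 1 = l + 1 + (1 - (i'%:R + 1))); last by ring.
  rewrite (_ : n%:R - i'%:R + 1 + (i'%:R + 1) = n%:R + 1 + 1); last by ring.
  rewrite (_ : l - n%:R + (n%:R - i'%:R) = l + (1 - (i'%:R + 1))); last by ring.
  rewrite (_ : n%:R - i'%:R + (i'%:R + 1) = n%:R + 1); last by ring.
  rewrite (_ : n%:R - (i'%:R + 1) + 1 = n%:R - i'%:R); last by ring.
  rewrite (_ : n%:R + 1 - (i'%:R + 1) + 1 = n%:R - i'%:R + 1); last by ring.
  rewrite (_ : l + (1 - (n%:R + 1)) = l - n%:R); last by ring.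
  rewrite (_ : l + 1 + 1 = l + 2); last by ring.
  move=> H; apply: (mulIf l2); apply: (mulIf l1); apply: (mulIf h1); apply: (mulIf h2).
  transitivity (br (l + 2) * br (l + (1 - (i'%:R + 1))) * (br (n%:R + 1) * br (n%:R - i'%:R + 1))).
    by rewrite -H; field; rewrite ?(l0, l1, l2, h1, h2).
  by field; rewrite ?(l0, l1, l2, h1, h2).
have e30 : mR (fun l => Fm n 0 (l - wt R false)) = mR (Fm n.+1 0).
  apply: mR_eq; apply: ae_impl br012 => l [l0 l1 l2].
  have h1 := n1 n; have h2 := n1 n.+1; rewrite S1 in h2.
  rewrite /Fm S1 /= !subr0 opprK (_ : l + 1 + 1 = l + 2); last by ring.
  by field; rewrite ?(l0, l1, l2, h1, h2).
have e4 i' : mR (fun l => G l * Fm n i' (l - wt R true)) = mR (Fm n.+1 i'.+1).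
  apply: mR_eq; apply: ae_impl br012 => l [l0 l1 l2].
  have h1 := n1 n; have h2 := n1 n.+1; rewrite S1 in h2.
  have i1 : i'.+1%:R = i'%:R + 1 :> C by rewrite natr1.
  rewrite /G /Fm S1 i1 /= addr0 (_ : l - 1 + (1 - i'%:R) = l + (1 - (i'%:R + 1))); last by ring.
  rewrite subrK (_ : n%:R + 1 - (i'%:R + 1) + 1 = n%:R - i'%:R + 1); last by ring.
  by field; rewrite ?(l0, l1, l2, h1, h2).
have c1 b : L e b Z * L e b z = L e b z * L e b Z := cm b.
have c2 b x : L e b Z * (L e b z * x) = L e b z * (L e b Z * x).
  by rewrite !mulrA c1.
have pm2 x : L e true Z * (L e false z * x) =
    mR A * L e false z * (L e true Z * x) + mR D * L e true z * (L e false Z * x).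
  by rewrite mulrA pm mulrDl -!mulrA.
have mp2 x : L e false Z * (L e true z * x) =
    mR B * L e false z * (L e true Z * x) + mR G * L e true z * (L e false Z * x).
  by rewrite mulrA mp mulrDl -!mulrA.
have wE2 j := wE n.+1 j; have wE1 := wE n i.
have mDs j : meromorphic (fun l => D l * Fm n j (l - wt R true)).
  by apply: meromorphicM => //; exact: msh.
have mBs j : meromorphic (fun l => B l * Fp n j (l - wt R false)).
  by apply: meromorphicM => //; exact: msh.
(* Hides the recursion of words from the rewriting below. *)
have [W WE] : exists W : seq bool -> nat -> C -> E, W = word by exists word.
rewrite -WE in IHp IHm wE1 wE2 step step1 *.
clear wE; split.
- rewrite wE1 (wE2 i.+1) !mulrDr pm2 IHp IHm step // step // e1 -addrA.
  congr (_ + _); case: {wE1 e1} i => [|i']; first by rewrite mulr0 addr0 e20.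
  by rewrite c2 IHp step1 // -mulrDl e2.
- rewrite wE1 (wE2 i) !mulrDr c2 IHm step1 //.
  case: {wE1 e1} i => [|i']; first by rewrite !mulr0 !addr0 e30.
  rewrite mp2 IHp IHm step // step // e4 addrA.
  by congr (_ + _); rewrite -mulrDl e3.
Qed.

End RowBinomial.

(** * Matrix elements are words *)

Section Pochhammer.
Variables (R : realType) (q p : R).
Hypotheses (hq : 0 < q < 1) (hp : 0 < p < 1).
Local Notation C := (Cx R).
Local Notation br := (br q p).

(** The bracket form of the elliptic shifted factorial (q^2x)_n; the two differ by
a power of q (pochE). *)
Definition pb (x : C) (n : nat) : C := \prod_(t < n) br (x + t%:R).

Lemma pb0 x : pb x 0 = 1. Proof. exact: big_ord0. Qed.

Lemma pbS x n : pb x n.+1 = pb x n * br (x + n%:R).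
Proof. exact: big_ord_recr. Qed.

Lemma pbSl x n : pb x n.+1 = br x * pb (x + 1) n.
Proof.
rewrite /pb big_ord_recl addr0; congr (_ * _); apply: eq_bigr => t _.
by rewrite /= /bump /= add1n -natr1 -addrA [1 + _]addrC.
Qed.

Lemma pbD x m n : pb x (m + n) = pb x m * pb (x + m%:R) n.
Proof.
elim: n => [|n IH]; first by rewrite addn0 pb0 mulr1.
by rewrite addnS !pbS IH natrD addrA mulrA.
Qed.

Lemma pb_neq0 x n : (forall t, (t < n)%N -> br (x + t%:R) != 0) -> pb x n != 0.
Proof. by move=> h; apply/prodf_neq0 => t _; exact: h. Qed.

Lemma pochE x n :
  poch q p (q2 q x) (Posz n) = qpow q (n%:R * x + 'C(n, 2)%:R) * pb x n.
Proof.
elim: n => [|n IH].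
  by rewrite /poch big_ord0 pb0 bin_small // mul0r addr0 qpow0 mulr1.
have -> : poch q p (q2 q x) (Posz n.+1) =
    poch q p (q2 q x) (Posz n) * theta p (q2 q x * q2 q n%:R).
  exact: big_ord_recr.
rewrite IH theta_brD pbS.
have -> : qpow q (n.+1%:R * x + 'C(n.+1, 2)%:R) =
    qpow q (n%:R * x + 'C(n, 2)%:R) * qpow q (x + n%:R).
  by rewrite -qpowD binS bin1 natrD -natr1; congr (qpow q _); ring.
by ring.
Qed.

Lemma qbinomE k l : qbinom q p k l =
  qpow q (l%:R * (k%:R - l%:R)) * (pb (k%:R - l%:R + 1) l / pb 1 l).
Proof.
rewrite /qbinom.
have h n : (\prod_(1 <= i < n.+1) (theta p (q2 q (k%:R - l%:R + i%:R)) / theta p (q2 q i%:R)))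
   = qpow q (n%:R * (k%:R - l%:R)) * (pb (k%:R - l%:R + 1) n / pb 1 n).
  elim: n => [|n IH]; first by rewrite big_geq // !pb0 mul0r qpow0 divr1 mulr1.
  rewrite big_nat_recr //= IH !pbS !theta_br.
  have -> : qpow q (n.+1%:R * (k%:R - l%:R)) = qpow q (n%:R * (k%:R - l%:R)) *
     (qpow q (k%:R - l%:R + n.+1%:R) / qpow q n.+1%:R).
    by rewrite -qpowN -!qpowD -natr1; congr (qpow q _); ring.
  have -> : k%:R - l%:R + 1 + n%:R = k%:R - l%:R + n.+1%:R :> C by rewrite -natr1; ring.
  have -> : 1 + n%:R = n.+1%:R :> C by rewrite -natr1 addrC.
  by rewrite !invfM; ring.
exact: h.
Qed.

End Pochhammer.

Section MatrixElements.
Variables (R : realType) (q p : R).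
Hypotheses (hq : 0 < q < 1) (hp : 0 < p < 1).
Local Notation C := (Cx R).
Local Notation M := (Mer R).
Local Notation br := (br q p).
Local Notation pb := (pb q p).
Hypothesis brn : forall i, (0 < i)%N -> br i%:R != 0.
Hypothesis brm : forall c, meromorphic (fun l => br (l + c)).
Hypothesis bra : forall c, ae (fun l => br (l + c) != 0).
Variables (Om : set C) (E : ellipticU2 q p Om).
Hypothesis hOm : spectral_domain q Om.
Local Notation L := (Lgen E).
Local Notation mR := (mR E).
Local Notation word := (word E).
Local Notation Fp := (Fp q p).
Local Notation Fm := (Fm q p).

(** An elliptic binomial coefficient with its dynamical part. *)
Definition binc (n i : nat) (m : C) : C :=
  pb (n%:R - i%:R + 1) i / pb 1 i *
  (pb (m + (2 - i%:R)) i / pb (m + (n%:R - 2 * i%:R + 2)) i).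

Lemma pb_mero c n : meromorphic (fun m => pb (m + c) n).
Proof.
elim: n => [|n IH].
  by under eq_fun do rewrite pb0; exact: meromorphic_cst.
under eq_fun do rewrite pbS -addrA.
exact: meromorphicM.
Qed.

Lemma pb_ae c n : ae (fun m => pb (m + c) n != 0).
Proof.
elim: n => [|n IH].
  by move=> x; apply: nearW => l; rewrite pb0 oner_neq0.
apply: ae_impl (ae_and IH (bra (c + n%:R))) => l [h1 h2].
by rewrite pbS mulf_neq0 // -addrA.
Qed.

Lemma binc_mero n i : meromorphic (binc n i).
Proof.
apply: meromorphicM; first exact: meromorphic_cst.
apply: meromorphicM; first exact: pb_mero.
by apply: meromorphicV; [exact: pb_ae|exact: pb_mero].
Qed.

(** The monomial in which a word with constant rows is expressed: all pluses to
the left and spectral parameters decreasing. *)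
Definition rword e n i z : E :=
  (\prod_(k <- rev (index_iota (n - i) n)) L e true (q2 q k%:R * z)) *
  (\prod_(k <- rev (index_iota 0 (n - i))) L e false (q2 q k%:R * z)).

Lemma index_iotaS a n : (a <= n)%N -> rev (index_iota a n.+1) = n :: rev (index_iota a n).
Proof.
move=> an; rewrite /index_iota subSn // -addn1 iotaD /= subnKC //.
by rewrite rev_cat.
Qed.

Lemma rwordS e n i z : (i <= n)%N ->
  rword e n.+1 i.+1 z = L e true (q2 q n%:R * z) * rword e n i z.
Proof.
by move=> le_in; rewrite /rword subSS index_iotaS ?leq_subr // big_cons mulrA.
Qed.

Lemma rwordS0 e n z : rword e n.+1 0 z = L e false (q2 q n%:R * z) * rword e n 0 z.
Proof.
have nn m : rev (index_iota m m) = [::] by rewrite /index_iota subnn.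
by rewrite /rword !subn0 !nn !big_nil !mul1r (index_iotaS (leq0n n)) big_cons.
Qed.

(** Each step of row_step multiplies the monomial by one more generator, and the
product of the inverse factors Fp is the binomial coefficient. *)
Lemma row_word e n i z : Om z -> (i <= n)%N ->
  word (nseq n e) i z = mR (binc n i) * rword e n i z.
Proof.
move=> Oz; elim: n i => [|n IH] i.
  rewrite leqn0 => /eqP ->.
  have -> : rword e 0 0 z = 1 by rewrite /rword /index_iota !big_nil mulr1.
  have -> : word (nseq 0 e) 0 z = 1 by [].
  rewrite mulr1 -(mR_1 E); apply: mR_eq => c; apply: nearW => l.
  by rewrite /binc !pb0 !divr1 mulr1.
have [s1 s2] := row_step hp brn brm bra E hOm e n i Oz.
case: i s1 s2 => [|i] s1 s2 le_in.
  have F1 : mR (Fm n 0) = 1.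
    rewrite -(mR_1 E); apply: mR_eq; apply: ae_impl (bra 1) => l l1.
    rewrite /(Fm _ _ _) !subr0 !divff ?mulr1 //; by rewrite natr1 brn.
  have B1 m : mR (binc m 0) = 1.
    rewrite -(mR_1 E); apply: mR_eq => c; apply: nearW => l.
    by rewrite /binc !pb0 !divr1 mulr1.
  move: s2; rewrite F1 mul1r => <-.
  by rewrite IH // !B1 !mul1r rwordS0.
clear s1 s2; have [s1 _] := row_step hp brn brm bra E hOm e n i Oz.
have bF : ae (fun m => Fp n i m != 0).
  apply: ae_impl (ae_and (bra 1) (bra (n%:R - i%:R + 1))) => l [l1 l2].
  have n1 m : br (m%:R + 1) != 0 by rewrite natr1 brn.
  have q0 (x y : C) : x != 0 -> y != 0 -> x / y != 0.
    by move=> ? ?; rewrite mulf_neq0 ?invr_eq0.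
  exact: (mulf_neq0 (q0 _ _ (n1 i) (n1 n)) (q0 _ _ l2 l1)).
have mF := Fp_mero brm bra n i; have mV := meromorphicV bF mF.
have VF : mR (fun m => (Fp n i m)^-1) * mR (Fp n i) = 1.
  rewrite mRM // -(mR_1 E); apply: mR_eq; apply: ae_impl bF => l l0.
  by rewrite mulVf.
rewrite -[LHS]mul1r -VF -mulrA -s1 (IH i) // rwordS //.
move: (rword e n i z) => w; rewrite !mulrA -(mulrA _ (L e true _)).
have LR f : meromorphic f -> L e true (q2 q n%:R * z) * mR f =
    mR (fun l => f (l - wt R true)) * L e true (q2 q n%:R * z).
  by apply: L_mR; exact: q2_iter.
rewrite LR; last exact: binc_mero.
rewrite mulrA mRM //; last exact: (meromorphic_shift _ (binc_mero n i)).
congr (_ * _ * _); apply: mR_eq.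
apply: ae_impl (ae_and (bra 1) (ae_and (bra (n%:R - i%:R + 1))
  (pb_ae (n%:R - 2 * i%:R + 1) i))) => l [l1 [l2 l3]].
have i1 : i.+1%:R = i%:R + 1 :> C by rewrite natr1.
have n1 : n.+1%:R = n%:R + 1 :> C by rewrite natr1.
rewrite /(Fp _ _ _) /binc /= i1 n1 !pbS.
rewrite (_ : n%:R + 1 - (i%:R + 1) + 1 = n%:R - i%:R + 1); last by ring.
rewrite (_ : l - 1 + (2 - i%:R) = l + (2 - (i%:R + 1))); last by ring.
rewrite (_ : l - 1 + (n%:R - 2 * i%:R + 2) = l + (n%:R + 1 - 2 * (i%:R + 1) + 2)); last by ring.
rewrite (_ : l + (2 - (i%:R + 1)) + i%:R = l + 1); last by ring.
rewrite (_ : l + (n%:R + 1 - 2 * (i%:R + 1) + 2) + i%:R = l + (n%:R - i%:R + 1)); last by ring.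
rewrite (_ : n%:R - i%:R + 1 + i%:R = n%:R + 1); last by ring.
rewrite (_ : 1 + i%:R = i%:R + 1); last by ring.
by rewrite !invfM !invrK; ring.
Qed.

Lemma rword_gr e n i z : Om z -> (i <= n)%N ->
  gr (wsum R n (if e then n else 0%N)) (wsum R n i) (rword e n i z).
Proof.
move=> Oz le_in.
have gp b (s : seq nat) : gr ((size s)%:R * wt R e) ((size s)%:R * wt R b)
    (\prod_(k <- s) L e b (q2 q k%:R * z)).
  elim: s => [|k s IHs]; first by rewrite big_nil !mul0r; exact: gr_1.
  rewrite big_cons /= -natr1 !mulrDl !mul1r ![_ + wt R _]addrC.
  by apply: gr_M => //; apply: (L_gr (ell_relations E)); exact: q2_iter.
have := gr_M (gp true (rev (index_iota (n - i) n))) (gp false (rev (index_iota 0 (n - i)))).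
rewrite !size_rev !size_iota subn0 subKn // -/(rword e n i z).
have -> : i%:R * wt R e + (n - i)%:R * wt R e = wsum R n (if e then n else 0%N).
  by rewrite /wsum natrB //; case: e {gp}; rewrite ?muln0 ?mul2n -?addnn ?natrD /=; ring.
have -> : i%:R * wt R true + (n - i)%:R * wt R false = wsum R n i.
  by rewrite /wsum natrB // natrM /=; ring.
by [].
Qed.

(** The powers of q in the binomial coefficients cancel against those of the
shifted factorials. *)
Lemma tmat_coef N k j l (m : C) : (k <= N)%N -> (l <= k)%N -> (l <= j)%N ->
  qbinom q p k l * qbinom q p (N - k) (j - l) *
  (poch q p (q2 q (m + N%:R - k%:R - 2 * j%:R + l%:R + 2)) l
   / poch q p (q2 q (m + N%:R - 2 * j%:R + 2)) l
   * (poch q p (q2 q (m + l%:R - j%:R + 2)) (j - l)%N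
      / poch q p (q2 q (m + N%:R - 2 * j%:R - k%:R + 2 * l%:R + 2)) (j - l)%N)) =
  binc (N - k) (j - l) m * binc k l (m - wsum R (N - k) (j - l)).
Proof.
move=> kN lk lj; have [n NE] : exists n, N = (n + k)%N by exists (N - k)%N; rewrite subnK.
have [i jE] : exists i, j = (i + l)%N by exists (j - l)%N; rewrite subnK.
rewrite NE jE !addnK.
pose X1 : C := n%:R - 2 * i%:R - l%:R + 2.
pose X2 : C := n%:R + k%:R - 2 * i%:R - 2 * l%:R + 2.
pose X3 : C := 2 - i%:R.
pose X4 : C := n%:R - 2 * i%:R + 2.
have -> : m + (n + k)%:R - k%:R - 2 * (i + l)%:R + l%:R + 2 = m + X1.
  by rewrite /X1 !natrD; ring.
have -> : m + (n + k)%:R - 2 * (i + l)%:R + 2 = m + X2.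
  by rewrite /X2 !natrD; ring.
have -> : m + l%:R - (i + l)%:R + 2 = m + X3 by rewrite /X3 !natrD; ring.
have -> : m + (n + k)%:R - 2 * (i + l)%:R - k%:R + 2 * l%:R + 2 = m + X4.
  by rewrite /X4 !natrD; ring.
rewrite !pochE // !qbinomE /binc.
have -> : m - wsum R n i + (2 - l%:R) = m + X1 by rewrite /wsum natrM /X1; ring.
have -> : m - wsum R n i + (k%:R - 2 * l%:R + 2) = m + X2 by rewrite /wsum natrM /X2; ring.
rewrite -/X3 -/X4.
have KE : qpow q (l%:R * (k%:R - l%:R)) * qpow q (i%:R * (n%:R - i%:R)) *
   (qpow q (l%:R * (m + X1) + 'C(l, 2)%:R) * (qpow q (l%:R * (m + X2) + 'C(l, 2)%:R))^-1
     * (qpow q (i%:R * (m + X3) + 'C(i, 2)%:R) * (qpow q (i%:R * (m + X4) + 'C(i, 2)%:R))^-1)) = 1.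
  rewrite -!qpowN -!qpowD; apply: etrans (qpow0 q); congr (qpow q _).
  by rewrite /X1 /X2 /X3 /X4; ring.
rewrite -[RHS]mul1r -[X in _ = X * _]KE.
move: (qpow q _) (qpow q _) (qpow q _) (qpow q _) (qpow q _) (qpow q _).
move: (pb _ _) (pb _ _) (pb _ _) (pb _ _) (pb _ _) (pb _ _) (pb _ _) (pb _ _) => *.
by rewrite !invfM; ring.
Qed.

(** Splitting the j pluses between the minus block and the plus block of the
standard word gives the sum over l; moving the second coefficient to the left
shifts its argument by the weight of the first block. *)
Lemma tmat_word N k j z : Om z -> (k <= N)%N -> (j <= N)%N ->
  tmat E N k j z = word (stdw N k) j z.
Proof.
move=> Oz kN jN; have [n NE] : exists n, N = (n + k)%N by exists (N - k)%N; rewrite subnK.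
have Oz' : Om (q2 q n%:R * z) by exact: q2_iter.
rewrite /stdw NE addnK word_cat size_nseq.
pose G i l := word (nseq n false) i z * word (nseq k true) l (q2 q n%:R * z).
have G0 i l : (n < i)%N || (k < l)%N -> G i l = 0.
  rewrite /G => /orP[h|h].
    by rewrite (_ : word (nseq n false) i z = 0) ?mul0r //; apply: word_gt; rewrite size_nseq.
  rewrite (_ : word (nseq k true) l _ = 0) ?mulr0 //; apply: word_gt; by rewrite size_nseq.
transitivity (\sum_(k + j - N <= l < (minn k j).+1) G (j - l)%N l); last first.
  transitivity (\sum_(0 <= l < j.+1) G (j - l)%N l); last first.
    rewrite big_mkord (reindex_inj rev_ord_inj) /=; apply: eq_bigr => i _.
    by rewrite subSS subKn // -ltnS.
  have z1 : \sum_(0 <= l < k + j - N) G (j - l)%N l = 0.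
    by rewrite big_nat big1 // => l hl; apply: G0; lia.
  have z2 : \sum_((minn k j).+1 <= l < j.+1) G (j - l)%N l = 0.
    by rewrite big_nat big1 // => l hl; apply: G0; lia.
  have c1 : (k + j - N <= (minn k j).+1)%N by lia.
  have c2 : ((minn k j).+1 <= j.+1)%N by lia.
  rewrite (big_cat_nat (leq0n _) (leq_trans c1 c2)) /= z1 add0r.
  by rewrite (big_cat_nat c1 c2) /= z2 addr0.
rewrite /tmat NE; apply: eq_big_nat => l hl.
have lk : (l <= k)%N by lia.
have lj : (l <= j)%N by lia.
have [i jE] : exists i, j = (i + l)%N by exists (j - l)%N; rewrite subnK.
have i_n : (i <= n)%N by lia.
rewrite /G jE; have -> : (i + l - l)%N = i by lia.
rewrite (row_word false Oz i_n) (row_word true Oz' lk).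
have -> : (n + k + l - (i + l) - k)%N = (n - i)%N by lia.
have -> : (n + k - k)%N = n by lia.
have gW := rword_gr false Oz i_n.
have WE : rword true k l (q2 q n%:R * z) =
    (\prod_(e <- rev (index_iota (n + k - l) (n + k))) L true true (q2 q e%:R * z)) *
    (\prod_(e <- rev (index_iota n (n + k - l))) L true false (q2 q e%:R * z)).
  have sh a b : rev (index_iota (n + a) (n + b)) = map (addn n) (rev (index_iota a b)).
    by rewrite map_rev /index_iota subnDl iotaDl.
  have -> : (n + k - l)%N = (n + (k - l))%N by lia.
  have sh0 b : rev (index_iota n (n + b)) = map (addn n) (rev (index_iota 0 b)).
    by rewrite -sh addn0.
  rewrite sh sh0 !big_map /rword; congr (_ * _);
    by apply: eq_bigr => e _; rewrite mulrA -q2D natrD [in RHS]addrC.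
set f := (fun m : C => _ / _ * (_ / _)).
transitivity ((qbinom q p k l * qbinom q p n i) *: (mR f * rword false n i z * rword true k l (q2 q n%:R * z))).
  by rewrite WE /rword !mulrA.
have mb := meromorphic_shift (- wsum R n i) (binc_mero k l).
have -> : mR (binc n i) * rword false n i z * (mR (binc k l) * rword true k l (q2 q n%:R * z)) =
   mR (fun m => binc n i m * binc k l (m - wsum R n i)) * rword false n i z * rword true k l (q2 q n%:R * z).
  move: (rword true k l _) (rword false n i z) gW => w' w gW.
  rewrite !mulrA; congr (_ * w').
  rewrite -mRM //; last exact: binc_mero.
  rewrite -!mulrA; congr (_ * _).
  rewrite !mRE (momR_comm _ gW) Tshift_toM; last exact: mb.
  congr (_ * momR E (toM _)).
  by apply/funext => m; rewrite addrK.
rewrite !scalerAl; congr (_ * _ * _).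
have fE m : qbinom q p k l * qbinom q p n i * f m = binc n i m * binc k l (m - wsum R n i).
  have := @tmat_coef (n + k) k (i + l) l m (leq_addl _ _) lk (leq_addl _ _).
  by rewrite !addnK.
have -> : (fun m => binc n i m * binc k l (m - wsum R n i)) =
    (fun m => qbinom q p k l * qbinom q p n i * f m) by apply/funext => m; rewrite fE.
by rewrite !mRE toM_scale rmorphM momR_const mulr_algl.
Qed.

End MatrixElements.

(** * Pairing a generator with a word *)

Section PairingRight.
Variable R : realType.
Local Notation C := (Cx R).
Local Notation M := (Mer R).
Variables (U A : hBialgebroid R) (P : U -> A -> oper R).
Hypothesis hP : is_pairing P.

Definition pfunr a b g (rho : C) (X Y : U) : M :=
  P (wproj (fun d => d.2 == rho) X) a
    (Tshift rho (P (wproj (fun d => d.1 == rho) Y) b g)).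

Lemma pfunr_balanced a b g : balanced (pfunr a b g).
Proof.
split=> rho.
- by move=> X X' Y; rewrite /pfunr wprojD (pair_Dl hP).
- by move=> X Y Y'; rewrite /pfunr wprojD (pair_Dl hP) TshiftD (pair_add hP).
- by move=> c X Y; rewrite /pfunr !wprojZ !(pair_Zl hP) TshiftM Tshift_cst (pair_scale hP).
- move=> f X Y; rewrite /pfunr !wprojM; [|exact: momL_gr|exact: momR_gr].
  by rewrite wprojR_comm (pair_momR hP) (pair_momL hP) /mulop /= TshiftM.
Qed.

Lemma pfunr_gr a b g al rho be X Y : gr al rho X -> gr rho be Y ->
  pfunr a b g rho X Y = P X a (Tshift rho (P Y b g)).
Proof. by move=> gX gY; rewrite /pfunr (wproj_gr _ gX) (wproj_gr _ gY) /= eqxx. Qed.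

Lemma pair_mulr_tsum X a b g : P X (a * b) g = tsum (pfunr a b g) (Delta X).
Proof.
rewrite (pair_mulr hP) fct_sumE /tsum big_seq [RHS]big_seq.
apply: eq_bigr => t /(@Delta_wf _ _ _) [al [be [gX gY]]].
by rewrite (pfunr_gr _ _ _ gX gY).
Qed.

End PairingRight.

Section GeneratorPairing.
Variables (R : realType) (q p : R).
Hypotheses (hq : 0 < q < 1) (hp : 0 < p < 1).
Local Notation C := (Cx R).
Local Notation M := (Mer R).
Local Notation br := (br q p).
Hypothesis brn : forall i, (0 < i)%N -> br i%:R != 0.
Hypothesis brm : forall c, meromorphic (fun l => br (l + c)).
Hypothesis bra : forall c, ae (fun l => br (l + c) != 0).
Variables (W Z : set C) (EW : ellipticU2 q p W) (EZ : ellipticU2 q p Z).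
Hypotheses (hW : spectral_domain q W) (hZ : spectral_domain q Z).
Variable P : cop EW -> EZ -> oper R.
Hypothesis hP : is_cobraiding P.
Let hPp := cobraiding_pairing hP.

(** The factor in the pairing of L_ab(w) with a word of n minuses and k pluses, at
w / z = q^2v. It vanishes when no word of the same length has k + a - b pluses
(gpair_out). *)
Definition gpair (a b : bool) (n k : nat) (v l : C) : C :=
  (match a, b with
   | true, true => br (v - n%:R + 1) * br (l + (n%:R + 1))
   | false, false => br (v - k%:R + 1) * br (l + (1 - k%:R))
   | false, true => br k%:R * br (l + (v + 2 - k%:R))
   | true, false => br n%:R * br (l + (n%:R - v))
   end) / br (v + 1) / br (l + 1).

Lemma gpair_mero a b n k v : meromorphic (gpair a b n k v).
Proof.
rewrite /gpair; apply: meromorphicM; last exact: meromorphicV.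
apply: meromorphicM; last exact: meromorphic_cst.
by case: a; case: b; apply: meromorphicM => //; exact: meromorphic_cst.
Qed.

(** The coproduct in the coopposite bialgebroid exchanges the two tensor factors,
whence the order of the column and row indices. *)
Lemma pair_L_M a b w (Y Y' : EZ) g : W w ->
  P (Lgen EW a b w) (Y * Y') g =
  P (Lgen EW true b w) Y (Tshift (wt R true) (P (Lgen EW a true w) Y' g)) +
  P (Lgen EW false b w) Y (Tshift (wt R false) (P (Lgen EW a false w) Y' g)).
Proof.
move=> Ow; rewrite (pair_mulr_tsum hPp).
have D : tens_eq (A := cop EW) (B := cop EW) (Delta (h := cop EW) (Lgen EW a b w))
   [:: (wt R true, Lgen EW true b w, Lgen EW a true w);
       (wt R false, Lgen EW false b w, Lgen EW a false w)].
  exact: (tens_flip_eq (Delta_L EW a b Ow)).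
rewrite (tsum_eq (pfunr_balanced hPp Y Y' g) D) /tsum !big_cons big_nil addr0 /=.
have gL x y : @gr R (hcop EW) (wt R y) (wt R x) (Lgen EW x y w).
  exact: (L_gr (ell_relations EW) x y Ow).
by rewrite (pfunr_gr (U := cop EW) P _ _ _ (gL true b) (gL a true))
  (pfunr_gr (U := cop EW) P _ _ _ (gL false b) (gL a false)).
Qed.

Lemma Rmat0 (b d e x : bool) (l u : C) : (b + d != e + x)%N -> Rmat q p b d e x l u = 0.
Proof. by case: b; case: d; case: e; case: x. Qed.

(** The two shapes of the addition formula in gpair_step: add4_down for shifts by
-1, add4_up for shifts by +1. *)
Lemma add4_down (a b c d yA yB yC yD y1 y2 yE yF v1 v0 l1 l0 l0' v1' : C) :
  br v1 != 0 -> br v0 != 0 -> br l1 != 0 -> br l0 != 0 ->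
  yA = a + b -> yB = a + b + c + d -> yC = b -> yD = b + c + d ->
  y1 = a -> y2 = a + 2 * b + c + d -> yE = c -> yF = d ->
  v1 = a + b + c -> v0 = b + c -> l1 = a + b + d -> l0 = b + d -> l0' = l0 -> v1' = v1 ->
  br yA * br yB / br v1 / br l1 =
  br v1' / br v1' * (br yC * br yD / br v0 / br l0) +
  br y1 * br y2 / br l1 / br v1 * (br yE * br yF / br v0 / br l0').
Proof.
move=> n1 n2 n3 n4 -> -> -> -> -> -> -> -> e1 e2 e3 e4 -> ->.
have H := br_add4 q hp a b c d.
move: n1 n2 n3 n4; rewrite {}e1 {}e2 {}e3 {}e4 => n1 n2 n3 n4.
apply: (mulIf n1); apply: (mulIf n2); apply: (mulIf n3); apply: (mulIf n4).
transitivity (br (a + b + c + d) * br (a + b) * (br (b + d) * br (b + c))); first by field; rewrite n1 n3.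
by rewrite -H; field; rewrite n1 n2 n3 n4.
Qed.

Lemma add4_up (a b c d yA yB yC yD y1 y2 yE yF v1 v0 l1 l0 l0' v1' : C) :
  br v1 != 0 -> br v0 != 0 -> br l1 != 0 -> br l0 != 0 ->
  yA = a + b -> yB = b + d -> yC = b -> yD = a + b + d ->
  y1 = a -> y2 = d -> yE = c -> yF = a + 2 * b + c + d ->
  v1 = a + b + c -> v0 = b + c -> l1 = b + c + d -> l0 = a + b + c + d -> l0' = l0 -> v1' = v1 ->
  br yA * br yB / br v1 / br l1 =
  br y1 * br y2 / br l1 / br v1 * (br yE * br yF / br v0 / br l0) +
  br v1' / br v1' * (br yC * br yD / br v0 / br l0').
Proof.
move=> n1 n2 n3 n4 -> -> -> -> -> -> -> -> e1 e2 e3 e4 -> ->.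
have H := br_add4 q hp a b c d.
move: n1 n2 n3 n4; rewrite {}e1 {}e2 {}e3 {}e4 => n1 n2 n3 n4.
apply: (mulIf n1); apply: (mulIf n2); apply: (mulIf n3); apply: (mulIf n4).
transitivity (br (a + b + c + d) * br (a + b) * (br (b + d) * br (b + c))); first by field; rewrite n1 n3.
by rewrite -H; field; rewrite n1 n2 n3 n4.
Qed.

(** The pairing with the first letter is an entry of the R-matrix. When it and the
column index of the generator have equal sign there are two such entries, and
the addition formula combines them; otherwise there is only one. *)
Lemma gpair_step (a b x : bool) (n k : nat) (v : C) : (forall i : nat, br (v + 1 - i%:R) != 0) ->
  ae (fun l => gpair a b (~~ x + n) (x + k) v l =
    \sum_(d : bool) \sum_(e : bool) Rmat q p b d e x l (q2 q v) *
      gpair a e n k (v - 1) (l + (wt R e - wt R b - wt R d))).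
Proof.
move=> v_nz.
have v1 : br (v + 1) != 0 by have := v_nz 0%N; rewrite subr0.
have v0 : br v != 0 by have := v_nz 1%N; rewrite addrK.
apply: ae_impl (ae_and (bra 0) (ae_and (bra 1) (bra 2))) => l [l0 [l1 l2]].
rewrite addr0 in l0.
rewrite !big_bool /= !Rmat_br //.
have key y1 y2 y3 y4 z1 z2 z3 z4 v' l' l'' : y1 = z1 -> y2 = z2 -> v' = v -> l'' = l' ->
    br l' != 0 ->
    br y1 * br y2 / br (v + 1) / br (l + 1) =
    br v * br l' / br (l + 1) / br (v + 1) * (br z1 * br z2 / br v' / br l'').
  by move=> -> -> -> -> n0; field; rewrite v1 v0 l1 n0.
have w0 y : y = v -> br y != 0 by move=> ->.
have k0 y : y = l -> br y != 0 by move=> ->.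
have k2 y : y = l + 2 -> br y != 0 by move=> ->.
case: a; case: b; case: x.
all: rewrite /rbr /gpair /wt ?add0n ?add1n ?mul0r ?addr0 ?add0r -?natr1.
- by apply: (add4_down (a := 1) (b := v - n%:R) (c := n%:R) (d := l + n%:R - v)) => //;
   first [by apply: w0; ring | by apply: k0; ring | ring].
- by apply: key; rewrite ?add0r //; ring.
- by apply: key => //; ring.
- by apply: (add4_up (a := 1) (b := n%:R) (c := v - n%:R) (d := l + 1 - v)) => //;
   first [by apply: w0; ring | by apply: k2; ring | ring].
- by apply: (add4_down (a := 1) (b := k%:R) (c := v - k%:R) (d := l - k%:R)) => //;
   first [by apply: w0; ring | by apply: k0; ring | ring].
- by apply: key; rewrite ?add0r //; ring.
- by apply: key => //; ring.
- by apply: (add4_up (a := 1) (b := v - k%:R) (c := k%:R) (d := l + 1 - v)) => //;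
   first [by apply: w0; ring | by apply: k2; ring | ring].
Qed.

(** Splitting off the first letter of the word by pair_L_M leaves pairings of
generators with generators, and gpair_step adds up the results. *)
Lemma pair_L_word a b xs j w z v g : W w -> Z z -> w / z = q2 q v ->
  (forall i : nat, br (v + 1 - i%:R) != 0) ->
  P (Lgen EW a b w) (word EZ xs j z) g =
  if (j + b == count_mem true xs + a)%N then
    toM (gpair a b (count_mem false xs) (count_mem true xs) v) *
    Tshift (- (wt R b + wsum R (size xs) j)) g
  else 0.
Proof.
move=> Ow; elim: xs j z v b => [|x xs IH] j z v b Oz zE v_nz.
  case: j => [|j] /=.
    rewrite (pair_1r hPp) /= (eps_L EW _ _ Ow) !add0n.
    have w0 : wsum R 0 0 = 0 by rewrite /wsum muln0 subrr.
    have -> : (b == a :> nat) = (a == b) by case: a; case: b.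
    case: eqP => [<-|_] //; rewrite w0 addr0.
    have -> : toM (gpair a a 0 0 v) = 1.
      rewrite -toM1; apply: toM_eq; apply: ae_impl (bra 1) => l l1.
      have v1 : br (v + 1) != 0 by have := v_nz 0%N; rewrite subr0.
      by rewrite /gpair; case: a; rewrite subr0 ?add0r ?subr0; field; rewrite v1 l1.
    by rewrite mul1r.
  rewrite (pair_0r hPp); case: eqP => // e.
  have [aT bF] : a = true /\ b = false by case: a e; case: b => /= e; split; lia.
  rewrite aT bF; have -> : toM (gpair true false 0 0 v) = 0.
    rewrite -toM0; apply: toM_eq => c; apply: nearW => l.
    by rewrite /gpair br0 // !mul0r.
  by rewrite mul0r.
have Oz' : Z (q2 q 1 * z) by case: (hZ Oz).
set z' := q2 q 1 * z in Oz'.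
have z'E : w / z' = q2 q (v - 1).
  have -> : w / z' = (q2 q 1)^-1 * q2 q v by rewrite /z' invfM mulrCA zE.
  have -> : q2 q v = q2 q 1 * q2 q (v - 1) by rewrite -q2D subrKC.
  exact: mulKf (q2_neq0 q 1) _.
have v_nz' (i : nat) : br (v - 1 + 1 - i%:R) != 0.
  by have := v_nz i.+1; rewrite -natr1; congr (br _ != 0); ring.
set n := count_mem false xs; set k := count_mem true xs.
have nE : count_mem false (x :: xs) = (~~ x + n)%N by case: (x).
have kE : count_mem true (x :: xs) = (x + k)%N by case: (x).
rewrite nE kE.
pose wd d := if d then (if j is j'.+1 then word EZ xs j' z' else 0) else word EZ xs j z'.
have wE : word EZ (x :: xs) j z = Lgen EZ x false z * wd false + Lgen EZ x true z * wd true.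
  by rewrite /= /wd; case: (j) => [|j1]; rewrite ?mulr0 ?addr0.
pose S := - (wt R b + wsum R (size (x :: xs)) j).
pose G d e := fun l => Rmat q p b d e x l (q2 q v) *
  gpair a e n k (v - 1) (l + (wt R e - wt R b - wt R d)).
have mR d e : meromorphic (fun l => Rmat q p b d e x l (q2 q v)).
  have v1 : br (v + 1) != 0 by have := v_nz 0%N; rewrite subr0.
  have -> : (fun l => Rmat q p b d e x l (q2 q v)) =
      (fun l => rbr q p b d e x l v * (br (v + 1))^-1).
    by apply/funext => l; rewrite Rmat_br.
  by apply: meromorphicM; [exact: rbr_mero|exact: meromorphic_cst].
have mf d e : meromorphic (fun l => gpair a e n k (v - 1) (l + (wt R e - wt R b - wt R d))).
  exact: meromorphic_shift (gpair_mero _ _ _ _ _).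
have mG d e : meromorphic (G d e) by exact: meromorphicM.
have key d e : P (Lgen EW e b w) (Lgen EZ x d z) (Tshift (wt R e) (P (Lgen EW a e w) (wd d) g)) =
  if (j + b == x + k + a)%N then toM (G d e) * Tshift S g else 0.
  rewrite (pair_LL hP) // zE /mulop /=.
  have [cons|ncons] := eqVneq (b + d)%N (e + x)%N; last first.
    have R0 : (fun l => Rmat q p b d e x l (q2 q v)) = (fun=> 0).
      by apply/funext => l; rewrite Rmat0.
    rewrite R0 toM0 mul0r; case: ifP => // _.
    rewrite (_ : G d e = (fun=> 0)) ?toM0 ?mul0r //.
    by apply/funext => l; rewrite /G Rmat0 // mul0r.
  have main i : j = (i + d)%N -> wd d = word EZ xs i z' ->
      toM ((Rmat q p b d e x)^~ (q2 q v)) *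
      Tshift (- (wt R b + wt R d)) (Tshift (wt R e) (P (Lgen EW a e w) (wd d) g)) =
      (if (j + b == x + k + a)%N then toM (G d e) * Tshift S g else 0).
    move=> jE ->; rewrite (IH i z' (v - 1)) //.
    have -> : (j + b == x + k + a)%N = (i + e == k + a)%N by rewrite jE -addnA [(d + b)%N]addnC cons addnA [(i + e + x)%N]addnC -addnA eqn_add2l.
    case: ifP => _; last by rewrite !Tshift_0 mulr0.
    rewrite /G toMM // -mulrA; congr (_ * _).
    rewrite Tshift_comp TshiftM Tshift_comp Tshift_toM; last exact: gpair_mero.
    have -> : - (wt R b + wt R d) + wt R e = wt R e - wt R b - wt R d by ring.
    congr (_ * Tshift _ g).
    rewrite /S /wsum jE /= mulnDr -natr1 natrD; case: (d) => /=; ring.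
  case: d {mf mR mG} cons main => [cons|_] main; last by apply: main; rewrite // addn0.
  (* With no plus to spend on the first letter the left-hand side is zero, and so
   is the factor [0] on the right. *)
  clear wE IH; case: j @wd @S main => [|j1] wd S main; last by apply: main; rewrite // addn1.
  rewrite /= (pair_0r hPp) !Tshift_0 mulr0; case: ifP => // c.
  have [ea ee ek] : [/\ a = false, e = true & k = 0%N].
    by clear -c cons; case: (a) c; case: (e) cons; case: (b); case: (x) => /=; split; lia.
  rewrite (_ : G true e = (fun=> 0)) ?toM0 ?mul0r //.
  by apply/funext => l; rewrite /G ea ee /gpair ek br0 // !mul0r mulr0.
rewrite wE (pair_Dr hPp) !pair_L_M // !key.
case: ifP => _; last by rewrite !addr0.
rewrite -/S -!mulrDl; congr (_ * _).
rewrite (toM_eq (gpair_step a b x n k v_nz)) -!toMD //.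
  by congr toM; apply/funext => l; rewrite !big_bool /= /G; ring.
all: exact: meromorphicD.
Qed.

End GeneratorPairing.

(** * Pairing products of generators with a word *)

Section Chains.
Variables (R : realType) (q p : R).
Hypotheses (hq : 0 < q < 1) (hp : 0 < p < 1).
Local Notation C := (Cx R).
Local Notation M := (Mer R).
Local Notation br := (br q p).
Local Notation pb := (pb q p).
Local Notation gpair := (gpair q p).
Hypothesis brn : forall i, (0 < i)%N -> br i%:R != 0.
Hypothesis brm : forall c, meromorphic (fun l => br (l + c)).
Hypothesis bra : forall c, ae (fun l => br (l + c) != 0).
Variables (W Z : set C) (EW : ellipticU2 q p W) (EZ : ellipticU2 q p Z).
Hypotheses (hW : spectral_domain q W) (hZ : spectral_domain q Z).
Variable P : cop EW -> EZ -> oper R.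
Hypothesis hP : is_cobraiding P.
Let hPp := cobraiding_pairing hP.

Lemma count_stdw N k : (k <= N)%N -> count_mem true (stdw N k) = k.
Proof. by move=> kN; rewrite /stdw count_cat !count_nseq /= mul0n mul1n. Qed.

Lemma countF_stdw N k : (k <= N)%N -> count_mem false (stdw N k) = (N - k)%N.
Proof. by move=> kN; rewrite /stdw count_cat !count_nseq /= mul0n mul1n addn0. Qed.

Lemma gpair_out (a b : bool) (N k : nat) (v l : C) : (k <= N)%N -> ~~ ((b <= k + a) && (k + a - b <= N))%N ->
  gpair a b (N - k) k v l = 0.
Proof.
move=> kN nc.
have [[-> -> ->]|[-> -> ->]] : [/\ a = false, b = true & k = 0%N] \/ [/\ a = true, b = false & N - k = 0]%N.
- by move: nc; clear -kN; case: a; case: b; rewrite /= => nc; ((exfalso; lia) || (left; split=> //; lia) || (right; split=> //; lia)).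
- by rewrite /gpair br0 // !mul0r.
- by rewrite /gpair br0 // !mul0r.
Qed.

(** Among the summands of word_coproduct only the one with k + a - b pluses
pairs nontrivially with the generator. *)
Lemma pair_L_std a b w v Y N k j z g : W w -> Z z -> w / z = q2 q v ->
  (forall i : nat, br (v + 1 - i%:R) != 0) -> (k <= N)%N ->
  P (Lgen EW a b w * Y) (word EZ (stdw N k) j z) g =
  toM (gpair a b (N - k) k v) * Tshift (- wt R b) (P Y (word EZ (stdw N (k + a - b)) j z) g).
Proof.
move=> Ow Oz zE v_nz kN.
rewrite (pair_mull_tsum hPp) (word_coproduct (q := q) (p := p) hp brn brm bra hZ) //; last exact: pfun_balanced.
rewrite size_stdw //.
have term (i : 'I_N.+1) : pfun P (Lgen EW a b w) Y g (wsum R N i) (word EZ (stdw N k) i z)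
     (word EZ (stdw N i) j z) =
   if (i + b == k + a)%N then toM (gpair a b (N - k) k v) *
     Tshift (- wt R b) (P Y (word EZ (stdw N i) j z) g) else 0.
  have iN : (i <= N)%N by rewrite -ltnS.
  have g1 := word_gr EZ hZ (stdw N k) i Oz.
  have g2 := word_gr EZ hZ (stdw N i) j Oz.
  rewrite !size_stdw // !count_stdw // in g1; rewrite !size_stdw // !count_stdw // in g2.

  rewrite (pfun_gr P _ _ _ g1 g2).
  rewrite (pair_L_word hq hp brm bra hZ hP _ _ _ _ _ Ow Oz zE) // count_stdw // countF_stdw // size_stdw //.
  case: ifP => // _; rewrite Tshift_comp; congr (_ * Tshift _ _); ring.
rewrite (eq_bigr _ (fun i _ => term i)).
have [/andP[c1 c2]|nc] := boolP ((b <= k + a) && (k + a - b <= N))%N.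
  have i0 : (k + a - b < N.+1)%N by [].
  rewrite (bigD1 (Ordinal i0)) //= subnK // eqxx big1 ?addr0 // => i ne.
  case: eqP => // e; case/eqP: ne; apply: val_inj => /=; lia.
rewrite (_ : gpair a b (N - k) k v = (fun=> 0)) ?toM0; last by apply/funext => l; exact: gpair_out.
rewrite mul0r big1 // => i _; case: eqP => // e.
by case/negP: nc; have := ltn_ord i; lia.
Qed.

(** The factors collected when len generators of the same kind, with decreasing
spectral parameters, are moved through the standard word. The truncated
subtraction in k is harmless because of gpair_out. *)
Fixpoint chain (a b : bool) (N : nat) (v : C) (len k : nat) (l : C) : C :=
  if len is len'.+1 then
    gpair a b (N - k) k (v + len'%:R) l * chain a b N v len' (k + a - b) (l - wt R b)
  else 1.

Lemma chain_mero a b N v len k : meromorphic (chain a b N v len k).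
Proof.
elim: len k => [|len IH] k; first exact: meromorphic_cst.
by apply: meromorphicM; [exact: gpair_mero|exact: (meromorphic_shift _ (IH _))].
Qed.

Definition Lprod (a b : bool) (m len : nat) (w : C) : EW :=
  \prod_(e <- rev (index_iota m (m + len))) Lgen EW a b (q2 q e%:R * w).

Lemma pair_chain a b m len w v Y N k j z g : W w -> Z z -> w / z = q2 q v ->
  (forall i : int, br (v + i%:~R) != 0) -> (k <= N)%N ->
  P (Lprod a b m len w * Y) (word EZ (stdw N k) j z) g =
  toM (chain a b N (v + m%:R) len k) *
    Tshift (- (len%:R * wt R b)) (P Y (word EZ (stdw N (k + len * a - len * b)) j z) g).
Proof.
move=> Ow Oz zE v_nz; elim: len k => [|len IH] k kN.
  by rewrite /Lprod addn0 /index_iota subnn big_nil mul1r !mul0n addn0 subn0 mul0r oppr0 Tshift0 toM1 mul1r.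
rewrite /Lprod addnS index_iotaS ?leq_addr // big_cons -mulrA.
have zE' : q2 q (m + len)%:R * w / z = q2 q (v + m%:R + len%:R).
  by rewrite -mulrA zE -q2D natrD addrC addrA.
have v_nz' (i : nat) : br (v + m%:R + len%:R + 1 - i%:R) != 0.
  have -> : v + m%:R + len%:R + 1 - i%:R = v + (m%:Z + len%:Z + 1 - i%:Z)%:~R.
    by rewrite !(rmorphB, rmorphD) /=; ring.
  exact: v_nz.
rewrite (pair_L_std _ _ _ _ _ (q2_iter hW _ Ow) Oz zE' v_nz' kN).
have [/andP[c1 c2]|nc] := boolP ((b <= k + a) && (k + a - b <= N))%N; last first.
  rewrite (_ : gpair a b (N - k) k _ = (fun=> 0)); last by apply/funext => l; exact: gpair_out.
  rewrite (_ : chain a b N _ len.+1 k = (fun=> 0)) ?toM0 ?mul0r //.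
  by apply/funext => l; rewrite /= gpair_out ?mul0r.
rewrite -/(Lprod a b m len w) (IH _ c2) TshiftM Tshift_comp Tshift_toM; last exact: chain_mero.
rewrite mulrA -toMM; last 2 first.
- exact: gpair_mero.
- exact: (meromorphic_shift _ (chain_mero _ _ _ _ _ _)).
congr (_ * Tshift _ _).
  by rewrite -natr1; ring.
by congr (P Y (word EZ (stdw N _) j z) g); move: c1; case: (a); case: (b) => /=; lia.
Qed.

End Chains.

Section ChainProducts.
Variables (R : realType) (q p : R).
Hypotheses (hp : 0 < p < 1).
Local Notation C := (Cx R).
Local Notation br := (br q p).
Local Notation pb := (pb q p).
Local Notation gpair := (gpair q p).
Local Notation chain := (chain q p).

Lemma chain_gamma N v a k l : chain false true N v a k l =
  pb (k%:R - a%:R + 1) a * pb (l + v + 2 - k%:R) a / (pb (v + 1) a * pb (l + 2 - a%:R) a).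
Proof.
elim: a k l => [|a IH] k l; first by rewrite !pb0 !mulr1 divr1.
rewrite /= IH /gpair /wt; case: k => [|k].
  rewrite [pb (0 - _ + 1) _.+1]pbS br0 // !mul0r.
  have -> : 0 - a.+1%:R + 1 + a%:R = 0 :> C by rewrite -natr1; ring.
  by rewrite br0 // mulr0 !mul0r.
rewrite addn0 subn1 /= !pbS -[k.+1%:R]natr1 -[a.+1%:R]natr1.
have -> : k%:R + 1 - (a%:R + 1) + 1 = k%:R - a%:R + 1 :> C by ring.
have -> : k%:R - a%:R + 1 + a%:R = k%:R + 1 :> C by ring.
have -> : l - 1 + v + 2 - k%:R = l + v + 2 - (k%:R + 1) by ring.
have -> : l + v + 2 - (k%:R + 1) + a%:R = l + (v + a%:R + 2 - (k%:R + 1)) by ring.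
have -> : l + 2 - (a%:R + 1) = l - 1 + 2 - a%:R by ring.
have -> : l - 1 + 2 - a%:R + a%:R = l + 1 by ring.
have -> : v + a%:R + 1 = v + 1 + a%:R by ring.
by rewrite !invfM; ring.
Qed.

Lemma chain_delta N v d k l : chain false false N v d k l =
  pb (v + 1 - k%:R) d * pb (l + 1 - k%:R) d / (pb (v + 1) d * pb (l + 1) d).
Proof.
elim: d l => [|d IH] l; first by rewrite !pb0 !mulr1 divr1.
rewrite /= addn0 subn0 IH /gpair /wt [pb (v + 1 - _) _.+1]pbS [pb (v + 1) _.+1]pbS [pb (l + 1) _]pbSl [pb (l + 1 - _) _.+1]pbSl.
have -> : v + d%:R + 1 = v + 1 + d%:R by ring.
have -> : v + d%:R - k%:R + 1 = v + 1 - k%:R + d%:R by ring.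
have -> : l + (1 - k%:R) = l + 1 - k%:R by ring.
have -> : l - -1 + 1 - k%:R = l + 1 - k%:R + 1 by ring.
have -> : l - -1 + 1 = l + 1 + 1 by ring.
by rewrite !invfM; ring.
Qed.

Lemma chain_alpha N v d k l : chain true true N v d k l =
  pb (v + 1 - (N - k)%:R) d * pb (l + (N - k)%:R + 2 - d%:R) d / (pb (v + 1) d * pb (l + 2 - d%:R) d).
Proof.
elim: d l => [|d IH] l; first by rewrite !pb0 !mulr1 divr1.
rewrite /= addnK IH /gpair /wt !pbS -[d.+1%:R]natr1.
have -> : v + d%:R + 1 = v + 1 + d%:R by ring.
have -> : v + d%:R - (N - k)%:R + 1 = v + 1 - (N - k)%:R + d%:R by ring.
have -> : l + (N - k)%:R + 2 - (d%:R + 1) = l - 1 + (N - k)%:R + 2 - d%:R by ring.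
have -> : l - 1 + (N - k)%:R + 2 - d%:R + d%:R = l + ((N - k)%:R + 1) by ring.
have -> : l + 2 - (d%:R + 1) = l - 1 + 2 - d%:R by ring.
have -> : l - 1 + 2 - d%:R + d%:R = l + 1 by ring.
by rewrite !invfM; ring.
Qed.

Lemma chain_beta N v d k l : chain true false N v d k l =
  pb ((N - k)%:R - d%:R + 1) d * pb (l + (N - k)%:R - v - d%:R + 1) d / (pb (v + 1) d * pb (l + 1) d).
Proof.
elim: d k l => [|d IH] k l; first by rewrite !pb0 !mulr1 divr1.
rewrite /= IH /gpair /wt addn1 subn0 subnS; case: (N - k)%N => [|n] /=.
  rewrite [pb (0 - _ + 1) _.+1]pbS br0 // !mul0r.
  have -> : 0 - d.+1%:R + 1 + d%:R = 0 :> C by rewrite -natr1; ring.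
  by rewrite br0 // mulr0 !mul0r.
rewrite -[n.+1%:R]natr1 -[d.+1%:R]natr1 [pb (l + 1) _]pbSl [pb (v + 1) _.+1]pbS.
have -> : n%:R + 1 - (d%:R + 1) + 1 = n%:R - d%:R + 1 :> C by ring.
rewrite [pb (n%:R - d%:R + 1) _.+1]pbS.
have -> : l + (n%:R + 1) - v - (d%:R + 1) + 1 = l + (n%:R + 1 - (v + d%:R)) by ring.
rewrite [pb (l + (n%:R + 1 - (v + d%:R))) _]pbSl.
have -> : n%:R - d%:R + 1 + d%:R = n%:R + 1 :> C by ring.
have -> : l + (n%:R + 1 - (v + d%:R)) + 1 = l - -1 + n%:R - v - d%:R + 1 by ring.
have -> : l - -1 + 1 = l + 1 + 1 by ring.
have -> : v + d%:R + 1 = v + 1 + d%:R by ring.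
by rewrite !invfM; ring.
Qed.

End ChainProducts.

(** * The pairing of matrix elements as a single sum *)

Section PairingOfMatrixElements.
Variables (R : realType) (q p : R).
Hypotheses (hq : 0 < q < 1) (hp : 0 < p < 1).
Local Notation C := (Cx R).
Local Notation M := (Mer R).
Local Notation br := (br q p).
Local Notation pb := (pb q p).
Local Notation gpair := (gpair q p).
Local Notation chain := (chain q p).
Hypothesis brn : forall i, (0 < i)%N -> br i%:R != 0.
Hypothesis brm : forall c, meromorphic (fun l => br (l + c)).
Hypothesis bra : forall c, ae (fun l => br (l + c) != 0).
Variables (W Z : set C) (EW : ellipticU2 q p W) (EZ : ellipticU2 q p Z).
Hypotheses (hW : spectral_domain q W) (hZ : spectral_domain q Z).
Variable P : cop EW -> EZ -> oper R.
Hypothesis hP : is_cobraiding P.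
Let hPp := cobraiding_pairing hP.

Lemma epsD (A : hBialgebroid R) (a b : A) g : eps (a + b) g = eps a g + eps b g.
Proof.
rewrite -[a in LHS]scale1r eps_lin /mulop constM1.
have -> (u v : oper R) : (u + v) g = u g + v g by [].
by rewrite /= mul1r.
Qed.

Lemma eps_word xs j z g : Z z -> eps (word EZ xs j z) g =
  if count_mem true xs == j then Tshift (- wsum R (size xs) j) g else 0.
Proof.
elim: xs j z => [|x xs IH] j z Oz.
  rewrite /= eq_sym; case: j => [|j] /=.
    by rewrite eps_1 /wsum muln0 subrr oppr0 Tshift0.
  by apply: (addIr (eps (0 : EZ) g)); rewrite -epsD addr0 add0r.
have Oz' : Z (q2 q 1 * z) by case: (hZ Oz).
have e0 : eps (0 : EZ) g = 0.
  by apply: (addIr (eps (0 : EZ) g)); rewrite -epsD addr0 add0r.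
rewrite /= epsD eps_M (eps_L EZ _ _ Oz) /= IH //.
have -> : eps (if j is j'.+1 then Lgen EZ x true z * word EZ xs j' (q2 q 1 * z) else 0) g =
   if j is j'.+1 then (if x == true then Tshift (- wt R x) else 0)
     (if count_mem true xs == j' then Tshift (- wsum R (size xs) j') g else 0) else 0.
  by case: j => [|j] //; rewrite eps_M (eps_L EZ _ _ Oz) /= IH.
case: x => /=.
  have -> (h : M) : (0 : oper R) h = 0 by [].
  rewrite add0r; case: j => [|j] //=; rewrite add1n eqSS; case: ifP => _; last exact: Tshift_0.
  by rewrite Tshift_comp; congr (Tshift _ g); rewrite /wsum -natr1 mulnS natrD; ring.
have -> : (if j is j'.+1 then (0 : oper R)
   (if count_mem true xs == j' then Tshift (- wsum R (size xs) j') g else 0) else 0) = 0 by case: j.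
rewrite addr0 add0n; case: ifP => _; last exact: Tshift_0.
by rewrite Tshift_comp; congr (Tshift _ g); rewrite /wsum -natr1 ; ring.
Qed.

(** The factors come from the blocks of gammas, deltas, alphas and betas in this
order; k and the dynamical parameter of each block record the effect of the
previous blocks. *)
Definition pairing_term (Mm N r s k : nat) (v : C) (l : nat) (x : C) : C :=
  binc q p (Mm - r) (s - l) x * binc q p r l (x - wsum R (Mm - r) (s - l)) *
  (chain false true N (v + (Mm + l - s - r)%:R) (s - l) k x *
  (chain false false N v (Mm + l - s - r) (k - (s - l)) (x - (s - l)%:R) *
  (chain true true N (v + (Mm - l)%:R) l (k - (s - l)) (x - (s - l)%:R + (Mm + l - s - r)%:R) *
   chain true false N (v + (Mm - r)%:R) (r - l) (k - (s - l))
     (x - (s - l)%:R + (Mm + l - s - r)%:R - l%:R)))).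

Lemma pairing_term_mero Mm N r s k v l : meromorphic (pairing_term Mm N r s k v l).
Proof.
apply: meromorphicM; first apply: meromorphicM.
- exact: binc_mero.
- exact: (meromorphic_shift _ (binc_mero _ _ _ _)).
have sh c d m f : meromorphic f -> meromorphic (fun x : C => f (x - c + d - m) : C).
  by move=> mf; have := meromorphic_shift (- c + d - m) mf; rewrite /= ; under eq_fun do rewrite !addrA.
have sh1 c f : meromorphic f -> meromorphic (fun x : C => f (x - c) : C) by apply: meromorphic_shift.
have sh2 c d f : meromorphic f -> meromorphic (fun x : C => f (x - c + d) : C).
  by move=> mf; have := meromorphic_shift (- c + d) mf; under eq_fun do rewrite !addrA.
have mc := chain_mero brm bra.
by apply: meromorphicM; [|apply: meromorphicM; [|apply: meromorphicM]];
  [exact: mc|exact/sh1/mc|exact/sh2/mc|exact/sh/mc].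
Qed.

Lemma pb_zero x t n : (t < n)%N -> x + t%:R = 0 -> pb x n = 0.
Proof.
move=> tn x0; rewrite /(pb _ _) (bigD1 (Ordinal tn)) //= x0 br0 // mul0r //.
Qed.

(** The factor [0] occurs. *)
Lemma pb_gap k a : (k < a)%N -> pb (k%:R - a%:R + 1) a = 0.
Proof.
move=> ka; apply: (@pb_zero _ (a - k.+1)); first by lia.
by rewrite natrB // -natr1; ring.
Qed.

Lemma pairing_term_zero Mm N r s k v l x : (k <= N)%N -> (s - l <= k)%N = false \/ (k - (s - l) + (r - l) <= N)%N = false ->
  pairing_term Mm N r s k v l x = 0.
Proof.
move=> kN; rewrite /pairing_term chain_gamma // chain_beta //.
move=> [/negbT|/negbT]; rewrite -ltnNge => h.
  by rewrite pb_gap // !mul0r mulr0.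
by rewrite [pb ((N - _)%:R - _ + 1) _]pb_gap ?mul0r ?mulr0 //; lia.
Qed.

Lemma toM_shift_mul (f g : C -> C) (a b : C) (h : M) : meromorphic f -> meromorphic g ->
  toM f * Tshift a (toM g * Tshift b h) = toM (fun x => f x * g (x + a)) * Tshift (a + b) h.
Proof.
move=> mf mg; rewrite (TshiftM a (toM g)) (Tshift_toM a mg) mulrA Tshift_comp toMM //.
exact: meromorphic_shift.
Qed.

Lemma chain_compose (f0 f1 f2 f3 f4 : C -> C) (a1 a2 a3 a4 : C) (h : M) :
  meromorphic f0 -> meromorphic f1 -> meromorphic f2 -> meromorphic f3 -> meromorphic f4 ->
  toM f0 * (toM f1 * Tshift a1 (toM f2 * Tshift a2 (toM f3 * Tshift a3 (toM f4 * Tshift a4 h)))) =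
  toM (fun x => f0 x * (f1 x * (f2 (x + a1) * (f3 (x + (a1 + a2)) * f4 (x + (a1 + (a2 + a3))))))) *
  Tshift (a1 + (a2 + (a3 + a4))) h.
Proof.
move=> m0 m1 m2 m3 m4; have ms c f : meromorphic f -> meromorphic (fun x : C => f (x + c) : C).
  exact: meromorphic_shift.
rewrite (toM_shift_mul _ _ _ m3 m4).
have m34 := meromorphicM m3 (ms a3 _ m4).
rewrite (toM_shift_mul _ _ _ m2 m34).
have m24 := meromorphicM m2 (ms a2 _ m34).
rewrite (toM_shift_mul _ _ _ m1 m24).
have m14 := meromorphicM m1 (ms a1 _ m24).
rewrite mulrA -(toMM m0 m14); congr (toM _ * _); apply/funext => x.
by congr (_ * (_ * (_ * (f3 _ * f4 _)))); ring.
Qed.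

Lemma pair_tmat Mm N r s k j w z v g : W w -> Z z -> w / z = q2 q v ->
  (forall i : int, br (v + i%:~R) != 0) ->
  (r <= Mm)%N -> (s <= Mm)%N -> (k <= N)%N -> (j <= N)%N ->
  P (tmat EW Mm r s w) (tmat EZ N k j z) g =
  if (s + j == r + k)%N then
    toM (fun x => \sum_(r + s - Mm <= l < (minn r s).+1) pairing_term Mm N r s k v l x) *
    Tshift (N%:R + Mm%:R - 2 * s%:R - 2 * j%:R) g
  else 0.
Proof.
move=> Ow Oz zE v_nz rM sM kN jN.
rewrite (tmat_word hq hp brn brm bra EZ hZ Oz kN jN).
have pair_suml I (t : seq I) (X : I -> EW) a : P (\sum_(i <- t) X i) a g = \sum_(i <- t) P (X i) a g.
  by apply: (big_morph (fun X => P X a g)); [move=> X1 X2; exact: (pair_Dl hPp)|exact: (pair_0l hPp)].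
rewrite /tmat pair_suml.
suff term l : (r + s - Mm <= l < (minn r s).+1)%N ->
  P ((qbinom q p r l * qbinom q p (Mm - r) (s - l)) *:
    (momR EW (toM (fun m =>
       poch q p (q2 q (m + Mm%:R - r%:R - 2 * s%:R + l%:R + 2)) l
       / poch q p (q2 q (m + Mm%:R - 2 * s%:R + 2)) l
       * (poch q p (q2 q (m + l%:R - s%:R + 2)) (s - l)%N
          / poch q p (q2 q (m + Mm%:R - 2 * s%:R - r%:R + 2 * l%:R + 2)) (s - l)%N)))
     * (\prod_(e <- rev (index_iota (Mm + l - s - r) (Mm - r)))
          Lgen EW false true (q2 q e%:R * w))
     * (\prod_(e <- rev (index_iota 0 (Mm + l - s - r)))
          Lgen EW false false (q2 q e%:R * w))
     * (\prod_(e <- rev (index_iota (Mm - l) Mm))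
          Lgen EW true true (q2 q e%:R * w))
     * (\prod_(e <- rev (index_iota (Mm - r) (Mm - l)))
          Lgen EW true false (q2 q e%:R * w)))) (word EZ (stdw N k) j z) g =
  toM (pairing_term Mm N r s k v l) *
  if (s + j == r + k)%N then Tshift (N%:R + Mm%:R - 2 * s%:R - 2 * j%:R) g else 0.
  rewrite (eq_big_nat _ _ term) -mulr_suml; case: ifP => _; last by rewrite mulr0.
  congr (_ * _); elim: (index_iota _ _) => [|l t IH].
    by rewrite big_nil -toM0; congr toM; apply/funext => x; rewrite big_nil.
  rewrite big_cons IH -toMD.
  - by congr toM; apply/funext => x; rewrite big_cons.
  - exact: pairing_term_mero.
  - elim: (t) => [|l' t' IH'].
      by under eq_fun do rewrite big_nil; exact: meromorphic_cst.
    under eq_fun do rewrite big_cons.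
    by apply: meromorphicD => //; exact: pairing_term_mero.
move=> hl; rewrite (pair_Zl hPp).
have ls : (l <= s)%N by lia.
have lr : (l <= r)%N by lia.
set d := (Mm + l - s - r)%N.
have LE (a b : bool) m n len : (n = m + len)%N ->
    \prod_(e <- rev (index_iota m n)) Lgen EW a b (q2 q e%:R * w) = Lprod EW a b m len w.
  by move=> ->.
rewrite (LE _ _ _ _ (s - l)%N); last by lia.
rewrite (LE _ _ _ _ d) // (LE _ _ _ _ l); last by lia.
rewrite (LE _ _ _ _ (r - l)%N); last by lia.
set f := (fun m : C => _ / _ * (_ / _)).
rewrite -!mulrA -[Lprod EW true false _ _ _]mulr1.
set T := word EZ _ j z.
have momE Y h : P (momR EW (toM f) * Y) T h = toM f * P Y T h.
  exact: (congr1 (fun u : oper R => u h) (pair_momL hPp (toM f) Y T)).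
rewrite momE mulrA -toM_scale.
have -> : (fun m => qbinom q p r l * qbinom q p (Mm - r) (s - l) * f m) =
   (fun m => binc q p (Mm - r) (s - l) m * binc q p r l (m - wsum R (Mm - r) (s - l))).
  by apply/funext => m; exact: tmat_coef.
set cf := (fun m => _ * _).
have pc := pair_chain hq hp brn brm bra hW hZ hP.
rewrite /T (pc _ _ _ _ _ _ _ _ _ _ _ _ Ow Oz zE v_nz) // muln0 addn0 muln1.
set k1 := (k - (s - l))%N.
have k1N : (k1 <= N)%N by rewrite /k1; lia.
rewrite (pc _ _ _ _ _ _ _ _ _ _ _ _ Ow Oz zE v_nz) // muln0 addn0 subn0 addr0.
rewrite (pc _ _ _ _ _ _ _ _ _ _ _ _ Ow Oz zE v_nz) // muln1 addnK.
rewrite (pc _ _ _ _ _ _ _ _ _ _ _ _ Ow Oz zE v_nz) // muln1 muln0 subn0.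
rewrite (pair_1l hPp) chain_compose; last 5 first.
- by apply: meromorphicM; [exact: binc_mero|exact: (meromorphic_shift _ (binc_mero _ _ _ _))].
all: try exact: chain_mero.
set S := - _ + (- _ + (- _ - _)).
transitivity (toM (pairing_term Mm N r s k v l) * Tshift S (eps (word EZ (stdw N (k1 + (r - l))) j z) g)).
  congr (toM _ * _). apply/funext => x; rewrite /pairing_term -/d -/k1 /wt /cf; congr (_ * (_ * (_ * (_ * _)))).
  - by congr chain; ring.
  - by congr chain; ring.
  - by congr chain; ring.
have [c1|c1] := boolP (s - l <= k)%N; last first.
  by rewrite (_ : pairing_term _ _ _ _ _ _ _ = (fun=> 0)) ?toM0 ?mul0r //;
    apply/funext => x; apply: pairing_term_zero => //; left; exact: negbTE.
have [c2|c2] := boolP (k1 + (r - l) <= N)%N; last first.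
  by rewrite (_ : pairing_term _ _ _ _ _ _ _ = (fun=> 0)) ?toM0 ?mul0r //;
    apply/funext => x; apply: pairing_term_zero => //; right; exact: negbTE.
congr (_ * _).
rewrite eps_word // count_stdw // size_stdw //.
have -> : (k1 + (r - l) == j)%N = (s + j == r + k)%N by rewrite /k1; lia.
case: ifP => [/eqP jE|_]; last exact: Tshift_0.
rewrite Tshift_comp; congr (Tshift _ g).
rewrite /S /wt /wsum /d natrM !natrB ?natrD; [ring|lia..].
Qed.

End PairingOfMatrixElements.

(** * The summands of the series in brackets *)

(** Reduces an equality between products of powers q^2x to one between exponents. *)
Ltac argq casts :=
  rewrite -?q2N -?q2D -?q2N -?q2D; congr (Defs.q2 _ _); rewrite ?casts; ring.

Section SeriesInBrackets.
Variables (R : realType) (q p : R).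
Hypotheses (hq : 0 < q < 1) (hp : 0 < p < 1).
Local Notation C := (Cx R).
Local Notation br := (br q p).
Local Notation pb := (pb q p).
Local Notation q2 := (q2 q).
Local Notation qpow := (qpow q).
Local Notation poch := (poch q p).

Lemma pb_rev y n : pb (- y) n = (-1) ^+ n * pb (y - n%:R + 1) n.
Proof.
elim: n y => [|n IH] y; first by rewrite !pb0 mulr1.
rewrite pbSl pbS; have -> : - y + 1 = - (y - 1) by ring.
rewrite IH (brN q hp) exprS -natr1.
have -> : y - 1 - n%:R + 1 = y - (n%:R + 1) + 1 by ring.
have -> : y - (n%:R + 1) + 1 + n%:R = y by ring.
ring.
Qed.

(** The quadratic exponent of q for an arbitrary length m, as m = M - r - s may be
negative. *)
Definition pexp (m y : C) : C := m * y + m * (m - 1) / 2.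

Lemma poch_nat z y n : z = q2 y -> poch z (Posz n) = qpow (pexp n%:R y) * pb y n.
Proof.
move=> ->; rewrite pochE //; congr (qpow _ * _); rewrite /pexp; congr (_ + _).
have two : (2 : C) != 0 by rewrite pnatr_eq0.
elim: n => [|n IH]; first by rewrite bin_small // !mul0r.
rewrite binS bin1 natrD IH -[n.+1%:R]natr1; by field.
Qed.

(** Writing a symbol of length d - l as a quotient of symbols of nonnegative
length treats both signs of d - l at once. *)
Lemma poch_int z y (d l : nat) : z = q2 y -> pb (y + d%:R - l%:R) l != 0 ->
  poch z (d%:Z - l%:Z) = qpow (pexp (d%:R - l%:R) y) * (pb y d / pb (y + d%:R - l%:R) l).
Proof.
move=> zE nz; have [ld|/ltnW dl] := leqP l d.
  rewrite subzn // (poch_nat _ zE) natrB //; congr (_ * _).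
  apply: (mulIf nz); rewrite mulfVK // -[in RHS](subnK ld) pbD natrB //.
  by rewrite addrA.
have [e eE] : exists e, l = (d + e)%N by exists (l - d)%N; rewrite subnKC.
rewrite {}eE in dl nz *.
have dE : y + d%:R - (d + e)%:R = y - e%:R by rewrite natrD; ring.
have eE : d%:R - (d + e)%:R = - e%:R :> C by rewrite natrD; ring.
have -> : d%:Z - (d + e)%N%:Z = - e%:Z by rewrite PoszD; ring.
rewrite dE in nz *; rewrite eE.
move: nz; rewrite addnC pbD subrK => nz.
have nz1 : pb y d != 0 by apply: contra_neq nz => ->; rewrite mulr0.
have nz2 : pb (y - e%:R) e != 0 by apply: contra_neq nz => ->; rewrite mul0r.
have -> : pb y d / (pb (y - e%:R) e * pb y d) = (pb (y - e%:R) e)^-1.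
  by field; rewrite nz1 nz2.
case: e {dl dE eE nz} nz2 => [|e] nz2.
  by rewrite /= big_ord0 pb0 invr1 mulr1 /pexp oppr0 !mul0r addr0 qpow0.
have -> : poch z (- e.+1%:Z) = (poch (z * q2 (- e.+1%:R)) (Posz e.+1))^-1 by [].
rewrite (@poch_nat _ (y - e.+1%:R)); last by rewrite zE q2D.
rewrite invfM -qpowN; congr (qpow _ * _); rewrite /pexp.
have two : (2 : C) != 0 by rewrite pnatr_eq0.
by field.
Qed.

(** A shifted factorial is Q up to a weight w, which stays abstract: the weights of
all factors of a summand are multiplied and seen to cancel only at the end. *)
Definition bracketed (z y : C) (n : nat) (Q : C) : Prop :=
  exists2 w, w = qpow (pexp n%:R y) & poch z (Posz n) = w * Q.

Definition bracketedZ (z y : C) (d l : nat) (Q : C) : Prop :=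
  exists2 w, w = qpow (pexp (d%:R - l%:R) y) & poch z (d%:Z - l%:Z) = w * Q.

Lemma poch_bracketed z y n Q : z = q2 y -> pb y n = Q -> bracketed z y n Q.
Proof. by move=> zE <-; exists (qpow (pexp n%:R y)); rewrite ?(poch_nat _ zE). Qed.

Lemma poch_bracketedZ z y d l Q1 Q2 : z = q2 y -> Q2 != 0 ->
  pb y d = Q1 -> pb (y + d%:R - l%:R) l = Q2 -> bracketedZ z y d l (Q1 / Q2).
Proof.
move=> zE Q20 <- e2; exists (qpow (pexp (d%:R - l%:R) y)) => //.
by rewrite (poch_int zE) e2.
Qed.

(** The multiplicative identity behind the comparison of the two summands. The
variables stand for shifted factorials in brackets, apart from the brackets a0
and a2 and the signs sd, sl, sb. The last three hypotheses say that products
of adjacent shifted factorials can be split at two different places. *)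
Lemma matching_algebra (A1 A2 B1 B2 C1 C2 C3 C4 D1 D2 D3 D4 E1 E2 F1 F2 K1 K2 K3 K4
    L1 L2 L3 L4 X1 X2 a0 a2 g1 g2 h1 h2 h3 h4 n_1 n_2 v1 v2 v3 y1 y2 sd sl sb : C) :
  A1 != 0 -> A2 != 0 -> B1 != 0 -> B2 != 0 -> C1 != 0 -> C2 != 0 -> C3 != 0 -> C4 != 0 ->
  D1 != 0 -> D2 != 0 -> D3 != 0 -> D4 != 0 -> K2 != 0 -> L2 != 0 -> X1 != 0 -> X2 != 0 ->
  a0 != 0 -> a2 != 0 ->
  g1 != 0 -> h1 != 0 -> h2 != 0 -> h3 != 0 -> n_2 != 0 -> v1 != 0 -> v2 != 0 -> v3 != 0 ->
  y1 != 0 -> sd ^+ 2 = 1 -> sl ^+ 2 = 1 -> sb ^+ 2 = 1 ->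
  a2 * D1 * D3 * D4 * C4 = a0 * D2 * C1 * C3 ->
  K1 * K3 = K2 * K4 -> L3 * L1 = L4 * L2 ->
  sd * sl * ((g1 * g2) / ((h1 * h2) * (C1 * (v2 * v3)))) *
  ((n_1 * n_2) * (sb * sl * (y1 * y2)) / ((sb * sl * (A1 * A2)) * (B1 * B2))) *
  ((sd * K1 / (sl * K2)) * (L1 / L2) / ((D2 / D3) * (v1 / v2))) *
  (a2 / a0 * (A1 * ((sl * h4) * ((sl * h2) * (F1 * ((sl * L3) * F2)))) /
     (h3 * (C2 * (C3 * ((sl * n_2) * (g1 * y1)))))) *
   (D1 * K3) * (E1 * E2)) =
  E1 / h1 * (X1 / C4) * (h4 / h3 * (X2 / C2)) *
  ((E2 * g2 / (v3 * X1)) * ((L4 * K4 / (v1 * D4)) * ((F2 * F1 / (B2 * X2)) *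
   (n_1 * y2 / (B1 * A2))))).
Proof.
move=> A1n A2n B1n B2n C1n C2n C3n C4n D1n D2n D3n D4n K2n L2n X1n X2n a0n a2n
  g1n h1n h2n h3n n2n v1n v2n v3n y1n sd1 sl1 sb1 eD eK eL.
have sdn : sd != 0 by apply/eqP => z; move/eqP: sd1; rewrite z expr0n eq_sym oner_eq0.
have sln : sl != 0 by apply/eqP => z; move/eqP: sl1; rewrite z expr0n eq_sym oner_eq0.
have sbn : sb != 0 by apply/eqP => z; move/eqP: sb1; rewrite z expr0n eq_sym oner_eq0.
have -> : K4 = K1 * K3 / K2 by rewrite eK mulrC mulKf.
have -> : L4 = L3 * L1 / L2 by rewrite eL mulfK.
have -> : a2 = a0 * D2 * C1 * C3 / (D1 * D3 * D4 * C4).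
  by rewrite -eD; field; rewrite D1n D3n D4n C4n.
have e : sd ^+ 2 * sl ^+ 2 = 1 by rewrite sd1 sl1 mulr1.
rewrite -[RHS]mul1r -[X in _ = X * _]e.
by field; rewrite ?(A1n, A2n, B1n, B2n, C1n, C2n, C3n, C4n, D1n, D2n, D3n, D4n, K2n,
  L2n, X1n, X2n, a0n, a2n, g1n, h1n, h2n, h3n, n2n, v1n, v2n, v3n, y1n, sdn, sln, sbn).
Qed.

Hypothesis brn : forall i, (0 < i)%N -> br i%:R != 0.
Hypothesis brm : forall c, meromorphic (fun l => br (l + c)).
Hypothesis bra : forall c, ae (fun l => br (l + c) != 0).

Lemma poch_add z m n : poch z (Posz (m + n)) = poch z (Posz m) * poch (z * q2 m%:R) (Posz n).
Proof.
rewrite /Defs.poch big_split_ord; congr (_ * _); apply: eq_bigr => i _ /=.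
by rewrite natrD q2D mulrA.
Qed.

Local Opaque Defs.poch.

Definition series_term (M N r s k : nat) (u x : C) (n : nat) : C :=
  Cfactor0 q p M N r s k u x *
  (V_term q p (q2 (x + M%:R - 2 * s%:R - r%:R + 1))
    [:: q2 (- r%:R); q2 (- s%:R); q2 (x + M%:R + N%:R - k%:R - s%:R - r%:R + 2);
        q2 (k%:R - s%:R) / u; q2 (M%:R - N%:R + k%:R - s%:R + 1) * u] n *
   pochs q p [:: q2 (x - s%:R + 1); q2 (x + M%:R - k%:R - s%:R - r%:R + 1)] n *
   pochs q p [seq q2 1 * q2 (x + M%:R - 2 * s%:R - r%:R + 1) / d * q2 n%:R |
      d <- [:: q2 (x - s%:R + 1); q2 (x + M%:R - k%:R - s%:R - r%:R + 1)]] (s%:Z - n%:Z)).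

(** Here d, a, b are the lengths of the blocks of deltas, gammas and betas in the
l-th monomial. In these variables all shifted factorials of the series split at
the ends of the blocks, and reversing those with negative argument only
produces signs. *)
Lemma series_term_br (a b d l n1 k N M r s : nat) (v : C) :
  M = (d + a + b + l)%N -> r = (b + l)%N -> s = (a + l)%N -> (k + n1 = N + a)%N ->
  (forall i : int, br (v + i%:~R) != 0) ->
  ae (fun x => series_term M N r s k (q2 v) x l =
    pb (d%:R + 1) a / pb 1 a *
    (pb (x + (2 - a%:R)) a / pb (x + (d%:R - a%:R + 2)) a) *
    (pb (b%:R + 1) l / pb 1 l *
     (pb (x + (d%:R - a%:R + 2 - l%:R)) l /
      pb (x + (d%:R + b%:R - a%:R - l%:R + 2)) l)) *
  ((pb (k%:R - a%:R + 1) a * pb (x + (v + d%:R - k%:R + 2)) a /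
      (pb (v + (d%:R + 1)) a * pb (x + (2 - a%:R)) a)) *
    ((pb (v + (a%:R - k%:R + 1)) d * pb (x + (1 - k%:R)) d /
      (pb (v + 1) d * pb (x + (1 - a%:R)) d)) *
    ((pb (v + (d%:R + a%:R + b%:R - n1%:R + 1)) l * pb (x + (d%:R - l%:R + n1%:R - a%:R + 2)) l /
      (pb (v + (d%:R + a%:R + b%:R + 1)) l * pb (x + (d%:R - a%:R + 2 - l%:R)) l)) *
   (pb (n1%:R - b%:R + 1) b * pb (x + (n1%:R - 2 * a%:R - l%:R - b%:R - v + 1)) b /
      (pb (v + (d%:R + a%:R + 1)) b * pb (x + (d%:R - a%:R - l%:R + 1)) b)))))).
Proof.
move=> M_def r_def s_def N_def hv.
have ME : M%:R = d%:R + a%:R + b%:R + l%:R :> C by rewrite M_def !natrD.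
have rE : r%:R = b%:R + l%:R :> C by rewrite r_def natrD.
have sE : s%:R = a%:R + l%:R :> C by rewrite s_def natrD.
have NE : N%:R = k%:R + n1%:R - a%:R :> C by rewrite -natrD N_def natrD addrK.
have casts := (ME, NE, rE, sE).
have pb_ae := pb_ae bra.
(* The factors depending on x that are cancelled are generically nonzero. *)
apply: ae_impl
  (ae_and (pb_ae (d%:R - a%:R - 2 * l%:R + 1) l)
  (ae_and (pb_ae (d%:R - a%:R - l%:R + 1) b)
  (ae_and (pb_ae (d%:R - a%:R - 2 * l%:R + 2) (a + l))
  (ae_and (pb_ae (d%:R + b%:R - a%:R - l%:R + 2) l)
  (ae_and (pb_ae (d%:R - l%:R + 2) l)
  (ae_and (pb_ae (d%:R - a%:R + 2) a)
  (ae_and (pb_ae (1 - a%:R - l%:R) l)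
  (ae_and (pb_ae (1 - a%:R - l%:R) d)
  (ae_and (pb_ae (1 - a%:R - 2 * l%:R + d%:R) l)
  (ae_and (pb_ae (1 - a%:R) d)
  (ae_and (pb_ae (1 - l%:R - k%:R) l)
  (ae_and (pb_ae (2 - a%:R) a)
  (ae_and (pb_ae (d%:R - a%:R + 2 - l%:R) l)
  (ae_and (pb_ae (v + d%:R - l%:R - k%:R + 2) l)
  (ae_and (pb_ae (n1%:R - 2 * a%:R - 2 * l%:R - b%:R - v + 1) l)
  (ae_and (bra (d%:R - a%:R - 2 * l%:R + 1)) (bra (d%:R - a%:R + 1)))))))))))))))))) => x.
pose g1 := pb (x + (v + d%:R - l%:R - k%:R + 2)) l. pose g2 := pb (x + (v + d%:R - k%:R + 2)) a.
pose h1 := pb 1 a. pose h2 := pb (1 + a%:R) l. pose h3 := pb 1 l. pose h4 := pb (b%:R + 1) l.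
pose C1 := pb (x + (d%:R - a%:R - 2 * l%:R + 2)) (a + l).
pose C2 := pb (x + (d%:R + b%:R - a%:R - l%:R + 2)) l. pose C3 := pb (x + (d%:R - l%:R + 2)) l.
pose C4 := pb (x + (d%:R - a%:R + 2)) a. pose v1 := pb (v + 1) d.
pose v2 := pb (v + (d%:R - l%:R + 1)) l. pose v3 := pb (v + (d%:R + 1)) a.
pose n_1 := pb (n1%:R - b%:R + 1) b. pose n_2 := pb (n1%:R + 1) l.
pose y1 := pb (x + (n1%:R - 2 * a%:R - 2 * l%:R - b%:R - v + 1)) l.
pose y2 := pb (x + (n1%:R - 2 * a%:R - l%:R - b%:R - v + 1)) b.
pose A1 := pb (x + (d%:R - a%:R - 2 * l%:R + 1)) l.
pose A2 := pb (x + (d%:R - a%:R - l%:R + 1)) b. pose B1 := pb (v + (d%:R + a%:R + 1)) b.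
pose B2 := pb (v + (d%:R + a%:R + b%:R + 1)) l. pose K1 := pb (x + (1 - l%:R - k%:R)) d.
pose K2 := pb (x + (1 - l%:R - k%:R)) l. pose K3 := pb (x + (d%:R - l%:R - k%:R + 1)) l.
pose K4 := pb (x + (1 - k%:R)) d. pose L1 := pb (v + (a%:R + l%:R - k%:R + 1)) d.
pose L2 := pb (v + (a%:R - k%:R + 1 + d%:R)) l. pose L3 := pb (v + (a%:R - k%:R + 1)) l.
pose L4 := pb (v + (a%:R - k%:R + 1)) d. pose D1 := pb (x + (1 - a%:R - l%:R)) l.
pose D2 := pb (x + (1 - a%:R - l%:R)) d. pose D3 := pb (x + (1 - a%:R - 2 * l%:R + d%:R)) l.
pose D4 := pb (x + (1 - a%:R)) d. pose F1 := pb (x + (d%:R - l%:R + n1%:R - a%:R + 2)) l.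
pose F2 := pb (v + (d%:R + a%:R + b%:R - n1%:R + 1)) l. pose E1 := pb (d%:R + 1) a.
pose E2 := pb (k%:R - a%:R + 1) a. pose X1 := pb (x + (2 - a%:R)) a.
pose X2 := pb (x + (d%:R - a%:R + 2 - l%:R)) l.
pose a0 := br (x + (d%:R - a%:R - 2 * l%:R + 1)); pose a2 := br (x + (d%:R - a%:R + 1)).
pose sd : C := (-1) ^+ d; pose sl : C := (-1) ^+ l; pose sb : C := (-1) ^+ b.
move=> [A1n [A2n [C1n [C2n [C3n [C4n [D1n [D2n [D3n [D4n [K2n [X1n [X2n [g1n [y1n [a0n a2n]]]]]]]]]]]]]]]].
have s0 n : (-1) ^+ n != 0 :> C by rewrite signr_eq0.
have sl0 : sl != 0 by exact: s0.
have pbv (i : int) y n : y = v + i%:~R -> pb y n != 0.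
  by move=> ->; apply: pb_neq0 => t _; have := hv (i + t%:Z); rewrite rmorphD /= addrA.
have pbn (i : nat) y n : y = i.+1%:R -> pb y n != 0.
  by move=> ->; apply: pb_neq0 => t _; rewrite -natrD brn.
have v1n : v1 != 0 by apply: (@pbv (1)); rewrite ?(rmorphB, rmorphD) /=; ring.
have v2n : v2 != 0 by apply: (@pbv (d%:Z - l%:Z + 1)); rewrite ?(rmorphB, rmorphD) /=; ring.
have v3n : v3 != 0 by apply: (@pbv (d%:Z + 1)); rewrite ?(rmorphB, rmorphD) /=; ring.
have B1n : B1 != 0 by apply: (@pbv (d%:Z + a%:Z + 1)); rewrite ?(rmorphB, rmorphD) /=; ring.
have B2n : B2 != 0 by apply: (@pbv (d%:Z + a%:Z + b%:Z + 1)); rewrite ?(rmorphB, rmorphD) /=; ring.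
have L2n : L2 != 0 by apply: (@pbv (a%:Z - k%:Z + 1 + d%:Z)); rewrite ?(rmorphB, rmorphD) /=; ring.
have h1n : h1 != 0 by exact: (@pbn 0%N).
have h3n : h3 != 0 by exact: (@pbn 0%N).
have h2n : h2 != 0 by apply: (@pbn a); rewrite -natr1 addrC.
have n_2n : n_2 != 0 by apply: (@pbn n1); rewrite -natr1.
(* The shifted factorials of the prefactor, then those of the series, in the
   order of their occurrence. *)
have [w1 w1E p1] : bracketed (q2 (x + M%:R - s%:R - k%:R - r%:R + 2) * q2 v) (x + (v + d%:R - l%:R - k%:R + 2)) s (g1 * g2).
  by apply: poch_bracketed; [argq casts|rewrite s_def addnC pbD; congr (pb _ _ * pb _ _); ring].
have [w2 w2E p2] : bracketed (q2 1) (1) s (h1 * h2).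
  by apply: poch_bracketed; [argq casts|rewrite s_def pbD; congr (pb _ _ * pb _ _); ring].
have [w3 w3E p3] : bracketed (q2 (x + M%:R - 2 * s%:R - r%:R + 2)) (x + (d%:R - a%:R - 2 * l%:R + 2)) s (C1).
  by apply: poch_bracketed; [argq casts|by rewrite s_def].
have [w4 w4E p4] : bracketed (q2 (M%:R - r%:R - s%:R + 1) * q2 v) (v + (d%:R - l%:R + 1)) s (v2 * v3).
  by apply: poch_bracketed; [argq casts|rewrite s_def addnC pbD; congr (pb _ _ * pb _ _); ring].
have [w5 w5E p5] : bracketed (q2 (N%:R - k%:R + s%:R - r%:R + 1)) (n1%:R - b%:R + 1) r (n_1 * n_2).
  by apply: poch_bracketed; [argq casts|rewrite r_def pbD; congr (pb _ _ * pb _ _); ring].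
have [w6 w6E p6] : bracketed (q2 (- x - N%:R + k%:R + s%:R) * q2 v) (- (x + (n1%:R - 2 * a%:R - l%:R - v))) r (sb * sl * (y1 * y2)).
  by apply: poch_bracketed; [argq casts|rewrite r_def pb_rev exprD natrD addnC pbD; congr (_ * (pb _ _ * pb _ _)); ring].
have [w7 w7E p7] : bracketed (q2 (- (x + M%:R - 2 * s%:R))) (- (x + (d%:R + b%:R - a%:R - l%:R))) r (sb * sl * (A1 * A2)).
  by apply: poch_bracketed; [argq casts|rewrite r_def pb_rev exprD natrD addnC pbD; congr (_ * (pb _ _ * pb _ _)); ring].
have [w8 w8E p8] : bracketed (q2 (M%:R - r%:R + 1) * q2 v) (v + (d%:R + a%:R + 1)) r (B1 * B2).
  by apply: poch_bracketed; [argq casts|rewrite r_def pbD; congr (pb _ _ * pb _ _); ring].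
have [w9 w9E p9] : bracketedZ (q2 (k%:R + s%:R + r%:R - x - M%:R)) (- (x + (d%:R - l%:R - k%:R))) d l (sd * K1 / (sl * K2)).
  apply: poch_bracketedZ; [argq casts|by rewrite mulf_neq0| |].
    by rewrite pb_rev; congr (_ * pb _ _); ring.
  have -> : - (x + (d%:R - l%:R - k%:R)) + d%:R - l%:R = - (x - k%:R) by ring.
  by rewrite pb_rev; congr (_ * pb _ _); ring.
have [w10 w10E p10] : bracketedZ (q2 (s%:R - k%:R + 1) * q2 v) (v + (a%:R + l%:R - k%:R + 1)) d l (L1 / L2).
  by apply: poch_bracketedZ; [argq casts| | |congr (pb _ _); ring].
have [w11 w11E p11] : bracketedZ (q2 (x - s%:R + 1)) (x + (1 - a%:R - l%:R)) d l (D2 / D3).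
  by apply: poch_bracketedZ; [argq casts| | |congr (pb _ _); ring].
have [w12 w12E p12] : bracketedZ (q2 1 * q2 v) (v + 1) d l (v1 / v2).
  by apply: poch_bracketedZ; [argq casts| | |congr (pb _ _); ring].
have [w13 w13E p13] : bracketed (q2 (x + M%:R - 2 * s%:R - r%:R + 1)) (x + (d%:R - a%:R - 2 * l%:R + 1)) l (A1).
  by apply: poch_bracketed; [argq casts|].
have [w14 w14E p14] : bracketed (q2 (- r%:R)) (- (b%:R + l%:R)) l (sl * h4).
  by apply: poch_bracketed; [argq casts|by rewrite pb_rev; congr (_ * pb _ _); ring].
have [w15 w15E p15] : bracketed (q2 (- s%:R)) (- (a%:R + l%:R)) l (sl * h2).
  by apply: poch_bracketed; [argq casts|by rewrite pb_rev; congr (_ * pb _ _); ring].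
have [w16 w16E p16] : bracketed (q2 (x + M%:R + N%:R - k%:R - s%:R - r%:R + 2)) (x + (d%:R - l%:R + n1%:R - a%:R + 2)) l (F1).
  by apply: poch_bracketed; [argq casts|].
have [w17 w17E p17] : bracketed (q2 (k%:R - s%:R) / q2 v) (- (v + (a%:R + l%:R - k%:R))) l (sl * L3).
  by apply: poch_bracketed; [argq casts|by rewrite pb_rev; congr (_ * pb _ _); ring].
have [w18 w18E p18] : bracketed (q2 (M%:R - N%:R + k%:R - s%:R + 1) * q2 v) (v + (d%:R + a%:R + b%:R - n1%:R + 1)) l (F2).
  by apply: poch_bracketed; [argq casts|].
have [w19 w19E p19] : bracketed (q2 1) (1) l (h3).
  by apply: poch_bracketed; [argq casts|].
have [w20 w20E p20] : bracketed (q2 1 * q2 (x + M%:R - 2 * s%:R - r%:R + 1) / q2 (- r%:R)) (x + (d%:R + b%:R - a%:R - l%:R + 2)) l (C2).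
  by apply: poch_bracketed; [argq casts|].
have [w21 w21E p21] : bracketed (q2 1 * q2 (x + M%:R - 2 * s%:R - r%:R + 1) / q2 (- s%:R)) (x + (d%:R - l%:R + 2)) l (C3).
  by apply: poch_bracketed; [argq casts|].
have [w22 w22E p22] : bracketed (q2 1 * q2 (x + M%:R - 2 * s%:R - r%:R + 1) / q2 (x + M%:R + N%:R - k%:R - s%:R - r%:R + 2)) (- (l%:R + n1%:R)) l (sl * n_2).
  by apply: poch_bracketed; [argq casts|by rewrite pb_rev; congr (_ * pb _ _); ring].
have [w23 w23E p23] : bracketed (q2 1 * q2 (x + M%:R - 2 * s%:R - r%:R + 1) / (q2 (k%:R - s%:R) / q2 v)) (x + (v + d%:R - l%:R - k%:R + 2)) l (g1).
  by apply: poch_bracketed; [argq casts|].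
have [w24 w24E p24] : bracketed (q2 1 * q2 (x + M%:R - 2 * s%:R - r%:R + 1) / (q2 (M%:R - N%:R + k%:R - s%:R + 1) * q2 v)) (x + (n1%:R - 2 * a%:R - 2 * l%:R - b%:R - v + 1)) l (y1).
  by apply: poch_bracketed; [argq casts|].
have [w25 w25E p25] : bracketed (q2 (x - s%:R + 1)) (x + (1 - a%:R - l%:R)) l (D1).
  by apply: poch_bracketed; [argq casts|].
have [w26 w26E p26] : bracketed (q2 (x + M%:R - k%:R - s%:R - r%:R + 1)) (x + (d%:R - l%:R - k%:R + 1)) l (K3).
  by apply: poch_bracketed; [argq casts|].
have [w27 w27E p27] : bracketed (q2 1 * q2 (x + M%:R - 2 * s%:R - r%:R + 1) / q2 (x - s%:R + 1) * q2 l%:R) (d%:R + 1) a (E1).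
  by apply: poch_bracketed; [argq casts|].
have [w28 w28E p28] : bracketed (q2 1 * q2 (x + M%:R - 2 * s%:R - r%:R + 1) / q2 (x + M%:R - k%:R - s%:R - r%:R + 1) * q2 l%:R) (k%:R - a%:R + 1) a (E2).
  by apply: poch_bracketed; [argq casts|].

have sq n : ((-1) ^+ n) ^+ 2 = 1 :> C by rewrite sqrr_sign.
have relD : a2 * D1 * D3 * D4 * C4 = a0 * D2 * C1 * C3.
  pose D5 := pb (x + (1 - a%:R - l%:R + d%:R)) l.
  have e1 : D1 * D4 = D2 * D5.
    transitivity (pb (x + (1 - a%:R - l%:R)) (l + d)); last rewrite addnC.
      by rewrite pbD; congr (_ * pb _ _); ring.
    by rewrite pbD; congr (_ * pb _ _); ring.
  have e2 : D3 * D5 * a2 * C4 = a0 * C1 * C3.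
    pose y := x + (d%:R - a%:R - 2 * l%:R + 1).
    transitivity (pb y ((l + l).+1 + a)).
      rewrite pbD pbS pbD; congr (pb _ _ * pb _ _ * br _ * pb _ _); rewrite /y -?[(l + l).+1%:R]natr1 ?natrD; ring.
    have -> : ((l + l).+1 + a = (a + l).+1 + l)%N by rewrite !addSn addnC addnA.
    rewrite pbD pbSl; congr (_ * pb _ _ * pb _ _); rewrite /y -?[(a + l).+1%:R]natr1 ?natrD; ring.
  transitivity (D1 * D4 * (D3 * a2 * C4)); first by ring.
  by rewrite e1 -mulrA -[RHS]mulrA -[a0 * D2 * _]mulrA; transitivity (D2 * (D3 * D5 * a2 * C4)); [ring|rewrite e2; ring].
have relK : K1 * K3 = K2 * K4.
  transitivity (pb (x + (1 - l%:R - k%:R)) (d + l)); last rewrite addnC.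
    by rewrite pbD; congr (_ * pb _ _); ring.
  by rewrite pbD; congr (_ * pb _ _); ring.
have relL : L3 * L1 = L4 * L2.
  transitivity (pb (v + (a%:R - k%:R + 1)) (l + d)); last rewrite addnC.
    by rewrite pbD; congr (_ * pb _ _); ring.
  by rewrite pbD; congr (_ * pb _ _); ring.
rewrite -/A1 -/A2 -/B1 -/B2 -/C2 -/C4 -/D4 -/E1 -/E2 -/F1 -/F2 -/h1 -/h3 -/h4 -/g2 -/K4 -/L4 -/X1 -/X2 -/n_1 -/v1 -/v3 -/y2.
rewrite -(@matching_algebra A1 A2 B1 B2 C1 C2 C3 C4 D1 D2 D3 D4 E1 E2 F1 F2 K1 K2 K3 K4
  L1 L2 L3 L4 X1 X2 a0 a2 g1 g2 h1 h2 h3 h4 n_1 n_2 v1 v2 v3 y1 y2 sd sl sb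
  A1n A2n B1n B2n C1n C2n C3n C4n D1n D2n D3n D4n K2n L2n X1n X2n a0n a2n g1n h1n h2n h3n n_2n v1n v2n v3n y1n (sq d) (sq l) (sq b) relD relK relL).
have mE : M%:Z - r%:Z - s%:Z = d%:Z - l%:Z by rewrite M_def r_def s_def !PoszD; ring.
have snE : s%:Z - l%:Z = a%:Z by rewrite s_def PoszD; ring.
have mC : (d%:Z - l%:Z)%:~R = d%:R - l%:R :> C by rewrite rmorphB.
have sgnE : (-1) ^ (d%:Z - l%:Z) = sd * sl :> C.
  rewrite expfzDr ?oppr_eq0 ?oner_eq0 // -exprnN; congr (_ * _).
  by apply: (mulfI sl0); rewrite mulfV // -expr2 sq.
have [wa waE pa] : exists2 w, w = qpow (x + M%:R - 2 * s%:R - r%:R + 1 + 2 * l%:R) &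
    theta p (q2 (x + M%:R - 2 * s%:R - r%:R + 1) * q2 (2 * l%:R)) = w * a2.
  eexists; first reflexivity.
  by rewrite theta_brD; congr (_ * br _); rewrite ME rE sE; ring.
have [wb wbE p_b] : exists2 w, w = qpow (x + M%:R - 2 * s%:R - r%:R + 1) &
    theta p (q2 (x + M%:R - 2 * s%:R - r%:R + 1)) = w * a0.
  eexists; first reflexivity.
  by rewrite theta_br; congr (_ * br _); rewrite ME rE sE; ring.
have [w0 w0E p0] : exists2 w, w = qpow ((d%:R - l%:R) * (2 * (x - s%:R + 1) + (d%:R - l%:R - 1))) &
  qpow ((d%:R - l%:R) * (2 * (x - s%:R + 1) + (d%:R - l%:R - 1))) = w by eexists.
(* The total power of q in the term is 1. *)
have W1 : w0 * (w1 / (w2 * (w3 * w4)) * (w5 * w6 / (w7 * w8)) * (w9 * w10 / (w11 * w12)) * (wa / wb * (q2 l%:R * (w13 * (w14 * (w15 * (w16 * (w17 * w18)))) / (w19 * (w20 * (w21 * (w22 * (w23 * w24))))))) * (w25 * w26) * (w27 * w28))) = 1.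
  rewrite q2E w0E waE wbE w1E w2E w3E w4E w5E w6E w7E w8E w9E w10E w11E w12E w13E w14E w15E w16E w17E w18E w19E w20E w21E w22E w23E w24E w25E w26E w27E w28E.
  rewrite -!qpowD -!qpowN -!qpowD; apply: etrans (qpow0 q); congr (qpow _).
  have two : (2 : C) != 0 by rewrite pnatr_eq0.
  by rewrite /pexp ?casts; field.
clearbody sd sl sb A1 A2 B1 B2 C1 C2 C3 C4 D1 D2 D3 D4 E1 E2 F1 F2 K1 K2 K3 K4 L1 L2 L3 L4 X1 X2 a0 a2 g1 g2 h1 h2 h3 h4 n_1 n_2 v1 v2 v3 y1 y2.
rewrite /series_term /Cfactor0 /V_term /pochs mE snE mC sgnE p0 /= !big_cons !big_nil !mulr1.
rewrite pa p_b ?p1 ?p2 ?p3 ?p4 ?p5 ?p6 ?p7 ?p8 ?p9 ?p10 ?p11 ?p12 ?p13 ?p14 ?p15 ?p16 ?p17 ?p18 ?p19 ?p20 ?p21 ?p22 ?p23 ?p24 ?p25 ?p26 ?p27 ?p28.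
rewrite -[RHS]mul1r -[X in _ = X * _]W1.
move: (q2 l%:R) => ql; rewrite !invfM; ring.
Qed.

End SeriesInBrackets.

(** * The single sum and the series *)

Section SummandMatching.
Variables (R : realType) (q p : R).
Hypotheses (hq : 0 < q < 1) (hp : 0 < p < 1).
Local Notation C := (Cx R).
Local Notation br := (br q p).
Local Notation pb := (pb q p).
Local Notation q2 := (q2 q).
Local Notation poch := (poch q p).
Local Notation pochs := (pochs q p).
Local Notation series_term := (series_term q p).
Hypothesis brn : forall i, (0 < i)%N -> br i%:R != 0.
Hypothesis brm : forall c, meromorphic (fun l => br (l + c)).
Hypothesis bra : forall c, ae (fun l => br (l + c) != 0).

(** If s - l > k, both sides vanish; otherwise the two products of brackets agree
up to rewriting their arguments. *)
Lemma series_term_pairing_term M N r s k l (v : C) : (r <= M)%N -> (s <= M)%N -> (k <= N)%N ->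
  (r + s - M <= l < (minn r s).+1)%N -> (forall i : int, br (v + i%:~R) != 0) ->
  ae (fun x => series_term M N r s k (q2 v) x l = pairing_term q p M N r s k v l x).
Proof.
move=> rM sM kN hl hv.
have [a aE] : exists a, s = (a + l)%N by exists (s - l)%N; lia.
have [b bE] : exists b, r = (b + l)%N by exists (r - l)%N; lia.
have [d dE] : exists d, M = (d + a + b + l)%N by exists (M + l - s - r)%N; lia.
have [n1 nE] : exists n1, (k + n1 = N + a)%N by exists (N + a - k)%N; lia.
have e := series_term_br hp brn bra dE bE aE nE hv.
apply: ae_impl e => x ->.
have [ak|ka] := leqP a k; last first.
  rewrite pairing_term_zero //; last by left; rewrite aE addnK; apply/negbTE; rewrite -ltnNge.
  by rewrite (pb_gap hq hp ka) !(mul0r, mulr0).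
rewrite /pairing_term chain_gamma // chain_delta chain_alpha chain_beta // /binc /wsum.
have -> : (s - l = a)%N by lia.
have -> : (r - l = b)%N by lia.
have -> : (M + l - s - r = d)%N by lia.
have -> : (N - (k - a) = n1)%N by lia.
have -> : (M - r = d + a)%N by lia.
have -> : (M - l = d + a + b)%N by lia.
rewrite ?[(2 * a)%:R]natrM ?natrD ?natrB //.
have -> : r%:R = b%:R + l%:R :> C by rewrite bE natrD.
by congr (pb _ _ / _ * (_ / pb _ _) * (pb _ _ / _ * (pb _ _ / pb _ _)) *
  (_ * pb _ _ / (pb _ _ * pb _ _) * (pb _ _ * pb _ _ / (_ * pb _ _) *
   (pb _ _ * pb _ _ / (pb _ _ * pb _ _) * (_ * pb _ _ / (pb _ _ * pb _ _)))))); ring.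
Qed.

Lemma pochs_zero (z : C) (zs : seq C) n : z \in zs -> poch z n = 0 -> pochs zs n = 0.
Proof.
by elim: zs => // y zs IH; rewrite inE /Defs.pochs big_cons => /orP[/eqP <- ->|/IH h /h];
  [rewrite mul0r|rewrite /Defs.pochs => ->; rewrite mulr0].
Qed.

Lemma poch_neg_zero r n : (r < n)%N -> poch (q2 (- r%:R)) (Posz n) = 0.
Proof.
by move=> rn; rewrite (poch_nat p n erefl) // (pb_zero q hp rn) ?mulr0 // addNr.
Qed.

Lemma V_term_zero a1 bs r n : q2 (- r%:R) \in bs -> (r < n)%N -> V_term q p a1 bs n = 0.
Proof.
move=> rb rn; rewrite /V_term (@pochs_zero (q2 (- r%:R))); last exact: poch_neg_zero.
  by rewrite mulr0 mul0r mulr0.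
by rewrite inE rb orbT.
Qed.

Local Opaque Defs.poch.

(** The shifted factorial (q^(2(M-r-s+1+n)))_(s-n) contains theta(1). *)
Lemma series_term_zero_low M N r s k u x n : (r <= M)%N -> (n <= s)%N -> (n < r + s - M)%N ->
  series_term M N r s k u x n = 0.
Proof.
move=> rM ns nl; rewrite /(series_term _ _ _ _ _ _ _ _) [pochs [seq _ | _ <- _] _](@pochs_zero (q2 (M%:R - r%:R - s%:R + 1 + n%:R))).
- by rewrite !mulr0.
- rewrite inE; apply/orP; left; apply/eqP.
  by rewrite -q2N -!q2D; congr (q2 _); ring.
rewrite subzn // (poch_nat p _ erefl) (@pb_zero _ q _ hp _ (r + s - M - n.+1)) ?mulr0 //; first by lia.
rewrite natrB ?natrB ?natrD -?natr1; [ring|lia..].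
Qed.

Lemma fsbig_nat_trunc (F : nat -> C) K : (forall n, (K <= n)%N -> F n = 0) ->
  \sum_(n \in [set: nat]) F n = \sum_(0 <= n < K) F n.
Proof.
move=> F0; rewrite /index_iota subn0 (@fsbigE _ _ _ _ _ (iota 0 K)) ?iota_uniq // => [|i _].
  by apply: eq_bigl => i; rewrite in_setT.
by rewrite mem_iota add0n /= -leqNgt => /F0.
Qed.

Lemma CVseries_finite M N r s k u x : (r <= M)%N -> (s <= M)%N ->
  CVseries q p M N r s k u x = \sum_(r + s - M <= n < (minn r s).+1) series_term M N r s k u x n.
Proof.
move=> rM sM; rewrite /CVseries /Vseries_reg (@fsbig_nat_trunc _ (minn r s).+1); last first.
  move=> n hn; have [rn|sn] : (r < n)%N \/ (s < n)%N by lia.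
    by rewrite (@V_term_zero _ _ r) ?mul0r // inE eqxx.
  by rewrite (@V_term_zero _ _ s) ?mul0r // !inE eqxx orbT.
rewrite mulr_sumr (@big_cat_nat _ _ _ (r + s - M)%N) //=; last by lia.
by rewrite big_nat big1 ?add0r // => n hn; apply: (series_term_zero_low N k u x rM); lia.
Qed.

(** For r + s <= M and s <= k the symbols (q^(2(M-r-s+1)))_n and (q^(2(k-s+1)))_n do
not vanish, so that the two factors absorbed into the regularized series can
be divided out term by term. *)
Lemma CVseries_Vseries M N r s k u x : (r + s <= M)%N -> (s <= k)%N ->
  Cfactor q p M N r s k u x *
  Vseries q p (q2 (x + M%:R - 2 * s%:R - r%:R + 1))
    [:: q2 (- r%:R); q2 (- s%:R); q2 (x - s%:R + 1);
        q2 (x + M%:R + N%:R - k%:R - s%:R - r%:R + 2);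
        q2 (x + M%:R - k%:R - s%:R - r%:R + 1);
        q2 (k%:R - s%:R) / u; q2 (M%:R - N%:R + k%:R - s%:R + 1) * u] =
  CVseries q p M N r s k u x.
Proof.
move=> rsM sk; rewrite /CVseries /Vseries_reg /Vseries !(@fsbig_nat_trunc _ (minn r s).+1); last 2 first.
- move=> n hn; have [rn|sn] : (r < n)%N \/ (s < n)%N by lia.
    by rewrite (@V_term_zero _ _ r) ?mul0r // inE eqxx.
  by rewrite (@V_term_zero _ _ s) ?mul0r // !inE eqxx orbT.
- move=> n hn; have [rn|sn] : (r < n)%N \/ (s < n)%N by lia.
    by rewrite (@V_term_zero _ _ r) ?mul0r // inE eqxx.
  by rewrite (@V_term_zero _ _ s) ?mul0r // !inE eqxx orbT.
rewrite /Cfactor -mulrA mulrCA mulr_sumr; congr (_ * _).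
rewrite !big_nat; apply: eq_bigr => n hn.
have ns : (n <= s)%N by lia.
set A := x + M%:R - 2 * s%:R - r%:R + 1.
have e1 : q2 1 * q2 A / q2 (x - s%:R + 1) = q2 (M%:R - r%:R - s%:R + 1).
  by rewrite -q2N -!q2D; congr (q2 _); rewrite /A; ring.
have e2 : q2 1 * q2 A / q2 (x + M%:R - k%:R - s%:R - r%:R + 1) = q2 (k%:R - s%:R + 1).
  by rewrite -q2N -!q2D; congr (q2 _); rewrite /A; ring.
rewrite subzn //.
have split y (i : nat) : y = i.+1%:R ->
    poch (q2 y) s = poch (q2 y) n * poch (q2 y * q2 n%:R) (Posz (s - n)) /\ poch (q2 y) n != 0.
  move=> yE; split; first by rewrite -poch_add subnKC.
  rewrite (poch_nat p _ erefl) mulf_neq0 ?qpow_neq0 //.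
  by apply: pb_neq0 => t _; rewrite yE -natrD brn.
have [s1 z1] := split (M%:R - r%:R - s%:R + 1) (M - r - s)%N
  ltac:(by rewrite -natr1 -!natrB //; lia).
have [s2 z2] := split (k%:R - s%:R + 1) (k - s)%N ltac:(by rewrite -natr1 natrB).
rewrite /V_term /Defs.pochs /= !big_cons !big_nil e1 e2 s1 s2 !mulr1.
have [Y1 Y1E] : exists Y, Y = poch (q2 (M%:R - r%:R - s%:R + 1)) n by eexists.
have [Y2 Y2E] : exists Y, Y = poch (q2 (k%:R - s%:R + 1)) n by eexists.
rewrite -Y1E -Y2E in z1 z2 *.
(* Only Y1 and Y2 have to be cancelled; all other factors agree on both sides. *)
have one : Y1 * Y1^-1 * (Y2 * Y2^-1) = 1 by rewrite !mulfV // mulr1.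
rewrite -[RHS]mul1r -[X in _ = X * _]one !invfM; clear.
do 16![move: (poch _ _)]; move=> *; ring.
Qed.

End SummandMatching.

Theorem theorem5p8 (R : realType) (q p : R)
  (hq : 0 < q < 1) (hp : 0 < p < 1)
  (hqp : forall i m : nat, (0 < i)%N -> q ^+ (2 * i) != p ^+ m)
  (W Z : set (Cx R))
  (hW : spectral_domain q W) (hZ : spectral_domain q Z)
  (hWZ : forall w z, W w -> Z z -> theta p (w / z) != 0)
  (EW : ellipticU2 q p W) (EZ : ellipticU2 q p Z)
  (P : cop EW -> EZ -> oper R) (hP : is_cobraiding P)
  (M N r s k j : nat)
  (hr : (r <= M)%N) (hs : (s <= M)%N) (hk : (k <= N)%N) (hj : (j <= N)%N)
  (w z : Cx R) (hw : W w) (hz : Z z) :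
  P (tmat EW M r s w) (tmat EZ N k j z) =
    (if (s + j == r + k)%N then
       mulop (toM (fun l => CVseries q p M N r s k (w / z) l))
         \o Tshift (N%:R + M%:R - 2 * s%:R - 2 * j%:R)
     else 0)
  /\
  ((r + s <= M)%N -> (s <= k)%N ->
   P (tmat EW M r s w) (tmat EZ N k j z) =
     (if (s + j == r + k)%N then
        mulop (toM (fun l =>
          Cfactor q p M N r s k (w / z) l *
          Vseries q p (q2 q (l + M%:R - 2 * s%:R - r%:R + 1))
            [:: q2 q (- r%:R); q2 q (- s%:R); q2 q (l - s%:R + 1);
                q2 q (l + M%:R + N%:R - k%:R - s%:R - r%:R + 2);
                q2 q (l + M%:R - k%:R - s%:R - r%:R + 1);
                q2 q (k%:R - s%:R) * z / w;
                q2 q (M%:R - N%:R + k%:R - s%:R + 1) * w / z]))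
          \o Tshift (N%:R + M%:R - 2 * s%:R - 2 * j%:R)
      else 0)).
Proof.
(* The three properties of the bracket on which everything else rests. *)
have brn i : (0 < i)%N -> br q p i%:R != 0 by move=> i0; exact: br_nat_neq0.
have brm := br_mero hp EZ hz; have bra := br_ae hp EZ hz.
have w0 : w != 0 by case: (hW _ hw).
have z0 : z != 0 by case: (hZ _ hz).
have [v vE] : exists v, w / z = q2 q v.
  have [|v <-] := @q2_surj R q hq (w / z); last by exists v.
  by rewrite mulf_neq0 ?invr_eq0.
(* Integer translates of v correspond to ratios of spectral parameters in the
   two domains, where theta does not vanish. *)
have hv (i : int) : br q p (v + i%:~R) != 0.
  have t0 : theta p (q2 q (v + i%:~R)) != 0.
    case: i => n.
      have := hWZ _ _ (q2_iter hW n hw) hz.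
      by rewrite -mulrA vE -q2D addrC.
    have := hWZ _ _ hw (q2_iter hZ n.+1 hz).
    rewrite invfM mulrCA vE mulrC NegzE rmorphN /=.
    by rewrite -q2N -q2D.
  by apply: contra_neq t0 => t0; rewrite theta_br t0 mulr0.
have main : P (tmat EW M r s w) (tmat EZ N k j z) =
    (if (s + j == r + k)%N then
       mulop (toM (fun l => CVseries q p M N r s k (w / z) l))
         \o Tshift (N%:R + M%:R - 2 * s%:R - 2 * j%:R)
     else 0).
  apply/funext => g.
  rewrite (pair_tmat hq hp brn brm bra hW hZ hP g hw hz vE hv hr hs hk hj).
  case: ifP => // _; rewrite /mulop /=; congr (_ * _); apply: toM_eq.
  have e := ae_sum (t := index_iota (r + s - M) (minn r s).+1)
    (F := series_term q p M N r s k (w / z)) (G := pairing_term q p M N r s k v).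
  have /e {}e l : l \in index_iota (r + s - M) (minn r s).+1 ->
      ae (fun x => series_term q p M N r s k (w / z) x l = pairing_term q p M N r s k v l x).
    by rewrite mem_index_iota vE => hl; exact: series_term_pairing_term.
  by apply: ae_impl e => x <-; rewrite CVseries_finite.
split=> // rsM sk; rewrite main; case: ifP => // _.
congr (mulop (toM _) \o _); apply/funext => l.
rewrite -(CVseries_Vseries hq hp brn N (w / z) l rsM sk); congr (_ * Vseries _ _ _ _).
by rewrite !mulrA invf_div mulrA.
Qed.
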